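(* Let $\lambda=(\lambda_1\ge\dots\ge\lambda_n\ge 0)$ be a partition and let $\mu\in S_n(\lambda)$ be a composition (a rearrangement of $\lambda$). Then the interpolation ASEP polynomial $f^*_\mu(x_1,\dots,x_n;q,t)$ equals the weight-generating function $F^*_\mu=\sum_{Q^{\pm}\in\mathrm{SMLQ}(\mu)}\mathrm{wt}(Q^{\pm})$ of signed multiline queues of type $\mu$. Moreover, the interpolation Macdonald polynomial $P^*_\lambda(x_1,\dots,x_n;q,t)$ equals $Z^*_\lambda=\sum_{\mu\in S_n(\lambda)}F^*_\mu$.
   Context: All polynomials are in $x_1,\dots,x_n$ with coefficients in $\mathbb{Q}(q,t)$. For $\mu\in\mathbb{N}^n$ let $k_i(\mu)=\#\{j<i:\mu_j>\mu_i\}+\#\{j>i:\mu_j\ge\mu_i\}$ and $\widetilde\mu=(q^{\mu_1}t^{-k_1(\mu)},\dots,q^{\mu_n}t^{-k_n(\mu)})$. For $\mu\in\mathbb{N}^n$ with $|\mu|=d$, the nonsymmetric interpolation Macdonald polynomial $E^*_\mu$ is the unique polynomial of degree at most $d$ whose coefficient of $x^\mu=x_1^{\mu_1}\cdots x_n^{\mu_n}$ is $1$ and with $E^*_\mu(\widetilde\nu)=0$ for all $\nu\in\mathbb{N}^n$ with $|\nu|\le d$, $\nu\ne\mu$. $S_n$ acts on compositions by $\sigma\cdot\mu=(\mu_{\sigma^{-1}(1)},\dots,\mu_{\sigma^{-1}(n)})$ and on polynomials by permuting variables; $s_i=(i,i+1)$. The Hecke operator is $T_i=t-\frac{tx_i-x_{i+1}}{x_i-x_{i+1}}(1-s_i)$,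 and $T_\sigma=T_{i_1}\cdots T_{i_\ell}$ for any reduced word $\sigma=s_{i_1}\cdots s_{i_\ell}$. For a partition $\lambda$ and $\mu\in S_n(\lambda)$, $\sigma_\mu$ is the shortest permutation with $\sigma_\mu(\lambda)=\mu$, and $f^*_\mu:=T_{\sigma_\mu}E^*_\lambda$. The interpolation Macdonald polynomial $P^*_\lambda$ is the unique symmetric polynomial of degree at most $|\lambda|$ whose coefficient of the monomial symmetric polynomial $m_\lambda$ is $1$ and which vanishes at $\widetilde\nu$ for every partition $\nu\ne\lambda$ with $|\nu|\le|\lambda|$. Signed multiline queues. Let $L$ be the largest part of $\lambda$ and $m_i=\#\{j:\lambda_j=i\}$. Let $\lambda^{(r)}$ be the multiset consisting of $m_L$ copies of $L$, ..., $m_r$ copies of $r$, and $m_{r-1}+\dots+m_0$ zeros. An enhanced ball system of type $\lambda$ is a $2L\times n$ array with rows labeled bottom to top $1,1',2,2',\dots,L,L'$ and columns $1,\dots,n$ left to right; each position is empty (value $0$) or holds a ball. In row $r$ the balls (''regular balls'') carry labels in $\{1,\dots,L\}$ and the row, read as a word, is a permutation of $\lambda^{(r)}$; in row $r'$ the balls (''signed balls'') carry labels in $\{\pm1,\dots,\pm L\}$ and the word of absolute values is a permutation of $\lambda^{(r)}$ (positive/negative balls according to sign). A signed multiline queue of type $\mu$ is an enhanced ball system of type $\lambda$ whose row $1$ is $\mu$, together with a pairing of every ball in each row above row $1$ with a ball in the row directly below having the same absolute value of label (distinct balls paired to distinct balls), such that: (Classic layers, between row $r\ge2$ and row $(r-1)'$,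 using absolute values of labels:) each pairing connects two balls by a shortest strand going straight down or from left to right, wrapping around cyclically (columns mod $n$) if needed; a ball with label $a$ in row $r$ has either an empty spot directly below it or a ball with absolute label $a'\ge a$, and if $a'=a$ these two balls are paired to each other (trivially paired). (Signed layers, between row $r'$ and row $r$:) each pairing connects two balls by a shortest strand going straight down or from left to right, without wrapping around; a positive ball with label $a$ in row $r'$ always has a ball with label $a'\ge a$ directly below it, and if $a'=a$ they are trivially paired; a negative ball with label $-a$ in row $r'$ has either an empty spot below it or a ball with label $a'\le a$. $\mathrm{SMLQ}(\mu)$ denotes the set of these. For $\mu=(0,\dots,0)$ the only one is the empty queue, of weight $1$. Weights. Ball weight: each positive ball in row $r'$, column $i$, has weight $x_i$; each negative ball in row $r'$ has weight $-q^{r-1}/t^{n-1}$; regular balls have weight $1$; $\mathrm{wt}_{\mathrm{ball}}$ is the product. Pairing weights (only nontrivial pairings get weights; trivial pairings have weight $1$). Classic layer between row $r$ and row $(r-1)'$: read the balls of row $r$ in decreasing order of label, ties broken right to left, and place the strands in this order. Balls of row $(r-1)'$ not yet matched just before placing pairing $p$ are free for $p$, except that when pairing balls of label $a$, balls of label $a$ in row $(r-1)'$ that are trivially paired are not free. If $p$ joins a ball of label $a$ in column $j$ to a ball in column $j'$, $\mathrm{skipped}(p)$ is the number of free balls in columns $j+1,\dots,j'-1$ (mod $n$), and $\mathrm{wt}(p)=\frac{(1-t)t^{\mathrm{skipped}(p)}}{1-q^{a-r+1}t^{\mathrm{free}(p)}}\cdot q^{a-r+1}$ if $j'<j$, and $\frac{(1-t)t^{\mathrm{skipped}(p)}}{1-q^{a-r+1}t^{\mathrm{free}(p)}}$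 if $j'>j$, where $\mathrm{free}(p)$ is the number of free balls for $p$. Signed layer between row $r'$ and row $r$: read the balls of row $r'$ in decreasing order of absolute value, ties right to left, placing strands in this order; free balls are the unmatched balls of row $r$. If $p$ joins a ball labeled $\pm a$ in column $j$ to a ball in column $k>j$, $\mathrm{skipped}(p)$ is the number of free balls and $\mathrm{emp}(p)$ the number of empty positions of row $r$ in columns $j+1,\dots,k-1$, and $\mathrm{wt}(p)=(1-t)t^{\mathrm{skipped}(p)+\mathrm{emp}(p)}$ if the top ball is positive, $-(1-t)t^{\mathrm{skipped}(p)+\mathrm{emp}(p)}$ if it is negative. Then $\mathrm{wt}(Q^{\pm})=\mathrm{wt}_{\mathrm{ball}}(Q^{\pm})\prod_p\mathrm{wt}(p)$. *)

(* Defs.v *)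
From HB Require Import structures.
From mathcomp Require Import all_boot all_order all_algebra all_fingroup.
From mathcomp Require Import fraction.
From mathcomp Require Import mpoly.
From Stdlib Require Import ClassicalEpsilon.

Set Implicit Arguments.
Unset Strict Implicit.
Unset Printing Implicit Defensive.

Import Order.TTheory GRing.Theory Num.Theory.
Local Open Scope ring_scope.

Notation QT := {fraction {poly {poly rat}}}.
Definition qq : QT := FracField.tofrac (('X : {poly rat})%:P : {poly {poly rat}}).
Definition tt : QT := FracField.tofrac ('X : {poly {poly rat}}).

Definition kk (n : nat) (mu : 'X_{1..n}) (i : 'I_n) : nat :=
  (#|[pred j : 'I_n | (j < i)%N && (mu i < mu j)%N]|
   + #|[pred j : 'I_n | (i < j)%N && (mu i <= mu j)%N]|)%N.

Definition tilde (n : nat) (mu : 'X_{1..n}) : 'I_n -> QT :=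
  fun i => qq ^+ (mu i) * tt ^- (kk mu i).

Definition is_Estar (n : nat) (mu : 'X_{1..n}) (E : {mpoly QT[n]}) : Prop :=
  [/\ (msize E <= (mdeg mu).+1)%N,
      E@_mu = 1 &
      forall nu : 'X_{1..n}, (mdeg nu <= mdeg mu)%N -> nu <> mu ->
        E.@[tilde nu] = 0].

Definition Estar (n : nat) (mu : 'X_{1..n}) : {mpoly QT[n]} :=
  epsilon (inhabits (0 : {mpoly QT[n]})) (is_Estar mu).

Definition is_partition (n : nat) (la : 'X_{1..n}) : Prop :=
  forall i j : 'I_n, (i <= j)%N -> (la j <= la i)%N.

(* interpolation Macdonald polynomial P*_lambda; for a symmetric       *)
(* polynomial the coefficient of m_lambda is the coefficient of x^lambda *)
Definition is_Pstar (n : nat) (la : 'X_{1..n}) (P : {mpoly QT[n]}) : Prop :=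
  [/\ P \is mpoly.symmetric,
      (msize P <= (mdeg la).+1)%N,
      P@_la = 1 &
      forall nu : 'X_{1..n}, is_partition nu -> nu <> la ->
        (mdeg nu <= mdeg la)%N -> P.@[tilde nu] = 0].

Definition Pstar (n : nat) (la : 'X_{1..n}) : {mpoly QT[n]} :=
  epsilon (inhabits (0 : {mpoly QT[n]})) (is_Pstar la).

Definition pact (n : nat) (s : 'S_n) (mu : 'X_{1..n}) : 'X_{1..n} :=
  [multinom mu ((s^-1)%g i) | i < n].

(* simple transpositions s_i = (i, i+1); only letters i with i+1 < n   *)
(* are used in words.                                                  *)
Definition nxt (n : nat) (i : 'I_n) : 'I_n := insubd i i.+1.
Definition sgen (n : nat) (i : 'I_n) : 'S_n := tperm i (nxt i).
Definition valid_word (n : nat) (w : seq 'I_n) : bool :=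
  all (fun i : 'I_n => (i.+1 < n)%N) w.

(* word_perm [:: i1; ...; il] = s_{i1} o ... o s_{il} (as functions) *)
Fixpoint word_perm (n : nat) (w : seq 'I_n) : 'S_n :=
  match w with
  | [::] => 1%g
  | i :: w' => (word_perm w' * sgen i)%g
  end.

Definition reduced_word (n : nat) (s : 'S_n) (w : seq 'I_n) : Prop :=
  [/\ valid_word w, word_perm w = s &
      forall w', valid_word w' -> word_perm w' = s -> (size w <= size w')%N].

Definition shortest_perm (n : nat) (la mu : 'X_{1..n}) (s : 'S_n) : Prop :=
  pact s la = mu /\
  exists w, reduced_word s w /\
    forall (s' : 'S_n) (w' : seq 'I_n), pact s' la = mu -> valid_word w' ->
      word_perm w' = s' -> (size w <= size w')%N.

Definition sigma_mu (n : nat) (la mu : 'X_{1..n}) : 'S_n :=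
  epsilon (inhabits 1%g) (shortest_perm la mu).

(* Hecke operator T_i = t - (t x_i - x_{i+1})/(x_i - x_{i+1}) (1 - s_i): *)
(* T_i f is the (unique) polynomial g with                              *)
(* (x_i - x_{i+1}) g = t (x_i - x_{i+1}) f - (t x_i - x_{i+1}) (f - s_i f) *)
Definition is_hecke (n : nat) (i : 'I_n) (f g : {mpoly QT[n]}) : Prop :=
  ('X_i - 'X_(nxt i)) * g
  = tt *: (('X_i - 'X_(nxt i)) * f)
    - (tt *: 'X_i - 'X_(nxt i)) * (f - msym (sgen i) f).

Definition hecke (n : nat) (i : 'I_n) (f : {mpoly QT[n]}) : {mpoly QT[n]} :=
  epsilon (inhabits (0 : {mpoly QT[n]})) (is_hecke i f).

Definition heckeT (n : nat) (s : 'S_n) (f : {mpoly QT[n]}) : {mpoly QT[n]} :=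
  foldr (@hecke n) f (epsilon (inhabits [::]) (reduced_word s)).

Definition fstar (n : nat) (la mu : 'X_{1..n}) : {mpoly QT[n]} :=
  heckeT (sigma_mu la mu) (Estar la).

Definition maxpart (n : nat) (la : 'X_{1..n}) : nat := (\max_(i < n) la i)%N.

Definition lamr (n : nat) (la : 'X_{1..n}) (r : nat) : seq nat :=
  [seq (if (r <= la i)%N then la i else 0%N) | i <- enum 'I_n].

(* A data point Q = (R, S, PS, PC), rows indexed by r : 'I_L standing for *)
(* row number r+1:                                                       *)
(*  R r j        : label (0 = empty) of row r+1 (regular row), column j  *)
(*  S r j        : (absolute label, sign) of row (r+1)', column j;       *)
(*                 sign true = positive; empty spots carry sign true     *)
(*  PS r j       : column in row r+1 of the ball paired with the ball of *)
(*                 row (r+1)' in column j (= j if there is no ball)      *)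
(*  PC r j (r>0) : column in row r' of the ball paired with the ball of  *)
(*                 row r+1 in column j (= j if no ball; PC 0 = id)       *)
Notation qdata n L :=
  ({ffun 'I_L -> {ffun 'I_n -> 'I_L.+1}}
   * {ffun 'I_L -> {ffun 'I_n -> 'I_L.+1 * bool}}
   * {ffun 'I_L -> {ffun 'I_n -> 'I_n}}
   * {ffun 'I_L -> {ffun 'I_n -> 'I_n}})%type.

Definition reg {n L : nat} (Q : qdata n L) (r : 'I_L) (j : 'I_n) : nat :=
  Q.1.1.1 r j.
Definition sab {n L : nat} (Q : qdata n L) (r : 'I_L) (j : 'I_n) : nat :=
  (Q.1.1.2 r j).1.
Definition spos {n L : nat} (Q : qdata n L) (r : 'I_L) (j : 'I_n) : bool :=
  (Q.1.1.2 r j).2.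
Definition ps {n L : nat} (Q : qdata n L) (r : 'I_L) (j : 'I_n) : 'I_n :=
  Q.1.2 r j.
Definition pc {n L : nat} (Q : qdata n L) (r : 'I_L) (j : 'I_n) : 'I_n :=
  Q.2 r j.

Definition opred (L : nat) (r : 'I_L) : 'I_L := insubd r r.-1.

Definition ball_ok {n L : nat} (la : 'X_{1..n}) (Q : qdata n L) : bool :=
  [forall r : 'I_L,
    [&& perm_eq [seq reg Q r j | j <- enum 'I_n] (lamr la r.+1),
        perm_eq [seq sab Q r j | j <- enum 'I_n] (lamr la r.+1) &
        [forall j : 'I_n, (sab Q r j == 0%N) ==> spos Q r j]]].

Definition row1_ok {n L : nat} (mu : 'X_{1..n}) (Q : qdata n L) : bool :=
  [forall r : 'I_L, (r == 0%N :> nat) ==> [forall j : 'I_n, reg Q r j == mu j]].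

Definition signed_ok {n L : nat} (Q : qdata n L) : bool :=
  [forall r : 'I_L,
    [forall j : 'I_n,
      if sab Q r j == 0%N then ps Q r j == j else
      [&& reg Q r (ps Q r j) == sab Q r j,
          (j <= ps Q r j)%N &
          if spos Q r j then
            (sab Q r j <= reg Q r j)%N
            && ((reg Q r j == sab Q r j) ==> (ps Q r j == j))
          else (reg Q r j <= sab Q r j)%N]]
    && [forall j1 : 'I_n, forall j2 : 'I_n,
          [&& sab Q r j1 != 0%N, sab Q r j2 != 0%N & ps Q r j1 == ps Q r j2]
          ==> (j1 == j2)]].

Definition classic_ok {n L : nat} (Q : qdata n L) : bool :=
  [forall r : 'I_L,
    if r == 0%N :> nat then [forall j : 'I_n, pc Q r j == j] else
    [forall j : 'I_n,
      if reg Q r j == 0%N then pc Q r j == j else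
      [&& sab Q (opred r) (pc Q r j) == reg Q r j,
          (sab Q (opred r) j == 0%N) || (reg Q r j <= sab Q (opred r) j)%N &
          (sab Q (opred r) j == reg Q r j) ==> (pc Q r j == j)]]
    && [forall j1 : 'I_n, forall j2 : 'I_n,
          [&& reg Q r j1 != 0%N, reg Q r j2 != 0%N & pc Q r j1 == pc Q r j2]
          ==> (j1 == j2)]].

Definition is_smlq {n L : nat} (la mu : 'X_{1..n}) (Q : qdata n L) : bool :=
  [&& ball_ok la Q, row1_ok mu Q, signed_ok Q & classic_ok Q].

Definition ballwt {n L : nat} (Q : qdata n L) : {mpoly QT[n]} :=
  \prod_(r : 'I_L) \prod_(j : 'I_n | sab Q r j != 0%N)
     (if spos Q r j then 'X_j else (- (qq ^+ r / tt ^+ n.-1))%:MP).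

Definition sweight {n L : nat} (Q : qdata n L) (r : 'I_L) (j : 'I_n) : QT :=
  let a := sab Q r j in
  let k := ps Q r j in
  let earlier (j2 : 'I_n) :=
    (sab Q r j2 != 0%N)
    && ((a < sab Q r j2)%N || ((sab Q r j2 == a) && (j < j2)%N)) in
  let matched (k2 : 'I_n) := [exists j2 : 'I_n, earlier j2 && (ps Q r j2 == k2)] in
  let free (k2 : 'I_n) := (reg Q r k2 != 0%N) && ~~ matched k2 in
  let between (k2 : 'I_n) := (j < k2)%N && (k2 < k)%N in
  let sk := #|[pred k2 : 'I_n | between k2 && free k2]| in
  let em := #|[pred k2 : 'I_n | between k2 && (reg Q r k2 == 0%N)]| in
  (if spos Q r j then 1 else -1) * (1 - tt) * tt ^+ (sk + em).

Definition cweight {n L : nat} (Q : qdata n L) (r : 'I_L) (j : 'I_n) : QT :=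
  let r0 := opred r in
  let a := reg Q r j in
  let k := pc Q r j in
  let e := (a - r)%N in (* = a - (r+1) + 1 *)
  let earlier (j2 : 'I_n) :=
    (reg Q r j2 != 0%N)
    && ((a < reg Q r j2)%N || ((reg Q r j2 == a) && (j < j2)%N)) in
  let matched (k2 : 'I_n) := [exists j2 : 'I_n, earlier j2 && (pc Q r j2 == k2)] in
  let trivp (k2 : 'I_n) := (sab Q r0 k2 == a) && (reg Q r k2 == a) in
  let free (k2 : 'I_n) :=
    [&& sab Q r0 k2 != 0%N, ~~ matched k2 & ~~ trivp k2] in
  let between (k2 : 'I_n) :=
    if (j < k)%N then (j < k2)%N && (k2 < k)%N
    else (j < k2)%N || (k2 < k)%N in
  let fr := #|[pred k2 : 'I_n | free k2]| in
  let sk := #|[pred k2 : 'I_n | between k2 && free k2]| in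
  (1 - tt) * tt ^+ sk / (1 - qq ^+ e * tt ^+ fr)
  * (if (k < j)%N then qq ^+ e else 1).

Definition wt {n L : nat} (Q : qdata n L) : {mpoly QT[n]} :=
  ballwt Q
  * (\prod_(r : 'I_L) \prod_(j : 'I_n | (sab Q r j != 0%N) && (ps Q r j != j))
        (sweight Q r j)%:MP)
  * (\prod_(r : 'I_L | r != 0%N :> nat)
        \prod_(j : 'I_n | (reg Q r j != 0%N) && (pc Q r j != j))
        (cweight Q r j)%:MP).

Definition Fstar (n : nat) (la mu : 'X_{1..n}) : {mpoly QT[n]} :=
  \sum_(Q : qdata n (maxpart la) | is_smlq la mu Q) wt Q.

Definition Zstar (n : nat) (la : 'X_{1..n}) : {mpoly QT[n]} :=
  \sum_(mu <- undup [seq pact s la | s <- enum 'S_n]) Fstar la mu.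

(* Main.v *)
(* A queue is read as a path of rows.  For fixed row contents the sum over the pairings of one
   layer factors over the labels [a]: pairing balls from right to left amounts to evaluating a
   polynomial [P_a] by the functional [u^i |-> 1 / (1 - q^e t^i)] (classic layer) or at [u = 1]
   (signed layer), where the column factors of [P_a] only depend on the number of strands of
   species [a] above the column.  These closed forms satisfy two-column exchange relations, so
   the generating functions [F_mu] of the queues above any given row satisfy
   [T_i F_mu = F_(s_i mu)] for [mu_i > mu_(i+1)], and they are cyclically covariant up to terms
   of lower degree.

   Vanishing is proved by descending induction on the row.  If [f] and [g] vanish at the spectral
   points of degree less than [d] and [g] is the leading part of the rotation [om] applied to
   [T_(n-1) ... T_1 f], then [x_1 g = theta f + (x_1 - theta t^(1-n)) om T_(n-1) ... T_1 f].  On a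
   row with an empty last column this makes cyclic covariance exact, which yields the vanishing of
   [F_la] in degree less than [|la|].  In the bottom row the same identity combined with the
   relation [T_i^-1 X_i^-1 T_i^-1 = t^-1 X_(i+1)^-1] makes [F_la] an eigenfunction of all spectral
   coordinates on the points of degree [|la|], hence [F_la] is [E*_la].  The sum of all [F_mu] is
   symmetric and inherits the vanishing conditions that characterise [P*_la]. *)

Require Import Defs.
From HB Require Import structures.
From mathcomp Require Import all_boot all_order all_algebra all_fingroup.
From mathcomp Require Import fraction.
From mathcomp Require Import mpoly.
From mathcomp Require Import zify ring.
From Stdlib Require Import ClassicalEpsilon FunctionalExtensionality.

Set Implicit Arguments.
Unset Strict Implicit.
Unset Printing Implicit Defensive.

Import Order.TTheory GRing.Theory Num.Theory.
Local Open Scope ring_scope.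

(** * Substitutions in multivariate polynomials *)

(** The denominators [1 - q^e t^free] are resummed geometric series: expanding them records how
    often a strand winds around the cylinder, and one full turn replaces [u] by [t u]. The closed
    form is thus a functional on polynomials in [u] for which wrapping is a shift of a series. Zero
    plays two roles. A classic layer lets any ball stand above an empty spot, so there an empty spot
    below behaves like an infinite label; in a signed layer empty spots count in the exponent like a
    smallest label. Functions attached to regular rows therefore satisfy exchange relations with 0
    as smallest label, those attached to signed rows relations with 0 as largest label, where moving
    an empty spot costs [t]. The two kinds of layers exchange the two kinds of relations. The
    constant [q^(r-1) t^(1-n)] of the negative balls is the coordinate of a dilated spectral point
    at its first zero part; this is why linear factors vanish there. The points of top degree need
    an argument of their own, because cyclic covariance of the bottom row holds only up to lower
    degree. *)

Section Substitution.
Variable K : fieldType.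

Lemma mpoly_gen_ind (n : nat) (P : {mpoly K[n]} -> Prop) :
  (forall c, P c%:MP) -> (forall i, P 'X_i) ->
  (forall f g, P f -> P g -> P (f + g)) ->
  (forall f g, P f -> P g -> P (f * g)) -> forall f, P f.
Proof.
move=> PC PX PD PM; apply: mpolyind; first by have := PC 0; rewrite mpolyC0.
move=> c m p _ _ Pp; apply: (PD) => //; rewrite -mul_mpolyC; apply: (PM) => //.
rewrite mpolyXE_id; apply: big_ind => [|f g|i _]; [exact: (PC 1)|exact: PM|].
by elim: (m i) => [|k IH]; [exact: (PC 1) | rewrite exprS; exact: PM].
Qed.

(** One notion serves the action of permutations, the rotation with its scalars and the restriction
    to hyperplanes, so that composition and evaluation are treated once. *)
Definition subst (n k : nat) (h : 'I_n -> {mpoly K[k]}) (p : {mpoly K[n]}) :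
  {mpoly K[k]} := mmap (@mpolyC k K) h p.

Section Morphism.
Variables (n k : nat) (h : 'I_n -> {mpoly K[k]}).

Lemma subst_is_additive : additive (subst h).
Proof. exact: mmap_is_additive. Qed.
Lemma subst_is_multiplicative : multiplicative (subst h).
Proof. exact: mmap_is_multiplicative. Qed.
HB.instance Definition _ :=
  GRing.isAdditive.Build {mpoly K[n]} {mpoly K[k]} (subst h) subst_is_additive.
HB.instance Definition _ :=
  GRing.isMultiplicative.Build {mpoly K[n]} {mpoly K[k]} (subst h)
    subst_is_multiplicative.

Lemma substC c : subst h c%:MP = c%:MP.
Proof. exact: mmapC. Qed.
Lemma substX i : subst h 'X_i = h i.
Proof. by rewrite /subst mmapX mmap1U. Qed.
Lemma substZ c p : subst h (c *: p) = c *: subst h p.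
Proof. by rewrite -!mul_mpolyC rmorphM /= substC. Qed.

Lemma meval_subst v p : (subst h p).@[v] = p.@[fun i => (h i).@[v]].
Proof.
elim/mpoly_gen_ind: p => [c|i|f g Hf Hg|f g Hf Hg].
- by rewrite substC !mevalC.
- by rewrite substX mevalXU.
- by rewrite rmorphD /= !mevalD Hf Hg.
- by rewrite rmorphM /= !mevalM Hf Hg.
Qed.

Lemma msize_subst p : (forall i, msize (h i) <= 2)%N ->
  (msize (subst h p) <= msize p)%N.
Proof.
move=> Hh.
have HM (f g : {mpoly K[k]}) a b : (msize f <= a.+1)%N -> (msize g <= b.+1)%N ->
    (msize (f * g) <= (a + b).+1)%N.
  have [-> _ _|f0] := eqVneq f 0; first by rewrite mul0r msize0.
  have [-> _ _|g0] := eqVneq g 0; first by rewrite mulr0 msize0.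
  by rewrite msizeM //; move: (msize f) (msize g) => u v; clear; lia.
rewrite [X in (msize (subst h X) <= _)%N]mpolyE raddf_sum /=.
apply: (leq_trans (msize_sum _ _ _)); apply/bigmax_leqP_seq => m Hm _.
rewrite substZ; apply: leq_trans (msizeZ_le _ _) _.
apply: leq_trans (msize_mdeg_lt Hm).
rewrite mpolyXE_id rmorph_prod /= mdegE.
elim/big_rec2: _ => [|i y p' _ IH]; first by rewrite msize1.
rewrite rmorphXn /= substX; apply: (HM _ _ (m i) y _ IH).
elim: (m i) => [|e IHe]; first by rewrite expr0 msize1.
by rewrite exprS -add1n; apply: (HM _ _ 1%N e).
Qed.

End Morphism.

(** A congruence modulo [p0] between substitutions may be checked on the variables. It yields the
    factor theorem [factor_at] and the divisibility of [f - s_i f] by [x_i - x_(i+1)]. *)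
Lemma subst_dvd (n k : nat) (p0 : {mpoly K[k]}) (h h' : 'I_n -> {mpoly K[k]}) p :
  (forall i, exists z, h' i - h i = p0 * z) ->
  exists z, subst h' p - subst h p = p0 * z.
Proof.
move=> H; elim/mpoly_gen_ind: p => [c|i|f g [z Hz] [z' Hz']|f g [z Hz] [z' Hz']].
- by exists 0; rewrite !substC subrr mulr0.
- by have [z Hz] := H i; exists z; rewrite !substX.
- by exists (z + z'); rewrite mulrDr -Hz -Hz' !rmorphD opprD addrACA.
- exists (z * subst h' g + subst h f * z').
  by rewrite !rmorphM /= mulrDr mulrA -Hz mulrCA -Hz' mulrBl mulrBr addrA subrK.
Qed.

Lemma subst_ext (n k : nat) (h h' : 'I_n -> {mpoly K[k]}) p :
  h =1 h' -> subst h p = subst h' p.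
Proof.
move=> E; elim/mpoly_gen_ind: p => [c|i|f g Hf Hg|f g Hf Hg].
- by rewrite !substC.
- by rewrite !substX.
- by rewrite !rmorphD /= Hf Hg.
- by rewrite !rmorphM /= Hf Hg.
Qed.

Lemma subst_subst (n k l : nat) (h : 'I_n -> {mpoly K[k]})
    (h' : 'I_k -> {mpoly K[l]}) p :
  subst h' (subst h p) = subst (fun i => subst h' (h i)) p.
Proof.
elim/mpoly_gen_ind: p => [c|i|f g Hf Hg|f g Hf Hg].
- by rewrite !substC.
- by rewrite !substX.
- by rewrite !rmorphD /= Hf Hg.
- by rewrite !rmorphM /= Hf Hg.
Qed.

Lemma subst_id (n : nat) (p : {mpoly K[n]}) : subst (fun i => 'X_i) p = p.
Proof.
elim/mpoly_gen_ind: p => [c|i|f g Hf Hg|f g Hf Hg].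
- by rewrite !substC.
- by rewrite !substX.
- by rewrite !rmorphD /= Hf Hg.
- by rewrite !rmorphM /= Hf Hg.
Qed.

Lemma msymE_subst (n : nat) (s : 'S_n) (p : {mpoly K[n]}) :
  msym s p = subst (fun i => 'X_(s i)) p.
Proof. by []. Qed.

Lemma subst_msym (n k : nat) (h : 'I_n -> {mpoly K[k]}) (s : 'S_n) p :
  subst h (msym s p) = subst (fun i => h (s i)) p.
Proof.
by rewrite msymE_subst subst_subst; apply: subst_ext => i; rewrite substX.
Qed.

Lemma meval_msym (n : nat) (v : 'I_n -> K) (s : 'S_n) (p : {mpoly K[n]}) :
  (msym s p).@[v] = p.@[fun i => v (s i)].
Proof. by rewrite msymE_subst meval_subst; apply: meval_eq => i; rewrite mevalXU. Qed.

Lemma mpolyX_sub_neq0 (n : nat) (i j : 'I_n) : i != j ->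
  'X_i - 'X_j != 0 :> {mpoly K[n]}.
Proof.
move=> ij; apply/eqP => /(congr1 (mcoeff U_(i)%MM)).
rewrite mcoeffB !mcoeffXU eqxx eq_sym (negPf ij) mcoeff0 subr0 => /eqP.
by rewrite oner_eq0.
Qed.

Lemma msizeXC (n : nat) (i : 'I_n) (c : K) :
  msize ('X_i - c%:MP : {mpoly K[n]}) = 2%N.
Proof.
apply/eqP; rewrite eqn_leq; apply/andP; split.
  apply: leq_trans (msizeD_le _ _) _.
  by rewrite geq_max msizeX mdeg1 msizeN msizeC; case: (c == 0).
have : U_(i)%MM \in msupp ('X_i - c%:MP : {mpoly K[n]}).
  rewrite mcoeff_msupp mcoeffB mcoeffXU eqxx mcoeffC mnm1_eq0 mulr0 subr0.
  exact: oner_neq0.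
by move=> /msize_mdeg_lt; rewrite mdeg1.
Qed.

Lemma mpolyXC_neq0 (n : nat) (i : 'I_n) (c : K) : 'X_i - c%:MP != 0 :> {mpoly K[n]}.
Proof. by rewrite -msize_poly_eq0 msizeXC. Qed.

Lemma msizeXC_mul (n : nat) (i : 'I_n) (c : K) (z : {mpoly K[n]}) : z != 0 ->
  msize (('X_i - c%:MP) * z) = (msize z).+1.
Proof. by move=> z0; rewrite msizeM ?mpolyXC_neq0 // msizeXC. Qed.

Definition restr_at (n : nat) (i : 'I_n) (c : K) : 'I_n -> {mpoly K[n]} :=
  fun j => if j == i then c%:MP else 'X_j.

Lemma factor_at (n : nat) (i : 'I_n) (c : K) (f : {mpoly K[n]}) d :
  subst (restr_at i c) f = 0 -> (msize f <= d.+1)%N ->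
  exists2 z, f = ('X_i - c%:MP) * z & (msize z <= d)%N.
Proof.
move=> f0 sf.
have [|z] := @subst_dvd n n ('X_i - c%:MP) (restr_at i c) (fun j => 'X_j) f.
  move=> j; rewrite /restr_at; case: eqP => [->|_]; first by exists 1; rewrite mulr1.
  by exists 0; rewrite subrr mulr0.
rewrite f0 subr0 subst_id => E; exists z => //.
have [->|z0] := eqVneq z 0; first by rewrite msize0.
by move: sf; rewrite E msizeXC_mul.
Qed.

End Substitution.

(** * Spectral points and uniqueness of interpolation *)

(* Multiplicative independence of [q] and [t] is all that is used about the field [Q(q,t)]. *)
Record generic_pair := GenericPair {
  gfield :> fieldType;
  gq : gfield;
  gt : gfield;
  g_inj : forall a b c d : nat, gq ^+ a * gt ^+ b = gq ^+ c * gt ^+ d ->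
    a = c /\ b = d }.

Section GenericPairTheory.
Variable K : generic_pair.
Local Notation qq := (gq K).
Local Notation tt := (gt K).

Lemma qq_neq0 : qq != 0.
Proof.
apply/eqP => q0; have [] : 1%N = 2%N /\ 0%N = 0%N by apply: (@g_inj K); rewrite q0 !expr0n.
by [].
Qed.

Lemma tt_neq0 : tt != 0.
Proof.
apply/eqP => t0; have [] : 0%N = 0%N /\ 1%N = 2%N by apply: (@g_inj K); rewrite t0 !expr0n.
by [].
Qed.

Lemma expqq_neq0 k : qq ^+ k != 0. Proof. exact: expf_neq0 qq_neq0. Qed.
Lemma exptt_neq0 k : tt ^+ k != 0. Proof. exact: expf_neq0 tt_neq0. Qed.

Lemma qt_neq1 e k : (0 < e)%N -> 1 - qq ^+ e * tt ^+ k != 0.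
Proof.
move=> e0; rewrite subr_eq0; apply/eqP => E.
have [] : 0%N = e /\ 0%N = k by apply: (@g_inj K); rewrite -E !expr0 mulr1.
by move=> E0; rewrite -E0 in e0.
Qed.

Lemma qt_div_inj a b c d :
  qq ^+ a * tt ^- b = qq ^+ c * tt ^- d -> a = c /\ b = d.
Proof.
move=> E; suff [-> ->] : a = c /\ d = b by [].
apply: (@g_inj K); move: E => /(congr1 (fun z => z * tt ^+ (b + d))).
rewrite {1}exprD addnC exprD !mulrA.
by rewrite !mulfVK ?exptt_neq0 // mulrA mulfVK ?exptt_neq0.
Qed.

End GenericPairTheory.

Section Spectral.

Lemma sum_ord_eq (n : nat) (i : 'I_n) : (\sum_(j < n) (j == i : nat) = 1)%N.
Proof. by rewrite (bigD1 i) //= eqxx big1 // => j /negPf->. Qed.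

(** The statistic [kk] as a sum over pairs of columns: reindexing by a rotation or a transposition
    then acts on single terms. *)
Definition kterm (n : nat) (mu : 'I_n -> nat) (i j : 'I_n) : nat :=
  ((j < i)%N && (mu i < mu j)%N) + ((i < j)%N && (mu i <= mu j)%N).

Lemma kkE (n : nat) (mu : 'X_{1..n}) (i : 'I_n) :
  kk mu i = (\sum_(j < n) kterm mu i j)%N.
Proof.
rewrite /kk -!sum1_card big_mkcond [X in (_ + X)%N]big_mkcond -big_split /=.
by apply: eq_bigr => j _; rewrite /kterm !inE; do 2 case: ifP.
Qed.

Section Points.
Variable K : generic_pair.
Local Notation qq := (gq K).
Local Notation tt := (gt K).

Definition gtilde (n : nat) (mu : 'X_{1..n}) : 'I_n -> K :=
  fun i => qq ^+ (mu i) * tt ^- (kk mu i).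
Local Notation tilde := (@gtilde _).

Definition pt (n : nat) (c : K) (mu : 'X_{1..n}) : 'I_n -> K :=
  fun i => c * tilde mu i.

Lemma pt1 (n : nat) (mu : 'X_{1..n}) : pt 1 mu =1 tilde mu.
Proof. by move=> i; rewrite /pt mul1r. Qed.

(** Rotates to the right and raises the wrapped part by one. The spectral vector is rotated too,
    with an extra [q] in the wrapped coordinate ([tilde_mshift]), and every composition with
    positive first part arises in this way. *)
Definition mshift (n : nat) (mu : 'X_{1..n.+1}) : 'X_{1..n.+1} :=
  [multinom (mu (ord_pred i) + (i == ord0))%N | i < n.+1].
Definition munshift (n : nat) (mu : 'X_{1..n.+1}) : 'X_{1..n.+1} :=
  [multinom (mu (ordS i) - (i == ord_max))%N | i < n.+1].

Lemma val_ordS (n : nat) (i : 'I_n.+1) :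
  (ordS i : nat) = if i == ord_max then 0%N else i.+1.
Proof.
rewrite /=; case: eqP => [->|/eqP H] /=; first by rewrite modnn.
by rewrite modn_small // ltn_neqAle ltn_ord andbT eqSS.
Qed.

Lemma ordS_eq0 (n : nat) (i : 'I_n.+1) : (ordS i == ord0) = (i == ord_max).
Proof. by rewrite -val_eqE (val_ordS i : \val (ordS i) = _); case: (i == ord_max). Qed.

Lemma ord_pred_eqmax (n : nat) (i : 'I_n.+1) : (ord_pred i == ord_max) = (i == ord0).
Proof. by rewrite -ordS_eq0 ord_predK. Qed.

Lemma mdeg_mshift (n : nat) (mu : 'X_{1..n.+1}) :
  mdeg (mshift mu) = (mdeg mu).+1.
Proof.
rewrite !mdegE (reindex_inj (can_inj (@ordSK _))) /=.
under eq_bigr do rewrite mnmE ordSK ordS_eq0.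
by rewrite big_split /= sum_ord_eq addn1.
Qed.

Lemma munshiftK (n : nat) (mu : 'X_{1..n.+1}) : (0 < mu ord0)%N ->
  mshift (munshift mu) = mu.
Proof.
move=> H; apply/mnmP => i; rewrite !mnmE ord_predK ord_pred_eqmax.
by case: eqP => [->|_]; rewrite ?subn0 ?addn0 // subnK.
Qed.

Lemma kk_mshift (n : nat) (mu : 'X_{1..n.+1}) i :
  kk (mshift mu) (ordS i) = kk mu i.
Proof.
rewrite !kkE (reindex_inj (can_inj (@ordSK _))) /=.
apply: eq_bigr => j _; rewrite /kterm !mnmE !ordSK !ordS_eq0 !val_ordS.
case: (eqVneq i ord_max) => [->|]; case: (eqVneq j ord_max) => [->|] //=;
  rewrite -?val_eqE /=; have := ltn_ord i; have := ltn_ord j; lia.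
Qed.

Lemma tilde_mshift (n : nat) (mu : 'X_{1..n.+1}) i :
  tilde (mshift mu) (ordS i) = (if i == ord_max then qq else 1) * tilde mu i.
Proof.
rewrite /gtilde kk_mshift mnmE ordSK ordS_eq0.
by case: (i == ord_max); rewrite ?addn0 ?mul1r // addn1 exprS mulrA.
Qed.

Lemma kk_eq0 (n : nat) (mu : 'X_{1..n.+1}) : mu ord0 = 0%N -> kk mu ord0 = n.
Proof.
move=> H; rewrite kkE big_ord_recl.
rewrite (eq_bigr (fun=> 1%N)) => [|i _]; last by rewrite /kterm /= H.
by rewrite sum_nat_const card_ord muln1.
Qed.

Lemma tilde_eq0 (n : nat) (mu : 'X_{1..n.+1}) : mu ord0 = 0%N ->
  tilde mu ord0 = tt ^- n.
Proof. by move=> H; rewrite /gtilde H kk_eq0 // expr0 mul1r. Qed.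

Definition mcons0 (n : nat) (mu : 'X_{1..n}) : 'X_{1..n.+1} :=
  [multinom (if unlift ord0 i is Some j then mu j else 0%N) | i < n.+1].

Lemma mdeg_mcons0 (n : nat) (mu : 'X_{1..n}) : mdeg (mcons0 mu) = mdeg mu.
Proof.
rewrite !mdegE big_ord_recl mnmE unlift_none add0n.
by apply: eq_bigr => i _; rewrite mnmE liftK.
Qed.

Lemma tilde_mcons0 (n : nat) (mu : 'X_{1..n}) i :
  tilde (mcons0 mu) (lift ord0 i) = tilde mu i.
Proof.
rewrite /gtilde !kkE mnmE liftK big_ord_recl; congr (_ * _ ^- _).
rewrite {1}/kterm !mnmE liftK unlift_none ltn0 andbF add0n.
by apply: eq_bigr => j _; rewrite /kterm !mnmE !liftK.
Qed.

Section Swap.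
Variables (n : nat) (i : 'I_n).
Hypothesis Hi : (i.+1 < n)%N.

Lemma val_nxt : (nxt i : nat) = i.+1.
Proof. by rewrite /nxt val_insubd Hi. Qed.

Lemma nxt_neq : i != nxt i.
Proof. by rewrite -val_eqE /= val_nxt; lia. Qed.

Lemma sgenL : sgen i i = nxt i. Proof. by rewrite /sgen tpermL. Qed.
Lemma sgenR : sgen i (nxt i) = i. Proof. by rewrite /sgen tpermR. Qed.
Lemma sgenK : involutive (sgen i). Proof. exact: tpermK. Qed.

Lemma val_sgen (j : 'I_n) : (sgen i j : nat) =
  if (j : nat) == i then i.+1 else if (j : nat) == i.+1 then (i : nat) else j.
Proof.
rewrite /sgen; case: tpermP => [->|->|/eqP H1 /eqP H2].
- by rewrite eqxx val_nxt.
- by rewrite val_nxt eqxx; case: eqP => //; lia.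
- rewrite -val_eqE in H1; rewrite -val_eqE /= val_nxt in H2.
  by rewrite (negPf H1) (negPf H2).
Qed.

Definition mswap (mu : 'X_{1..n}) : 'X_{1..n} := [multinom mu (sgen i j) | j < n].

Lemma mdeg_mswap mu : mdeg (mswap mu) = mdeg mu.
Proof.
rewrite !mdegE [RHS](reindex_inj (can_inj sgenK)) /=.
by apply: eq_bigr => j _; rewrite mnmE.
Qed.

Lemma mswapK : involutive mswap.
Proof. by move=> mu; apply/mnmP => j; rewrite !mnmE sgenK. Qed.

Lemma tilde_mswap (mu : 'X_{1..n}) j : mu i != mu (nxt i) ->
  tilde (mswap mu) j = tilde mu (sgen i j).
Proof.
move=> H; rewrite /gtilde mnmE; congr (_ * _ ^- _); rewrite !kkE.
rewrite (reindex_inj (can_inj sgenK)) /=; apply: eq_bigr => k _.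
rewrite /kterm !mnmE sgenK.
have [j' ->] : exists j', j = sgen i j' by exists (sgen i j); rewrite sgenK.
rewrite sgenK !val_sgen.
have Hne : nxt i <> i by move=> E; move: (nxt_neq); rewrite E eqxx.
case: (eqVneq (j' : nat) i) => [/val_inj E|]; case: (eqVneq (k : nat) i) => [/val_inj E'|];
case: (eqVneq (j' : nat) (nxt i)) => [/val_inj F|]; case: (eqVneq (k : nat) (nxt i)) => [/val_inj F'|];
  try (by case: Hne; rewrite -F -E); try (by case: Hne; rewrite -F' -E');
  rewrite ?E ?E' ?F ?F' ?val_nxt; move: H; do ?case: ifP; lia.
Qed.

Lemma kk_nxt_eq (mu : 'X_{1..n}) : mu i = mu (nxt i) ->
  kk mu i = (kk mu (nxt i)).+1.
Proof.
move=> H; rewrite !kkE -addn1.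
have -> : (1 = \sum_(j < n) (j == nxt i : nat))%N by rewrite sum_ord_eq.
rewrite -big_split /=; apply: eq_bigr => j _; rewrite /kterm -H val_nxt.
case: (eqVneq j i) => [->|]; first by rewrite (negPf nxt_neq); lia.
case: (eqVneq j (nxt i)) => [->|]; first by rewrite H val_nxt; lia.
by rewrite -!val_eqE /= val_nxt => *; lia.
Qed.

Lemma tilde_eq (mu : 'X_{1..n}) : mu i = mu (nxt i) ->
  tt * tilde mu i = tilde mu (nxt i).
Proof.
move=> H; rewrite /gtilde -H kk_nxt_eq // mulrCA; congr (_ * _).
by rewrite exprS invfM mulrA divff ?tt_neq0 // mul1r.
Qed.

Lemma tilde_sub_neq0 (mu : 'X_{1..n}) : tilde mu i - tilde mu (nxt i) != 0.
Proof.
rewrite subr_eq0; apply/eqP => E.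
have [/kk_nxt_eq E1 E2] := qt_div_inj E.
by rewrite E2 in E1; lia.
Qed.

End Swap.

End Points.

End Spectral.

Section Rotation.
Variables (K : generic_pair) (n : nat).
Local Notation qq := (gq K).
Implicit Types (f : {mpoly K[n.+1]}) (mu : 'X_{1..n.+1}).

(** The factor [q^-1] at the wrapped variable cancels the [q] of [tilde_mshift], so evaluating
    [om f] at a shifted point is evaluating [f] at the original one ([meval_om]). *)
Definition omh (i : 'I_n.+1) : {mpoly K[n.+1]} :=
  (if i == ord_max then qq^-1 else 1) *: 'X_(ordS i).
Definition omVh (i : 'I_n.+1) : {mpoly K[n.+1]} :=
  (if i == ord0 then qq else 1) *: 'X_(ord_pred i).
Local Notation om := (subst omh).
Local Notation omV := (subst omVh).

Lemma omX i : om 'X_i = (if i == ord_max then qq^-1 else 1) *: 'X_(ordS i).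
Proof. exact: substX. Qed.

Lemma omVK f : om (omV f) = f.
Proof.
rewrite subst_subst -[RHS]subst_id; apply: subst_ext => i.
rewrite substZ substX /omh /omVh ord_predK scalerA ord_pred_eqmax.
by case: (i == ord0); rewrite ?mulfV ?qq_neq0 ?mulr1 ?scale1r // ?qq_neq0.
Qed.

Lemma omK f : omV (om f) = f.
Proof.
rewrite subst_subst -[RHS]subst_id; apply: subst_ext => i.
rewrite substZ substX /omh /omVh ordSK scalerA ordS_eq0.
by case: (i == ord_max); rewrite ?mulVf ?qq_neq0 ?mulr1 ?scale1r // ?qq_neq0.
Qed.

Lemma msize_om f : (msize (om f) <= msize f)%N.
Proof.
apply: msize_subst => i; apply: leq_trans (msizeZ_le _ _) _.
by rewrite msizeX mdeg1.
Qed.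

Lemma msize_omV f : (msize (omV f) <= msize f)%N.
Proof.
apply: msize_subst => i; apply: leq_trans (msizeZ_le _ _) _.
by rewrite msizeX mdeg1.
Qed.

Lemma meval_omV c f mu : (omV f).@[pt c mu] = f.@[pt c (mshift mu)].
Proof.
rewrite meval_subst; apply: meval_eq => i; rewrite mevalZ mevalXU /pt.
rewrite -{3}[i]ord_predK tilde_mshift ord_pred_eqmax.
by rewrite mulrCA.
Qed.

Lemma meval_om c f mu : (om f).@[pt c (mshift mu)] = f.@[pt c mu].
Proof. by rewrite -meval_omV omK. Qed.

End Rotation.

Notation om := (subst (@omh _ _)).
Notation omV := (subst (@omVh _ _)).

Section Uniqueness.
Variable K : generic_pair.
Local Notation qq := (gq K).
Local Notation tt := (gt K).
Implicit Types c : K.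

Lemma pt_neq_c (n : nat) c (mu : 'X_{1..n.+1}) : c != 0 -> (0 < mu ord0)%N ->
  pt c mu ord0 - c * tt ^- n != 0.
Proof.
move=> c0 H; rewrite subr_eq0 /pt; apply/eqP => /(mulfI c0).
rewrite /gtilde -[tt ^- n]mul1r -(expr0 qq) => /qt_div_inj [E _].
by rewrite E in H.
Qed.

Lemma pt_eq0 (n : nat) c (mu : 'X_{1..n.+1}) : mu ord0 = 0%N ->
  pt c mu ord0 = c * tt ^- n.
Proof. by move=> H; rewrite /pt tilde_eq0. Qed.

(** Induction on the number of variables and on the degree. Compositions with first part 0 lie on
    [x_0 = c t^-n] and give the points for one variable less, so [f] is divisible by [x_0 - c t^-n].
    The other compositions are shifts of smaller ones, which handles the quotient after [omV]. *)
Lemma interp_uniq (n d : nat) c (f : {mpoly K[n]}) :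
  c != 0 -> (msize f <= d.+1)%N ->
  (forall mu : 'X_{1..n}, (mdeg mu <= d)%N -> f.@[pt c mu] = 0) -> f = 0.
Proof.
move=> c0; elim: n d f => [|n IHn] d f.
  move=> _ H; rewrite -[f]subst_id.
  have -> : subst (fun i => 'X_i) f = (f.@[fun _ => 0])%:MP_[0].
    elim/mpoly_gen_ind: {H} f => [a|[]|f g Hf Hg|f g Hf Hg] //.
    - by rewrite substC mevalC.
    - by rewrite rmorphD /= Hf Hg mevalD mpolyCD.
    - by rewrite rmorphM /= Hf Hg mevalM mpolyCM.
  suff -> : f.@[fun _ => 0] = 0 by exact: mpolyC0.
  by rewrite -(H 0%MM) ?mdeg0 //; apply: meval_eq => -[].
elim: d f => [|d IHd] f sf H.
  have E := msize1_polyC sf; have := H 0%MM; rewrite mdeg0 E mevalC => H0.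
  by rewrite H0 // mpolyC0.
pose h (i : 'I_n.+1) : {mpoly K[n]} :=
  if unlift ord0 i is Some j then 'X_j else (c * tt ^- n)%:MP.
have r0 : subst h f = 0.
  apply: (IHn d.+1).
    apply: leq_trans (msize_subst _ _) sf => i; rewrite /h.
    by case: unlift => [j|]; rewrite ?msizeX ?mdeg1 // msizeC; case: (_ == _).
  move=> mu Hmu; rewrite meval_subst -(H (mcons0 mu)) ?mdeg_mcons0 //.
  apply: meval_eq => i; rewrite /h; case: unliftP => [j ->|->].
    by rewrite mevalXU /pt tilde_mcons0.
  by rewrite mevalC pt_eq0 // mnmE unlift_none.
have [|z Ez sz] := @factor_at _ _ ord0 (c * tt ^- n) f _ _ sf.
  rewrite (_ : subst _ f = subst (fun j => 'X_(lift ord0 j)) (subst h f)).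
    by rewrite r0 rmorph0.
  rewrite subst_subst; apply: subst_ext => i; rewrite /h /restr_at.
  case: unliftP => [j ->|->]; last by rewrite eqxx substC.
  by rewrite substX eq_sym (negPf (neq_lift _ _)).
suff z0 : omV z = 0 by rewrite Ez -[z]omVK z0 rmorph0 mulr0.
apply: IHd => [|mu Hmu]; first exact: leq_trans (msize_omV _) sz.
rewrite meval_omV.
have := H (mshift mu); rewrite mdeg_mshift ltnS => /(_ Hmu).
rewrite Ez mevalM => /eqP; rewrite mulf_eq0 => /orP[|/eqP //].
rewrite mevalB mevalXU mevalC (negPf (pt_neq_c _ _)) //.
by rewrite mnmE eqxx addn1.
Qed.

End Uniqueness.

(** * Hecke operators *)

Section AbstractHecke.
Variables (R : idomainType) (t x y : R) (s T : R -> R).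
Hypothesis xy : x - y != 0.
Hypothesis sD : {morph s : f g / f + g}.
Hypothesis sM : {morph s : f g / f * g}.
Hypothesis sK : involutive s.
Hypothesis sx : s x = y.
Hypothesis st : s t = t.
Hypothesis sdiv : forall f, exists z, f - s f = (x - y) * z.
Hypothesis TP : forall f,
  (x - y) * T f = t * ((x - y) * f) - (t * x - y) * (f - s f).

Lemma aheckeD f g : T (f + g) = T f + T g.
Proof. by apply: (mulfI xy); rewrite mulrDr !TP sD; ring. Qed.

Lemma aheckeM f r : s r = r -> T (r * f) = r * T f.
Proof. by move=> sr; apply: (mulfI xy); rewrite mulrCA !TP sM sr; ring. Qed.

(** Twisted Leibniz rule: it separates the action of [T_i] on a matrix entry in the variables from
    its action on the function which that entry multiplies. *)
Lemma aheckeLeib f g : (x - y) * T (f * g) =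
  (x - y) * s f * T g + (1 - t) * y * (f - s f) * g.
Proof.
have -> : (x - y) * s f * T g = s f * ((x - y) * T g) by ring.
rewrite !TP sM; ring.
Qed.

Lemma ahecke_square f : T (T f) = (t - 1) * T f + t * f.
Proof.
have [z Hz] := sdiv f.
have sy : s y = x by rewrite -sx sK.
have s0 : s 0 = 0 by apply: (addrI (s 0)); rewrite -sD !addr0.
have sN g : s (- g) = - s g by apply: (addrI (s g)); rewrite -sD !subrr.
(* The divided difference is symmetric, which makes [s (T f)] computable. *)
have sz : s z = z.
  apply: (mulfI xy); rewrite -Hz; apply: oppr_inj; rewrite -mulNr !opprB.
  by rewrite -{1}sy -{1}sx -sN -sD -sM -Hz sD sN sK.
have Ef : f = s f + (x - y) * z by rewrite -Hz; ring.
have Tf : T f = t * f - (t * x - y) * z.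
  by apply: (mulfI xy); rewrite TP Hz; ring.
have sTf : s (T f) = t * s f - (t * y - x) * z.
  by rewrite Tf sD sN !sM sD sN !sM sx sy st sz.
apply: (mulfI xy); rewrite TP sTf Tf; move: (s f) Ef => sf ->; ring.
Qed.

End AbstractHecke.

Section HeckeDef.
Variables (K : generic_pair) (n : nat).

(** The text of [is_hecke] over a generic pair, so that at the concrete field [ghecke] and [hecke]
    agree by conversion. *)
Definition is_ghecke (i : 'I_n) (f g : {mpoly K[n]}) : Prop :=
  ('X_i - 'X_(nxt i)) * g
  = gt K *: (('X_i - 'X_(nxt i)) * f)
    - (gt K *: 'X_i - 'X_(nxt i)) * (f - msym (sgen i) f).

Definition ghecke (i : 'I_n) (f : {mpoly K[n]}) : {mpoly K[n]} :=
  epsilon (inhabits (0 : {mpoly K[n]})) (is_ghecke i f).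

End HeckeDef.

Section Hecke.
Variables (K : generic_pair) (n : nat) (i : 'I_n).
Local Notation tt := (gt K).
Local Notation tilde := (@gtilde K n).
Local Notation hecke := (@ghecke K n).
Local Notation is_hecke := (@is_ghecke K n).
Implicit Types c : K.
Hypothesis Hi : (i.+1 < n)%N.
Implicit Types (f g z : {mpoly K[n]}).

Local Notation x := ('X_i : {mpoly K[n]}).
Local Notation y := ('X_(nxt i) : {mpoly K[n]}).
Local Notation s f := (msym (sgen i) f).

Lemma msym_sgenX j : s 'X_j = 'X_(sgen i j) :> {mpoly K[n]}.
Proof. by rewrite msymE_subst substX. Qed.

Lemma msym_sgenK f : s (s f) = f.
Proof. by rewrite -msymMm /sgen tperm2 msym1m. Qed.

Lemma xy_neq0 : x - y != 0.
Proof. by rewrite mpolyX_sub_neq0 ?nxt_neq. Qed.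

Lemma div_diff f : exists z, f - s f = (x - y) * z.
Proof.
have [|z] := @subst_dvd _ n n (x - y) (fun j => 'X_(sgen i j)) (fun j => 'X_j) f.
  move=> j; rewrite /sgen; case: tpermP => [->|->|_ _].
  - by exists 1; rewrite mulr1.
  - by exists (-1); rewrite mulrN1 opprB.
  - by exists 0; rewrite mulr0 subrr.
by rewrite subst_id => E; exists z.
Qed.

Lemma is_heckeE f g : is_hecke i f g <->
  (x - y) * g = tt%:MP * ((x - y) * f) - (tt%:MP * x - y) * (f - s f).
Proof. by rewrite !mul_mpolyC. Qed.

Lemma heckeP f : is_hecke i f (hecke i f).
Proof.
apply: epsilon_spec; have [z Hz] := div_diff f.
exists (tt%:MP * f - (tt%:MP * x - y) * z); apply/is_heckeE; rewrite Hz.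
by rewrite mulrBr mulrCA; congr (_ - _); rewrite mulrCA.
Qed.

Lemma hecke_uniq f g : is_hecke i f g -> hecke i f = g.
Proof.
by move=> E; apply: (mulfI xy_neq0); exact: etrans (heckeP f) (esym E).
Qed.

Let TP f : (x - y) * hecke i f =
  tt%:MP * ((x - y) * f) - (tt%:MP * x - y) * (f - s f).
Proof. exact: (iffLR (is_heckeE f _) (heckeP f)). Qed.
Let sD : {morph (msym (sgen i) : {mpoly K[n]} -> _) : f g / f + g}.
Proof. exact: msymD. Qed.
Let sM : {morph (msym (sgen i) : {mpoly K[n]} -> _) : f g / f * g}.
Proof. exact: msymM. Qed.

Lemma heckeD f g : hecke i (f + g) = hecke i f + hecke i g.
Proof. exact: (aheckeD xy_neq0 sD TP). Qed.

Lemma heckeM f r : s r = r -> hecke i (r * f) = r * hecke i f.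
Proof. exact: (aheckeM xy_neq0 sM TP). Qed.

Lemma heckeC f a : hecke i (a%:MP * f) = a%:MP * hecke i f.
Proof. by apply: heckeM; rewrite msymE_subst substC. Qed.

Lemma heckeZ f a : hecke i (a *: f) = a *: hecke i f.
Proof. by rewrite -mul_mpolyC heckeC mul_mpolyC. Qed.

Lemma hecke0 : hecke i 0 = 0.
Proof. by have := heckeZ 0 0; rewrite !scale0r. Qed.

Lemma hecke_sum (I : Type) (r : seq I) (P : pred I) (F : I -> {mpoly K[n]}) :
  hecke i (\sum_(j <- r | P j) F j) = \sum_(j <- r | P j) hecke i (F j).
Proof. exact: (big_morph _ heckeD hecke0). Qed.

Lemma hecke_Leib f g : (x - y) * hecke i (f * g) =
  (x - y) * s f * hecke i g + (1 - tt%:MP) * y * (f - s f) * g.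
Proof. exact: (aheckeLeib sM TP). Qed.

Lemma hecke_square f : hecke i (hecke i f) = (tt - 1) *: hecke i f + tt *: f.
Proof.
have sx : s x = y by rewrite msym_sgenX sgenL.
have st : s tt%:MP = tt%:MP :> {mpoly K[n]} by rewrite msymE_subst substC.
rewrite (ahecke_square xy_neq0 sD sM msym_sgenK sx st div_diff TP).
by rewrite -mpolyC1 -mpolyCB !mul_mpolyC.
Qed.

Definition heckeV f : {mpoly K[n]} := tt^-1 *: (hecke i f - (tt - 1) *: f).

Lemma heckeVK f : hecke i (heckeV f) = f.
Proof.
rewrite /heckeV heckeZ heckeD -scaleNr heckeZ hecke_square scaleNr.
by rewrite [_ + tt *: f]addrC addrK scalerA mulVf ?tt_neq0 ?scale1r.
Qed.

Lemma heckeKV f : heckeV (hecke i f) = f.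
Proof.
by rewrite /heckeV hecke_square [_ + tt *: f]addrC addrK scalerA mulVf ?tt_neq0 ?scale1r.
Qed.

Lemma msize_hecke f : (msize (hecke i f) <= msize f)%N.
Proof.
have [->|h0] := eqVneq (hecke i f) 0; first by rewrite msize0.
have f0 : f != 0 by apply: contraNneq h0 => ->; rewrite hecke0.
have sX (j : 'I_n) : msize ('X_j : {mpoly K[n]}) = 2%N by rewrite msizeX mdeg1.
have sxy : (msize (tt *: x - y) <= 2)%N.
  apply: leq_trans (msizeD_le _ _) _; rewrite msizeN sX geq_max andbT.
  by apply: leq_trans (msizeZ_le _ _) _; rewrite sX.
have sMul (a b : {mpoly K[n]}) : (msize a <= 2)%N -> (msize (a * b) <= (msize b).+1)%N.
  have [->|a0] := eqVneq a 0; first by rewrite mul0r msize0.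
  have [->|b0] := eqVneq b 0; first by rewrite mulr0 msize0.
  by rewrite msizeM //; move: (msize a) (msize b) => u v; clear; lia.
have sxy1 : msize (x - y) = 2%N.
  apply/eqP; rewrite eqn_leq; apply/andP; split.
    by apply: leq_trans (msizeD_le _ _) _; rewrite msizeN !sX.
  have : U_(i)%MM \in msupp (x - y).
    rewrite mcoeff_msupp mcoeffB !mcoeffXU eqxx [nxt i == i]eq_sym (negPf (nxt_neq Hi)).
    by rewrite subr0 oner_neq0.
  by move=> /msize_mdeg_lt; rewrite mdeg1.
have ssf : (msize (s f) <= msize f)%N.
  by apply: msize_subst => j; rewrite sX.
have := congr1 (fun p : {mpoly K[n]} => msize p) (heckeP f).
rewrite msizeM ?xy_neq0 // sxy1 add2n /= => E; rewrite -ltnS E.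
apply: leq_trans (msizeD_le _ _) _; rewrite msizeN geq_max; apply/andP; split.
  by apply: leq_trans (msizeZ_le _ _) _; apply: sMul; rewrite sxy1.
apply: leq_trans (sMul _ _ sxy) _; rewrite ltnS.
by apply: leq_trans (msizeD_le _ _) _; rewrite msizeN geq_max leqnn.
Qed.

Lemma meval_hecke f v :
  (v i - v (nxt i)) * (hecke i f).@[v] =
  (1 - tt) * v (nxt i) * f.@[v]
  + (tt * v i - v (nxt i)) * f.@[fun j => v (sgen i j)].
Proof.
have := congr1 (meval v) (heckeP f).
rewrite !(mevalM, mevalB, mevalZ) !mevalXU meval_msym => ->; ring.
Qed.

Lemma meval_mswap c f (mu : 'X_{1..n}) : mu i != mu (nxt i) ->
  f.@[fun j => pt c mu (sgen i j)] = f.@[pt c (mswap i mu)].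
Proof. by move=> H; apply: meval_eq => j; rewrite /pt tilde_mswap. Qed.

(** For equal adjacent parts the swapped vector is no spectral point, but its coefficient
    [t x_i - x_(i+1)] is zero by [tilde_eq]. *)
Lemma hecke_pt_eq c f (mu : 'X_{1..n}) : c != 0 -> mu i = mu (nxt i) ->
  (hecke i f).@[pt c mu] = tt * f.@[pt c mu].
Proof.
move=> c0 H; have := meval_hecke f (pt c mu); rewrite /pt -(tilde_eq K Hi H).
have -> : tt * (c * tilde mu i) - c * (tt * tilde mu i) = 0 by ring.
rewrite mul0r addr0 => E; apply: (@mulfI _ (c * (tilde mu i - tilde mu (nxt i)))).
  by rewrite mulf_neq0 // tilde_sub_neq0.
rewrite mulrBr -(tilde_eq K Hi H) E; ring.
Qed.

Lemma hecke_pt_neq c f (mu : 'X_{1..n}) : c != 0 -> mu i != mu (nxt i) ->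
  (tilde mu i - tilde mu (nxt i)) * (hecke i f).@[pt c mu] =
  (1 - tt) * tilde mu (nxt i) * f.@[pt c mu]
  + (tt * tilde mu i - tilde mu (nxt i)) * f.@[pt c (mswap i mu)].
Proof.
move=> c0 H.
have := meval_hecke f (pt c mu) : (c * tilde mu i - c * tilde mu (nxt i)) * _ =
  (1 - tt) * (c * tilde mu (nxt i)) * _
  + (tt * (c * tilde mu i) - c * tilde mu (nxt i)) * _.
rewrite meval_mswap // => E; apply: (mulfI c0); rewrite mulrA mulrBr E; ring.
Qed.

Lemma hecke_vanish c f d : c != 0 ->
  (forall mu : 'X_{1..n}, (mdeg mu < d)%N -> f.@[pt c mu] = 0) ->
  forall mu : 'X_{1..n}, (mdeg mu < d)%N -> (hecke i f).@[pt c mu] = 0.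
Proof.
move=> c0 H mu Hmu; case: (eqVneq (mu i) (mu (nxt i))) => E.
  by rewrite hecke_pt_eq // H // mulr0.
apply: (mulfI (tilde_sub_neq0 K Hi mu)).
by rewrite hecke_pt_neq // !H ?mdeg_mswap // !mulr0 addr0.
Qed.

(** On [x_(i+1) = 0] the fraction in [T_i] is the constant [t], so that [T_i] reduces to [t s_i]. *)
Lemma hecke_subst0 k (h : 'I_n -> {mpoly K[k]}) f : h (nxt i) = 0 -> h i != 0 ->
  subst h (hecke i f) = tt *: subst (fun j => h (sgen i j)) f.
Proof.
move=> h0 hi; apply: (mulfI hi); have := congr1 (subst h) (TP f).
rewrite !(rmorphM, rmorphB) /= !substX substC h0 !subr0 subst_msym => ->.
by rewrite -mul_mpolyC mulrBr [_ * h i * _]mulrAC -[_ * _ * h i]mulrA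
  [h i * _]mulrC subKr mulrAC mulrC.
Qed.

(* The operator form is [T_i^-1 X_i^-1 T_i^-1 = t^-1 X_(i+1)^-1] on functions on
   the spectral points. *)
Lemma hecke_jucys c d p r : c != 0 ->
  (forall mu : 'X_{1..n}, mdeg mu = d ->
     tilde mu i * r.@[pt c mu] = (heckeV p).@[pt c mu]) ->
  forall mu : 'X_{1..n}, mdeg mu = d ->
     tt * tilde mu (nxt i) * (heckeV r).@[pt c mu] = p.@[pt c mu].
Proof.
move=> c0 H mu Hmu; rewrite -[p in RHS]heckeVK; move: (heckeV p) H => f H.
have H1 := H _ Hmu.
rewrite /heckeV mevalZ mevalB mevalZ mulrA [tt * _]mulrC mulfK ?tt_neq0 //.
case: (eqVneq (mu i) (mu (nxt i))) => E.
  rewrite (hecke_pt_eq r c0 E) (hecke_pt_eq f c0 E) -H1 -(tilde_eq K Hi E); ring.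
have H2 := H _ (etrans (mdeg_mswap i mu) Hmu).
rewrite tilde_mswap ?sgenL // in H2.
apply: (mulfI (tilde_sub_neq0 K Hi mu)); rewrite (hecke_pt_neq f c0 E) -H1 -H2.
rewrite mulrCA [X in _ * X]mulrBr (hecke_pt_neq r c0 E); ring.
Qed.

End Hecke.

(** * Closed forms of the pairing sums *)

Section LocalWeights.
Variables (n : nat) (R : comNzRingType).
(* [w a j b c z] is the weight for species [a] of column [j] with bottom label [b]
   and top label [c], when [z] (net) strands enter the column from its right. *)
Variable w : nat -> 'I_n -> nat -> nat -> int -> R.
Implicit Types b c : 'I_n -> nat.

(* The net number of strands of species [a] passing over column [j] from its right, modulo
   wrapping. *)
Definition rho (a : nat) b c (j : 'I_n) : int :=
  \sum_(k < n | (j < k)%N) ((b k == a)%:Z - (c k == a)%:Z).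

Definition colprod (a : nat) b c : R := \prod_(j < n) w a j (b j) (c j) (rho a b c j).

Lemma rho_ext a b c b' c' : b =1 b' -> c =1 c' -> rho a b c =1 rho a b' c'.
Proof. by move=> Eb Ec j; apply: eq_bigr => k _; rewrite Eb Ec. Qed.

Lemma colprod_ext a b c b' c' : b =1 b' -> c =1 c' -> colprod a b c = colprod a b' c'.
Proof.
by move=> Eb Ec; apply: eq_bigr => k _; rewrite Eb Ec (rho_ext a Eb Ec).
Qed.

Section Swap.
Variable i : 'I_n.
Hypothesis Hi : (i.+1 < n)%N.
Local Notation s := (sgen i).

Lemma rho_step a b c :
  rho a b c i = rho a b c (nxt i) + ((b (nxt i) == a)%:Z - (c (nxt i) == a)%:Z).
Proof.
rewrite /rho (bigD1 (nxt i)) /=; last by rewrite val_nxt.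
rewrite addrC; congr (_ + _); apply: eq_bigl => k.
by rewrite -val_eqE /= val_nxt //; lia.
Qed.

Lemma sgen_out (j : 'I_n) : j != i -> j != nxt i -> s j = j.
Proof. by move=> H1 H2; rewrite /sgen tpermD // eq_sym. Qed.

(** The columns to the right of [j] include both or neither of [i] and [i+1] unless [j = i]. Hence a
    swap in either row affects only a two-column factor. *)
Lemma rho_swap a b c j : j != i -> rho a (b \o s) (c \o s) j = rho a b c j.
Proof.
move=> ji; rewrite /rho [RHS](reindex_inj (can_inj (@sgenK _ i))) /=.
apply: eq_bigl => k; rewrite val_sgen //; rewrite -val_eqE /= in ji.
by case: eqP => [->|_]; [lia|case: eqP; lia].
Qed.

Lemma rho_swapb a b c j : j != i -> rho a (b \o s) c j = rho a b c j.
Proof.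
move=> ji; rewrite /rho !sumrB; congr (_ - _).
rewrite [RHS](reindex_inj (can_inj (@sgenK _ i))) /=.
apply: eq_bigl => k; rewrite val_sgen //; rewrite -val_eqE /= in ji.
by case: eqP => [->|_]; [lia|case: eqP; lia].
Qed.

Lemma rho_swapc a b c j : j != i -> rho a b (c \o s) j = rho a b c j.
Proof.
move=> ji; rewrite -(rho_swapb a _ _ ji) -(rho_swap a b c ji).
by apply: rho_ext => // k.
Qed.

Definition colrest a b c : R :=
  \prod_(j < n | (j != i) && (j != nxt i)) w a j (b j) (c j) (rho a b c j).

Definition twocol (a b1 b2 c1 c2 : nat) (z : int) : R :=
  w a i b1 c1 (z + ((b2 == a)%:Z - (c2 == a)%:Z)) * w a (nxt i) b2 c2 z.

Lemma colprod_split a b c :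
  colprod a b c = colrest a b c *
    twocol a (b i) (b (nxt i)) (c i) (c (nxt i)) (rho a b c (nxt i)).
Proof.
rewrite /colprod (bigD1 i) //= (bigD1 (nxt i)) /=; last by rewrite eq_sym nxt_neq.
by rewrite /twocol rho_step mulrA mulrC.
Qed.

Lemma colrest_swapb a b c : colrest a (b \o s) c = colrest a b c.
Proof.
apply: eq_bigr => j /andP[j1 j2]; rewrite rho_swapb //.
by rewrite /= sgen_out.
Qed.

Lemma colrest_swapc a b c : colrest a b (c \o s) = colrest a b c.
Proof.
apply: eq_bigr => j /andP[j1 j2]; rewrite rho_swapc //.
by rewrite /= sgen_out.
Qed.

Lemma colprod_split_swapb a b c :
  colprod a (b \o s) c = colrest a b c *
    twocol a (b (nxt i)) (b i) (c i) (c (nxt i)) (rho a b c (nxt i)).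
Proof.
rewrite colprod_split colrest_swapb rho_swapb /= ?sgenL ?sgenR //.
by rewrite eq_sym nxt_neq.
Qed.

Lemma colprod_split_swapc a b c :
  colprod a b (c \o s) = colrest a b c *
    twocol a (b i) (b (nxt i)) (c (nxt i)) (c i) (rho a b c (nxt i)).
Proof.
rewrite colprod_split colrest_swapc rho_swapc /= ?sgenL ?sgenR //.
by rewrite eq_sym nxt_neq.
Qed.

End Swap.
End LocalWeights.

(** * The functional that resums windings *)

Section Lambda.
Variable K : generic_pair.
Local Notation tt := (gt K).

Implicit Types (Q : K) (p r : {poly K}).

(* Formally [lamb Q p = sum_(s >= 0) Q^s p(t^s)]. *)
Definition lamb (Q : K) (p : {poly K}) : K :=
  \sum_(i < size p) p`_i / (1 - Q * tt ^+ i).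

Lemma lambE N Q p : (size p <= N)%N ->
  lamb Q p = \sum_(i < N) p`_i / (1 - Q * tt ^+ i).
Proof.
move=> H; rewrite /lamb (big_ord_widen N (fun i => p`_i / (1 - Q * tt ^+ i))) //.
rewrite big_mkcond; apply: eq_bigr => i _; case: ltnP => // Hi.
by rewrite nth_default // mul0r.
Qed.

Lemma lambD Q p r : lamb Q (p + r) = lamb Q p + lamb Q r.
Proof.
pose N := maxn (size p) (size r).
rewrite !(@lambE N) ?leq_maxl ?leq_maxr ?size_polyD // -big_split /=.
by apply: eq_bigr => i _; rewrite coefD mulrDl.
Qed.

Lemma lambZ Q a p : lamb Q (a *: p) = a * lamb Q p.
Proof.
rewrite !(@lambE (size p)) ?size_scale_leq // mulr_sumr.
by apply: eq_bigr => i _; rewrite coefZ mulrA.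
Qed.

Lemma lamb0p Q : lamb Q 0 = 0.
Proof. by rewrite /lamb size_poly0 big_ord0. Qed.

Lemma lambXn Q k : lamb Q 'X^k = (1 - Q * tt ^+ k)^-1.
Proof.
rewrite /lamb size_polyXn big_ord_recr /= coefXn eqxx mul1r big1 ?add0r // => i _.
by rewrite coefXn ltn_eqF // mul0r.
Qed.

Definition tX (z : int) : {poly K} := (tt ^ z) *: 'X.

Definition pshift (p : {poly K}) : {poly K} := p \Po tX 1.

Lemma coef_pshift p k : (pshift p)`_k = p`_k * tt ^+ k.
Proof.
rewrite /pshift /tX expr1z coef_comp_poly.
under eq_bigr => i _ do rewrite exprZn coefZ coefXn.
case: (ltnP k (size p)) => Hk; last first.
  rewrite nth_default // mul0r big1 // => i _.
  by rewrite gtn_eqF ?mulr0 // (leq_trans (ltn_ord i)).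
rewrite (bigD1 (Ordinal Hk)) //= eqxx mulr1 big1 ?addr0 // => i Hi.
by rewrite eq_sym -val_eqE /= in Hi; rewrite (negPf Hi) !mulr0.
Qed.

Lemma pshiftM p r : pshift (p * r) = pshift p * pshift r.
Proof. exact: rmorphM. Qed.

Lemma pshift_prod (I : Type) (l : seq I) (P : pred I) (F : I -> {poly K}) :
  pshift (\prod_(j <- l | P j) F j) = \prod_(j <- l | P j) pshift (F j).
Proof. exact: rmorph_prod. Qed.

Lemma pshift_tX z : pshift (tX z) = tX (z + 1).
Proof.
by rewrite /pshift /tX comp_polyZ comp_polyX scalerA -expfzDr ?tt_neq0.
Qed.

Lemma pshift1B z : pshift (1 - tX z) = 1 - tX (z + 1).
Proof. by rewrite /pshift rmorphB rmorph1 -pshift_tX. Qed.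

Lemma horner_tX z : (tX z).[1] = tt ^ z.
Proof. by rewrite hornerZ hornerX mulr1. Qed.

(** Removes the term [s = 0] of the formal series and reindexes the rest; this is how the wrapping
    factor [Q] gets absorbed. *)
Lemma lamb_shift Q p : (forall k, 1 - Q * tt ^+ k != 0) ->
  Q * lamb Q (pshift p) = lamb Q p - p.[1].
Proof.
move=> HQ; have sp : (size (pshift p) <= size p)%N.
  by apply/leq_sizeP => k Hk; rewrite coef_pshift nth_default // mul0r.
rewrite (lambE Q sp) /lamb horner_coef -sumrB mulr_sumr; apply: eq_bigr => i _.
rewrite coef_pshift expr1n mulr1.
move: (HQ i); move: (p`_i) (tt ^+ i) => a x H; field; exact: H.
Qed.

Lemma lamb_shift0 Q p : (forall k, 1 - Q * tt ^+ k != 0) -> p.[1] = 0 ->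
  lamb Q p = Q * lamb Q (pshift p).
Proof. by move=> HQ p1; rewrite lamb_shift // p1 subr0. Qed.

(** Only the term without winding survives: this is the functional of the signed layer. *)
Lemma lamb_Q0 p : lamb 0 p = p.[1].
Proof.
rewrite /lamb horner_coef; apply: eq_bigr => i _.
by rewrite mul0r subr0 divr1 expr1n mulr1.
Qed.

End Lambda.

(** * The pairings of one label, by sweeping a strand across the columns *)

Section Sweep.
Variables (K : generic_pair) (n : nat).
Local Notation tt := (gt K).
Local Notation tX := (tX K).
Implicit Types (T B D S : {set 'I_n}) (p : nat) (j k : 'I_n) (Q : K).

Definition cge S p : int := \sum_(k in S) (p <= k)%N%:Z.
Definition crho B T j : int := cge B j.+1 - cge T j.+1.

(** [T] are the nontrivially paired top balls of one label, [B] their possible partners, and [D]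
    balls that can be skipped but not chosen. The correction [j < p] anticipates the removal of the
    bottom ball in column [p], which all columns to its left notice ([Vpoly_remove]). *)
Definition Vpoly p T B D : {poly K} :=
  \prod_(j in T) (1 - tX (crho B T j - (j < p)%N%:Z))
  * \prod_(d in D) tX (crho B T d - (d < p)%N%:Z).

Definition V Q T B D : K := lamb Q (Vpoly 0 T B D).

Lemma cge_split S j : cge S j = cge S j.+1 + (j \in S)%:Z.
Proof.
have E k : (j <= k)%N%:Z = (j.+1 <= k)%N%:Z + (k == j)%:Z.
  by rewrite -val_eqE /=; case: ltngtP.
rewrite /cge (eq_bigr _ (fun k _ => E k)) big_split /=; congr (_ + _).
rewrite big_mkcond (bigD1 j) //= eqxx big1 ?addr0 => [|k /negPf->].
  by case: (j \in S).
by case: ifP.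
Qed.

Lemma cge_out S p : (forall k, k \in S -> (k < p)%N) -> cge S p = 0.
Proof. by move=> H; rewrite /cge big1 // => k /H; case: leqP. Qed.

Lemma cge_n S : cge S n = 0.
Proof. exact: cge_out. Qed.

Lemma cge_0 S : cge S 0 = #|S|%:Z.
Proof. by rewrite /cge (eq_bigr (fun=> 1)) // sumr_const natz. Qed.

Lemma cge_D1 S k p : k \in S -> cge (S :\ k) p = cge S p - (p <= k)%N%:Z.
Proof.
by move=> kS; rewrite /cge [in RHS](big_setD1 k) //= addrAC subrr add0r.
Qed.

Lemma cge_U1 S k p : k \notin S -> cge (k |: S) p = cge S p + (p <= k)%N%:Z.
Proof. by move=> kS; rewrite /cge big_setU1 //= addrC. Qed.

(* [V] with one more top ball, inserted in the gap to the left of column [p]. *)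
Definition Wgap Q T B D p : K :=
  lamb Q ((1 - tX (cge B p - cge T p)) * Vpoly p T B D).

Lemma prod_gap S j (F : int -> 'I_n -> {poly K}) : j \notin S ->
  \prod_(k in S) F (k < j.+1)%N%:Z k = \prod_(k in S) F (k < j)%N%:Z k.
Proof.
move=> jS; apply: eq_bigr => k Hk.
by rewrite ltnS leq_eqVlt val_eqE; case: eqP Hk jS => [-> ->|].
Qed.

Lemma Vpoly_step T B D j : j \notin T -> j \notin D ->
  Vpoly j.+1 T B D = Vpoly j T B D.
Proof.
move=> jT jD; rewrite /Vpoly (prod_gap (fun z k => 1 - tX (crho B T k - z)) jT).
by rewrite (prod_gap (fun z k => tX (crho B T k - z)) jD).
Qed.

Lemma Vpoly_remove T B D k : k \in B -> Vpoly 0 T (B :\ k) D = Vpoly k T B D.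
Proof.
move=> kB; rewrite /Vpoly /crho; congr (_ * _); apply: eq_bigr => j _.
  by rewrite cge_D1 // subr0 addrAC.
by rewrite cge_D1 // subr0 addrAC.
Qed.

Lemma Wgap_skip Q T B D j : j \notin T -> j \notin B -> j \notin D ->
  Wgap Q T B D j = Wgap Q T B D j.+1.
Proof.
move=> jT jB jD.
by rewrite /Wgap Vpoly_step // !cge_split (negPf jT) (negPf jB) !addr0.
Qed.

(** The factors of the old and the inserted top ball trade places. *)
Lemma Wgap_top Q T B D j : j \in T -> j \notin B -> j \notin D ->
  Wgap Q T B D j = Wgap Q T B D j.+1.
Proof.
move=> jT jB jD; rewrite /Wgap !cge_split jT (negPf jB) addr0 /Vpoly.
rewrite (big_setD1 j jT) [in RHS](big_setD1 j jT) /= ltnn ltnSn subr0 /crho.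
rewrite (@prod_gap (T :\ j) _ (fun z k => 1 - tX (cge B k.+1 - cge T k.+1 - z))); last first.
  by rewrite !inE eqxx.
rewrite (prod_gap (fun z k => tX (cge B k.+1 - cge T k.+1 - z)) jD).
congr lamb; rewrite !mulrA; congr (_ * _ * _).
by rewrite mulrC opprD addrA.
Qed.

Lemma tX1 z : tX (z + 1) = tt *: tX z.
Proof. by rewrite /(tX _) scalerA expfzDr ?tt_neq0 // expr1z mulrC. Qed.

Lemma Wgap_D Q T B D j : j \notin T -> j \notin B -> j \in D ->
  Wgap Q T B D j = tt * Wgap Q T B D j.+1.
Proof.
move=> jT jB jD; rewrite /Wgap !cge_split (negPf jT) (negPf jB) !addr0 -lambZ.
rewrite scalerAr /Vpoly; congr (lamb _ (_ * _)).
rewrite (big_setD1 j jD) [in RHS](big_setD1 j jD) /= ltnn ltnSn subr0 /crho.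
rewrite (prod_gap (fun z k => 1 - tX (cge B k.+1 - cge T k.+1 - z)) jT).
rewrite (@prod_gap (D :\ j) _ (fun z k => tX (cge B k.+1 - cge T k.+1 - z))); last first.
  by rewrite !inE eqxx.
by rewrite scalerAr scalerAl -tX1 subrK.
Qed.

(** A strand that meets a possible partner either skips it, with factor [t], or ends there, with
    factor [1 - t]. *)
Lemma Wgap_B Q T B D j : j \notin T -> j \in B -> j \notin D ->
  Wgap Q T B D j = tt * Wgap Q T B D j.+1 + (1 - tt) * lamb Q (Vpoly j T B D).
Proof.
move=> jT jB jD; rewrite /Wgap Vpoly_step // !cge_split (negPf jT) jB addr0.
rewrite -!lambZ -lambD; congr lamb.
rewrite -[X in _ = _ + _ *: X]mul1r !scalerAl -mulrDl; congr (_ * _).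
rewrite addrAC tX1 scalerBr scalerBl scale1r [RHS]addrC addrA subrK.
by [].
Qed.

Definition ccount S p p' : nat := #|[set x in S | (p <= x)%N && (x < p')%N]|.

Lemma ccountS S p p' j : (j : nat) = p -> (p < p')%N ->
  ccount S p p' = ((j \in S) + ccount S p.+1 p')%N.
Proof.
move=> <- jp; rewrite /ccount (cardsD1 j) !inE leqnn jp !andbT; congr (_ + _)%N.
congr #|pred_of_set _|; apply/setP => x; rewrite !inE -val_eqE /=.
by case: (x \in S); rewrite ?andbF //=; case: (ltngtP j x).
Qed.

Lemma ccount0 S p : ccount S p p = 0%N.
Proof.
apply/eqP; rewrite cards_eq0; apply/eqP/setP => x; rewrite !inE.
by case: (x \in S) => //=; case: (ltngtP p x).
Qed.

Lemma Wgap_sweep Q T B D p p' : (p <= p')%N -> (p' <= n)%N ->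
  [disjoint B & D] ->
  (forall j, (p <= j < p')%N -> j \in T -> (j \notin B) && (j \notin D)) ->
  Wgap Q T B D p =
  \sum_(k in B | (p <= k < p')%N)
     (1 - tt) * tt ^+ ccount (B :|: D) p k * lamb Q (Vpoly k T B D)
  + tt ^+ ccount (B :|: D) p p' * Wgap Q T B D p'.
Proof.
move=> pp' p'n dBD HT; move: {-1}(p' - p)%N (erefl (p' - p)%N) => l El.
elim: l p pp' El HT => [|l IH] p pp' El HT.
  have -> : p = p' by lia.
  rewrite ccount0 expr0 mul1r big1 ?add0r // => k /andP[_].
  by case: (ltngtP p' k).
have Hp : (p < n)%N by lia.
pose j : 'I_n := Ordinal Hp.
have pp1 : (p < p')%N by lia.
have {}IH : Wgap Q T B D p.+1 = _ := IH p.+1 pp1 _ _.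
have Hsum : \sum_(k in B | (p <= k < p')%N)
     (1 - tt) * tt ^+ ccount (B :|: D) p k * lamb Q (Vpoly k T B D)
  = (if j \in B then (1 - tt) * lamb Q (Vpoly j T B D) else 0)
   + tt ^+ (j \in B :|: D) * \sum_(k in B | (p.+1 <= k < p')%N)
     (1 - tt) * tt ^+ ccount (B :|: D) p.+1 k * lamb Q (Vpoly k T B D).
  rewrite big_mkcond (bigD1 j) //= leqnn pp1 !andbT ccount0 mulr1; congr (_ + _).
  rewrite -big_mkcondr mulr_sumr; apply: eq_big => k.
    rewrite -val_eqE /=; case: (k \in B); rewrite ?andbF //=.
    by case: (ltngtP p k).
  move=> /andP[kj /andP[_ /andP[pk kp']]].
  rewrite (@ccountS _ _ _ j) //; last by rewrite ltn_neqAle pk eq_sym kj.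
  rewrite exprD; ring.
rewrite Hsum (@ccountS _ _ _ j) // exprD inE.
rewrite -addrA -mulrA -mulrDr -IH; last 2 first.
- lia.
- by move=> k /andP[k1 k2]; apply: HT; rewrite k2 ltnW.
have Hj := HT j; rewrite leqnn pp1 in Hj; have {}Hj := Hj isT.
rewrite -[p in LHS]/(nat_of_ord j) -[p.+1]/(j.+1).
case: (boolP (j \in B)) => jB.
  have jD : j \notin D by rewrite (disjointFr dBD jB).
  have jT : j \notin T by apply/negP => /Hj; rewrite jB.
  by rewrite Wgap_B // expr1 addrC.
rewrite add0r orFb; case: (boolP (j \in D)) => jD.
  have jT : j \notin T by apply/negP => /Hj; rewrite jD andbF.
  by rewrite Wgap_D // expr1.
rewrite expr0 mul1r; case: (boolP (j \in T)) => jT; first by rewrite Wgap_top.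
by rewrite Wgap_skip.
Qed.

Lemma V_add_top Q T B D j : j \notin T -> j \notin D ->
  V Q (j |: T) B D = lamb Q ((1 - tX (cge B j.+1 - cge T j.+1)) * Vpoly j.+1 T B D).
Proof.
move=> jT jD; rewrite Vpoly_step // /V /Vpoly big_setU1 // -mulrA.
congr (lamb _ (_ * (_ * _))).
- by rewrite ltn0 subr0 /crho cge_U1 // ltnn addr0.
- by apply: eq_bigr => k _; rewrite /crho cge_U1 // ltn0 subr0 opprD addrA.
- by apply: eq_bigr => k _; rewrite /crho cge_U1 // ltn0 subr0 opprD addrA.
Qed.

Lemma horner1B z : (1 - tX z).[1] = 1 - tt ^ z.
Proof. by rewrite hornerD hornerN horner_tX -[1]/(1%:P) hornerC. Qed.

Lemma horner1B0 : (1 - tX 0).[1] = 0.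
Proof. by rewrite horner1B expr0z subrr. Qed.

Definition between j k x : bool :=
  if (j < k)%N then (j < x)%N && (x < k)%N else (j < x)%N || (x < k)%N.

(** Sweeping the new top ball once around the cylinder returns to the starting value times
    [Q t^(#B + #D)], plus one contribution for each possible endpoint. Solving this linear equation
    produces the denominator of the pairing weight. *)
Lemma V_classic Q T B D j : (forall e : nat, 1 - Q * tt ^+ e != 0) ->
  j \notin T -> j \notin B -> j \notin D ->
  [disjoint B & D] -> [disjoint T & B] -> [disjoint T & D] ->
  #|B| = #|T|.+1 ->
  (1 - Q * tt ^+ (#|B| + #|D|)) * V Q (j |: T) B D =
  \sum_(k in B) (1 - tt) * tt ^+ #|[set x in B :|: D | between j k x]|
     * (if (k < j)%N then Q else 1) * V Q T (B :\ k) D.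
Proof.
move=> HQ jT jB jD dBD dTB dTD cB; rewrite V_add_top //.
rewrite -[lamb _ _]/(Wgap Q T B D j.+1).
have HT k : k \in T -> (k \notin B) && (k \notin D).
  by move=> kT; rewrite (disjointFr dTB kT) (disjointFr dTD kT).
have S1 := @Wgap_sweep Q T B D j.+1 n (ltn_ord j) (leqnn n) dBD (fun k _ => @HT k).
have S2 := @Wgap_sweep Q T B D 0 j (leq0n j) (ltnW (ltn_ord j)) dBD (fun k _ => @HT k).
(* At the right border the label balance is 0, so the inserted factor [1 - X] kills the value at 1
   and crossing the border is a pure shift. *)
have Wn : Wgap Q T B D n = Q * Wgap Q T B D 0.
  rewrite /Wgap (lamb_shift0 HQ); last first.
    by rewrite hornerM !cge_n subrr horner1B0 mul0r.
  rewrite pshiftM pshift1B !cge_n subrr add0r !cge_0 cB.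
  rewrite -addn1 PoszD addrAC subrr add0r; congr (_ * lamb _ (_ * _)).
  rewrite /Vpoly pshiftM !pshift_prod; congr (_ * _); apply: eq_bigr => k _.
    by rewrite pshift1B ltn_ord subrK subr0.
  by rewrite pshift_tX ltn_ord subrK subr0.
rewrite (Wgap_skip Q jT jB jD) in S2.
have cBD : #|B :|: D| = (#|B| + #|D|)%N by have [_ /eqP] := leq_card_setU B D; rewrite dBD => /eqP/eqP.
have cnt k : (k <= j)%N -> (ccount (B :|: D) j.+1 n + ccount (B :|: D) 0 k)%N =
    #|[set x in B :|: D | (j < x)%N || (x < k)%N]|.
  move=> kj; rewrite /ccount -cardsUI [X in (_ + X)%N]eq_card0 ?addn0; last first.
    move=> x; rewrite !inE; case: (ltnP j x) => //= jx; last by rewrite andbF.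
    by rewrite [(x < k)%N]ltnNge (leq_trans kj (ltnW jx)) !andbF.
  congr #|pred_of_set _|; apply/setP => x; rewrite !inE ltn_ord andbT leq0n.
  by rewrite -andb_orr.
have tot : (ccount (B :|: D) j.+1 n + ccount (B :|: D) 0 j = #|B| + #|D|)%N.
  rewrite cnt // -cBD; congr #|pred_of_set _|; apply/setP => x; rewrite !inE.
  case: ltngtP; rewrite ?andbT // => /val_inj E.
  by rewrite -E (negPf jB) (negPf jD).
have -> : (1 - Q * tt ^+ (#|B| + #|D|)) * Wgap Q T B D j.+1 =
  \sum_(k in B | (j < k < n)%N)
     (1 - tt) * tt ^+ ccount (B :|: D) j.+1 k * lamb Q (Vpoly k T B D) +
  tt ^+ ccount (B :|: D) j.+1 n * Q * \sum_(k in B | (0 <= k < j)%N)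
     (1 - tt) * tt ^+ ccount (B :|: D) 0 k * lamb Q (Vpoly k T B D).
  by rewrite mulrBl mul1r {1}S1 Wn S2 -tot exprD; ring.
rewrite [RHS](bigID (fun k => (j < k)%N)) /=; congr (_ + _).
  apply: eq_big => [k|k /andP[kB /andP[jk _]]]; first by rewrite ltn_ord andbT.
  rewrite ltnNge (ltnW jk) mulr1 -Vpoly_remove // /V; congr (_ * _ ^+ _ * _).
  by congr #|pred_of_set _|; apply/setP => x; rewrite !inE /between jk.
rewrite mulr_sumr; apply: eq_big => [k|k /andP[kB kj]].
  case: (boolP (k \in B)) => kB //=. rewrite -leqNgt [(k <= j)%N]leq_eqVlt val_eqE.
  by case: eqP kB jB => [-> ->|//].
rewrite kj /V Vpoly_remove //.
have -> : #|[set x in B :|: D | between j k x]| =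
    (ccount (B :|: D) j.+1 n + ccount (B :|: D) 0 k)%N.
  rewrite (cnt k (ltnW kj)); congr #|pred_of_set _|; apply/setP => x.
  by rewrite !inE /between ltnNge (ltnW kj).
rewrite exprD; ring.
Qed.

Lemma V_base Q D : V Q set0 set0 D = (1 - Q * tt ^+ #|D|)^-1.
Proof.
rewrite /V /Vpoly big_set0 mul1r -lambXn (eq_bigr (fun=> 'X)); last first.
  move=> d _; rewrite /crho /cge !big_set0 ltn0 subrr.
  by rewrite /(tX _) expr0z scale1r.
by rewrite prodr_const.
Qed.

(* With [Q = 0] there is no wrapping, and [j] may carry a bottom ball. *)
Lemma V_signed T B D j : j \notin T -> j \notin D -> [disjoint B & D] ->
  (forall k, k \in T -> (k < j)%N) ->
  \sum_(k in B | (j < k)%N) (1 - tt) *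
     tt ^+ #|[set x in B :|: D | (j < x)%N && (x < k)%N]| * V 0 T (B :\ k) D =
  (1 - tt ^ (cge B j.+1)) * (Vpoly j T B D).[1].
Proof.
move=> jT jD dBD Tj.
have HT k : (j < k < n)%N -> k \in T -> (k \notin B) && (k \notin D).
  by move=> /andP[jk _] /Tj kj; lia.
have := @Wgap_sweep 0 T B D j.+1 n (ltn_ord j) (leqnn n) dBD HT.
rewrite {2}/Wgap lamb_Q0 hornerM !cge_n subrr horner1B0 mul0r mulr0 addr0.
rewrite /Wgap lamb_Q0 hornerM horner1B Vpoly_step // (@cge_out T); last first.
  by move=> k /Tj; lia.
rewrite subr0 => ->; apply: eq_big => [k|k /andP[kB jk]].
  by rewrite ltn_ord andbT.
by rewrite -Vpoly_remove.
Qed.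

End Sweep.

(** * Sums over pairings as sequential choices *)

Section Sequential.
Variables (n : nat) (R : comNzRingType) (act : pred 'I_n).
Variable w : 'I_n -> 'I_n -> {set 'I_n} -> R.
Implicit Types (f : {ffun 'I_n -> 'I_n}) (M : {set 'I_n}) (j k : 'I_n) (P : nat).

(* The sum over sequential choices of partners for the active columns [< P], taken
   from right to left, when the partners in [M] are already used. *)
Fixpoint seqchoice P M : R :=
  if P is P'.+1 then
    if insub P' is Some j then
      if act j then \sum_k w j k M * seqchoice P' (k |: M) else seqchoice P' M
    else 1
  else 1.

Definition used P M f j : {set 'I_n} :=
  M :|: [set y | [exists x : 'I_n, [&& act x, (j < x)%N, (x < P)%N & f x == y]]].

Definition upd f j k : {ffun 'I_n -> 'I_n} := [ffun x => if x == j then k else f x].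

(** Functions are normalised to the identity off the active columns below [P], so that each sequence
    of choices is counted once. *)
Definition idle P f := [forall j : 'I_n, ((P <= j)%N || ~~ act j) ==> (f j == j)].

Lemma seqchoiceE P M : (P <= n)%N ->
  \sum_(f | idle P f) \prod_(j | act j && (j < P)%N) w j (f j) (used P M f j)
  = seqchoice P M.
Proof.
elim: P M => [|P IH] M Pn.
  rewrite (big_pred1 [ffun x => x]).
    by rewrite big1 // => j /andP[].
  move=> f /=; apply/forallP/eqP => [H|-> j]; last by rewrite ffunE eqxx implybT.
  by apply/ffunP => x; rewrite ffunE; apply/eqP; have := H x.
pose j : 'I_n := Ordinal Pn.
have Ej : insub P = Some j by rewrite insubT.
rewrite /= Ej.
have jP (x : 'I_n) : (x < P.+1)%N = (x == j) || (x < P)%N.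
  by rewrite ltnS leq_eqVlt; congr (_ || _); exact: (inj_eq val_inj x j).
have jn : (j < P)%N = false by rewrite ltnn.
case: (boolP (act j)) => aj; last first.
  have Hne (x : 'I_n) : act x -> (x < P.+1)%N = (x < P)%N.
    by rewrite jP => ax; have [E|] := eqP; first by rewrite -E ax in aj.
  rewrite -(IH _ (ltnW Pn)); apply: eq_big => f.
    apply: eq_forallb => x; congr (_ ==> _); rewrite leqNgt jP negb_or -leqNgt.
    by case: (eqVneq x j) => [->|xj]; rewrite ?xj ?aj ?orbT.
  move=> _; apply: eq_big => x.
    by case ax: (act x) => //=; rewrite Hne.
  move=> _; congr w; congr (_ :|: _); apply/setP => y; rewrite !inE.
  apply: eq_existsb => z; case az: (act z) => //=; rewrite Hne //.
rewrite (partition_big (fun f => f j) xpredT) //=; apply: eq_bigr => k _.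
rewrite -(IH _ (ltnW Pn)) mulr_sumr.
(* Functions with value [k] at [j] correspond to functions idle at [j]; the choice at [j] is
   remembered by putting [k] into [M]. *)
rewrite (reindex_onto (fun f => upd f j k) (fun f => upd f j j)) /=; last first.
  move=> f /andP[_ /eqP fj]; apply/ffunP => x; rewrite !ffunE.
  by case: eqP => // ->.
apply: eq_big => f.
  apply/andP/idP => [[/andP[/forallP H _] /eqP E]|/forallP H].
    apply/forallP => x; apply/implyP; case: (eqVneq x j) => [->|xj] Hx.
      by rewrite -E !ffunE eqxx.
    have := H x; rewrite !ffunE (negPf xj) => /implyP; apply.
    by rewrite leqNgt jP (negPf xj) /= -leqNgt.
  have Hj : f j = j by apply/eqP; have := H j; rewrite leqnn.
  split; last first.
    by apply/eqP/ffunP => x; rewrite !ffunE; case: eqP => // ->.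
  apply/andP; split; last by rewrite ffunE eqxx.
  apply/forallP => x; apply/implyP => Hx; rewrite ffunE.
  have xj : x == j = false.
    by apply/eqP => E; move: Hx; rewrite E leqNgt jP eqxx aj.
  rewrite xj; have /implyP := H x; apply.
  by case/orP: Hx => [/ltnW ->|->]; rewrite ?orbT.
move=> /andP[_ /eqP E].
have fj : f j = j by rewrite -E !ffunE eqxx.
rewrite (bigD1 j) ?aj ?jP ?eqxx //=; congr (_ * _).
  rewrite ffunE eqxx; congr w; rewrite /used; apply/setP => y; rewrite !inE.
  case: (y \in M) => //=; apply/existsP => -[x /and4P[_ jx xP _]].
  by move: xP; rewrite ltnS leqNgt jx.
apply: eq_big => x.
  by rewrite jP; case: eqP => [->|]; rewrite ?andbF ?jn ?andbF // andbT.
move=> /andP[/andP[ax xP] xj]; rewrite jP (negPf xj) /= in xP; rewrite ffunE (negPf xj); congr w.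
apply/setP => y; rewrite !inE [(y == k) || _]orbC -orbA; case: (y \in M) => //=.
apply/existsP/orP => [[z /and4P[az xz zP]]|[/eqP->|]].
- rewrite ffunE; case: (z =P j) => [_ /eqP->|/eqP zj fz]; [by left|right].
  by apply/existsP; exists z; rewrite az xz fz andbT /=; move: zP; rewrite jP (negPf zj).
- by exists j; rewrite aj ltnSn ffunE !eqxx !andbT.
- move=> /existsP[z /and4P[az xz zP fz]]; exists z.
  rewrite az xz ltnW // ffunE; case: (z =P j) zP => [->|_ _]; first by rewrite jn.
  by rewrite fz.
Qed.

End Sequential.

(** * The pairing sum of a classic layer *)

Section ClassicPairings.
Variables (K : generic_pair) (n : nat) (b c : 'I_n -> nat) (m1 : nat).
Local Notation qq := (gq K).
Local Notation tt := (gt K).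
Implicit Types (p : {ffun 'I_n -> 'I_n}) (M : {set 'I_n}) (j k x : 'I_n) (a : nat).

(** Repeats the body of [cweight] for a single layer, so that the two agree by conversion. *)
Definition crow p j : K :=
  let a := c j in
  let k := p j in
  let e := (a - m1)%N in
  let earlier (j2 : 'I_n) :=
    (c j2 != 0%N) && ((a < c j2)%N || ((c j2 == a) && (j < j2)%N)) in
  let matched (k2 : 'I_n) := [exists j2 : 'I_n, earlier j2 && (p j2 == k2)] in
  let trivp (k2 : 'I_n) := (b k2 == a) && (c k2 == a) in
  let free (k2 : 'I_n) := [&& b k2 != 0%N, ~~ matched k2 & ~~ trivp k2] in
  let between (k2 : 'I_n) :=
    if (j < k)%N then (j < k2)%N && (k2 < k)%N
    else (j < k2)%N || (k2 < k)%N in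
  let fr := #|[pred k2 : 'I_n | free k2]| in
  let sk := #|[pred k2 : 'I_n | between k2 && free k2]| in
  (1 - tt) * tt ^+ sk / (1 - qq ^+ e * tt ^+ fr) * (if (k < j)%N then qq ^+ e else 1).

Definition crow_ok p : bool :=
  [forall j : 'I_n,
    if c j == 0%N then p j == j else
    [&& b (p j) == c j, (b j == 0%N) || (c j <= b j)%N &
        (b j == c j) ==> (p j == j)]]
  && [forall j1 : 'I_n, forall j2 : 'I_n,
        [&& c j1 != 0%N, c j2 != 0%N & p j1 == p j2] ==> (j1 == j2)].

Definition csum : K :=
  \sum_(p : {ffun 'I_n -> 'I_n} | crow_ok p)
    \prod_(j : 'I_n | (c j != 0%N) && (p j != j)) crow p j.

(** When a ball of label [a] is read, all larger labels below are taken and all smaller ones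
    untouched. Reading by decreasing label can therefore be replaced by reading all columns from
    right to left, and only label [a] itself refers to [M]. *)
Definition cfree j M x : bool :=
  ((0 < b x)%N && (b x < c j)%N) || [&& b x == c j, c x != c j & x \notin M].

Definition cadm j : bool := (b j == 0%N) || (c j <= b j)%N.

(** The condition on [c k] reserves a ball lying under a ball of its own label for the trivial
    pairing. *)
Definition cstep j k M : K :=
  if [&& b k == c j, k \notin M, cadm j, (b j == c j) ==> (k == j)
       & (c k == c j) ==> (k == j)]
  then if k == j then 1 else
    (1 - tt) * tt ^+ #|[set x : 'I_n | between j k x && cfree j M x]|
    / (1 - qq ^+ (c j - m1) * tt ^+ #|[set x : 'I_n | cfree j M x]|)
    * (if (k < j)%N then qq ^+ (c j - m1) else 1)
  else 0.

Let act : pred 'I_n := fun j => c j != 0%N.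

Variables A0 A1 : nat.
Hypothesis m1A0 : (m1 < A0)%N.
Hypothesis cA : forall j, c j != 0%N -> (A0 <= c j < A1)%N.
Hypothesis cnt : forall a, (A0 <= a)%N ->
  #|[set j | b j == a]| = #|[set j | c j == a]|.

Lemma in_used p j y : (y \in used act n set0 p j) =
  [exists x : 'I_n, [&& c x != 0%N, (j < x)%N & p x == y]].
Proof. by rewrite !inE /=; apply: eq_existsb => x; rewrite ltn_ord. Qed.

Section Fixed.
Variable p : {ffun 'I_n -> 'I_n}.
Hypothesis pok : crow_ok p.

Lemma crow_okP j : c j != 0%N -> b (p j) = c j.
Proof.
by move=> cj; have /andP[/forallP/(_ j)] := pok; rewrite (negPf cj) => /and3P[/eqP].
Qed.

Lemma crow_ok_adm j : c j != 0%N -> cadm j.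
Proof.
by move=> cj; have /andP[/forallP/(_ j)] := pok; rewrite (negPf cj) => /and3P[_].
Qed.

Lemma crow_ok_triv j : c j != 0%N -> b j = c j -> p j = j.
Proof.
move=> cj E; have /andP[/forallP/(_ j)] := pok; rewrite (negPf cj) E eqxx.
by move=> /and3P[_ _ /eqP].
Qed.

Lemma crow_ok_inj j1 j2 : c j1 != 0%N -> c j2 != 0%N -> p j1 = p j2 -> j1 = j2.
Proof.
move=> c1 c2 E; have /andP[_ /forallP/(_ j1)/forallP/(_ j2)] := pok.
by rewrite c1 c2 E eqxx => /eqP.
Qed.

(** Pairings are injective and the label counts agree from [A0] on, so every such bottom ball is
    hit. *)
Lemma crow_ok_surj x : (A0 <= b x)%N -> exists2 j, c j = b x & p j = x.
Proof.
move=> bx; have bx0 : b x != 0%N by lia.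
have E : [set p j | j in [set j | c j == b x]] = [set j | b j == b x].
  apply/eqP; rewrite eqEcard; apply/andP; split.
    apply/subsetP => y /imsetP[j]; rewrite inE => /eqP cj ->.
    by rewrite inE crow_okP ?cj.
  rewrite card_in_imset ?cnt // => j1 j2; rewrite !inE => /eqP c1 /eqP c2.
  by apply: crow_ok_inj; rewrite ?c1 ?c2.
have : x \in [set p j | j in [set j | c j == b x]] by rewrite E inE.
by move=> /imsetP[j]; rewrite inE => /eqP cj Ex; exists j.
Qed.

Lemma crow_free j k2 : c j != 0%N ->
  [&& b k2 != 0%N,
      ~~ [exists j2 : 'I_n, (c j2 != 0%N)
          && ((c j < c j2)%N || ((c j2 == c j) && (j < j2)%N)) && (p j2 == k2)] &
      ~~ ((b k2 == c j) && (c k2 == c j))] = cfree j (used act n set0 p j) k2.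
Proof.
move=> cj; have aj := cA cj; rewrite /cfree in_used.
case: (ltngtP (b k2) (c j)) => Hb /=.
- rewrite orbF andbT [(0 < _)%N]lt0n; case: (boolP (b k2 != 0%N)) => //= b0.
  apply/existsP => -[j2 /andP[/andP[c2 H] /eqP E]].
  by have := crow_okP c2; rewrite E; lia.
- rewrite andbF andbT; have -> : b k2 != 0%N by lia.
  have [|j2 c2 p2] := @crow_ok_surj k2; first by lia.
  apply/negbF/existsP; exists j2; rewrite c2 p2 eqxx Hb andbT /= andbT; lia.
- have -> : [exists j2 : 'I_n, (c j2 != 0%N)
      && ((c j < c j2)%N || ((c j2 == c j) && (j < j2)%N)) && (p j2 == k2)]
    = [exists x : 'I_n, [&& c x != 0%N, (j < x)%N & p x == k2]].
    apply: eq_existsb => j2; case: (boolP (c j2 != 0%N)) => //= c2.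
    case: (eqVneq (p j2) k2) => E; rewrite ?andbF ?andbT //=.
    by have := crow_okP c2; rewrite E Hb => <-; rewrite ltnn eqxx.
  by rewrite Hb cj andbF /= andbC.
Qed.

Lemma crow_step j : c j != 0%N ->
  cstep j (p j) (used act n set0 p j) = if p j == j then 1 else crow p j.
Proof.
move=> cj; rewrite /cstep crow_okP // eqxx crow_ok_adm //=.
have -> : p j \notin used act n set0 p j.
  rewrite in_used; apply/existsP => -[x /and3P[cx jx /eqP /(crow_ok_inj cx cj) E]].
  by rewrite E ltnn in jx.
have -> : (b j == c j) ==> (p j == j) by apply/implyP => /eqP /(crow_ok_triv cj)->.
have -> : (c (p j) == c j) ==> (p j == j).
  apply/implyP => /eqP E; apply/eqP; have c' : c (p j) != 0%N by rewrite E.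
  by apply: (crow_ok_inj c' cj); apply: (crow_ok_triv c'); rewrite crow_okP.
case: ifP => //= _; rewrite /crow; congr (_ * _ ^+ _ / (1 - _ * _ ^+ _) * _).
- by apply: eq_card => x; rewrite !inE crow_free.
- by apply: eq_card => x; rewrite !inE crow_free.
Qed.

End Fixed.

Lemma csum_seqchoice : csum = seqchoice act cstep n set0.
Proof.
rewrite -seqchoiceE // /csum big_mkcond [RHS]big_mkcond; apply: eq_bigr => p _ /=.
case: (boolP (crow_ok p)) => ok.
  have -> : idle act n p.
    apply/forallP => j; rewrite leqNgt ltn_ord /= /act negbK; apply/implyP => cj.
    by have /andP[/forallP/(_ j)] := ok; rewrite cj.
  rewrite [RHS](eq_bigl (fun j => c j != 0%N)); last by move=> j; rewrite ltn_ord andbT.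
  rewrite [RHS](eq_bigr (fun j => if p j == j then 1 else crow p j)); last first.
    by move=> j cj; rewrite crow_step.
  rewrite big_mkcondr; apply: eq_bigr => j _.
  by case: eqP.
(* An invalid map contributes 0: nonzero factors [cstep] would make it a valid pairing. *)
case: ifP => // /forallP id; apply/esym/eqP; apply: contraR ok => /prodf_neq0 H.
have F j : c j != 0%N -> [&& b (p j) == c j, p j \notin used act n set0 p j, cadm j,
    (b j == c j) ==> (p j == j) & (c (p j) == c j) ==> (p j == j)].
  move=> cj; have := H j; rewrite /act cj ltn_ord /cstep => /(_ isT).
  by case: ifP; rewrite ?eqxx.
apply/andP; split.
  apply/forallP => j; case: ifP => [/eqP c0|/negbT /F/and5P[-> _ + -> _]]; last by rewrite /cadm => ->.
  by have := id j; rewrite /act c0 eqxx orbT.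
apply/forallP => j1; apply/forallP => j2; apply/implyP => /and3P[c1 c2 /eqP E].
have [_ N1 _ _ _] := and5P (F j1 c1); have [_ N2 _ _ _] := and5P (F j2 c2).
rewrite in_used in N1; rewrite in_used in N2.
apply/eqP/val_inj; case: (ltngtP j1 j2) => // H'.
  by case/existsP: N1; exists j2; rewrite c2 H' E eqxx.
by case/existsP: N2; exists j1; rewrite c1 H' E eqxx.
Qed.

Local Notation Q a := (qq ^+ (a - m1)).
Definition ctop a P : {set 'I_n} := [set j : 'I_n | [&& (j < P)%N, c j == a & b j != a]].
Definition cbot a M : {set 'I_n} := [set x | (b x == a) && (c x != a)] :\: M.
Definition cpass a : {set 'I_n} := [set x | (0 < b x)%N && (b x < a)%N].

Lemma cpass_disj a M : [disjoint cbot a M & cpass a].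
Proof.
rewrite -setI_eq0; apply/eqP/setP => x; rewrite !inE.
by case: (eqVneq (b x) a) => [->|]; rewrite ?andbF //= ltnn !andbF.
Qed.

Lemma cQ_neq1 a e : (A0 <= a)%N -> 1 - Q a * tt ^+ e != 0.
Proof. by move=> ha; apply: qt_neq1; lia. Qed.

(** Each column alters only the factor of its own label: a trivially paired ball changes nothing,
    any other ball is added by [V_classic]. The factors [1 - Q t^#cpass] normalise the value without
    top balls to 1 through [V_base]. *)
Lemma seqchoice_classic P M : (P <= n)%N -> (forall j, c j != 0%N -> cadm j) ->
  (forall a, (A0 <= a < A1)%N -> #|cbot a M| = #|ctop a P|) ->
  (forall x, (x < P)%N -> c x != 0%N -> b x = c x -> x \notin M) ->
  seqchoice act cstep P M =
  \prod_(A0 <= a < A1) ((1 - Q a * tt ^+ #|cpass a|)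
     * V (Q a) (ctop a P) (cbot a M) (cpass a)).
Proof.
move=> Pn adm; elim: P M Pn => [|P IH] M Pn HB HM.
  rewrite /= big_nat big1 // => a ha.
  have T0 : ctop a 0 = set0 by apply/setP => x; rewrite !inE.
  have B0 : cbot a M = set0.
    by apply/eqP; rewrite -cards_eq0 HB // T0 cards0.
  by rewrite T0 B0 V_base mulfV // cQ_neq1; case/andP: ha.
pose j : 'I_n := Ordinal Pn.
have Ej : insub P = Some j by rewrite insubT.
rewrite /= Ej.
have jP (x : 'I_n) : (x < P.+1)%N = (x == j) || (x < P)%N.
  by rewrite ltnS leq_eqVlt.
have jn : (j < P)%N = false by rewrite ltnn.
have ctopS a : ctop a P.+1 = if (c j == a) && (b j != a) then j |: ctop a P else ctop a P.
  apply/setP => x; rewrite !inE jP.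
  case: ifP => Hj; rewrite !inE; case: (eqVneq x j) => [->|] //=.
  by rewrite jn Hj.
case: (boolP (act j)) => cj; last first.
  rewrite IH ?(ltnW Pn) //.
  - rewrite big_nat [RHS]big_nat; apply: eq_bigr => a ha.
    by rewrite ctopS; case: eqP cj ha => [<-|//]; rewrite /act negbK => /eqP ->; lia.
  - move=> a ha; rewrite HB // ctopS.
    by case: eqP cj ha => [<-|//]; rewrite /act negbK => /eqP ->; lia.
  - by move=> x xP; apply: HM; rewrite ltnW.
have aj := cA cj.
case: (eqVneq (b j) (c j)) => Hbj.
  rewrite (bigD1 j) //= big1 ?addr0 => [|k kj]; last first.
    by rewrite /cstep Hbj eqxx (negPf kj) /= !andbF mul0r.
  rewrite /cstep Hbj !eqxx HM ?ltnSn //= adm //= mul1r IH ?(ltnW Pn) //.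
  - apply: eq_bigr => a _; rewrite ctopS Hbj.
    have -> : (c j == a) && (c j != a) = false by case: eqP.
    congr (_ * V _ _ _ _); apply/setP => x; rewrite !inE.
    by case: (eqVneq x j) => [->|] //=; rewrite Hbj; case: eqP; rewrite ?andbF.
  - move=> a ha; have := HB a ha; rewrite ctopS Hbj.
    have -> : (c j == a) && (c j != a) = false by case: eqP.
    move=> <-; congr #|pred_of_set _|; apply/setP => x; rewrite !inE.
    by case: (eqVneq x j) => [->|] //=; rewrite Hbj; case: eqP; rewrite ?andbF.
  - move=> x xP cx Ex; rewrite !inE negb_or (HM x (ltnW xP) cx Ex) andbT.
    by apply: contraTneq xP => ->; rewrite jn.
set a := c j in aj Hbj *.
have in_cbot k : (k \in cbot a M) = [&& b k == a, c k != a & k \notin M].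
  by rewrite !inE andbC -andbA.
have ain : a \in index_iota A0 A1 by rewrite mem_index_iota.
rewrite (bigD1_seq a) ?iota_uniq //=.
have Hstep k : cstep j k M * seqchoice act cstep P (k |: M) =
   if k \in cbot a M then
     (1 - tt) * tt ^+ #|[set x in cbot a M :|: cpass a | between j k x]|
     / (1 - Q a * tt ^+ (#|cbot a M| + #|cpass a|))
     * (if (k < j)%N then Q a else 1)
     * ((1 - Q a * tt ^+ #|cpass a|) * V (Q a) (ctop a P) (cbot a M :\ k) (cpass a)
     * \prod_(A0 <= i < A1 | i != a) ((1 - Q i * tt ^+ #|cpass i|) *
         V (Q i) (ctop i P.+1) (cbot i M) (cpass i)))
   else 0.
  rewrite in_cbot /cstep -/a; case: (eqVneq (b k) a) => Hbk; last by rewrite mul0r.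
  have kj : k == j = false by apply: contraNF Hbj => /eqP <-; rewrite Hbk.
  rewrite (negPf Hbj) adm // kj !implybF /= ?andbT.
  case: (boolP (k \in M)) => kM; rewrite ?andbF ?mul0r //= ?andbT.
  case: (eqVneq (c k) a) => Hck; first by rewrite mul0r.
  have fr x : cfree j M x = (x \in cbot a M :|: cpass a).
    by rewrite inE in_cbot inE orbC.
  congr (_ * _ ^+ _ / (1 - _ * _ ^+ _) * _ * _).
  - by apply: eq_card => x; rewrite !inE fr !inE andbC.
  - rewrite (_ : #|_| = #|cbot a M :|: cpass a|).
      by have [_ /eqP] := leq_card_setU (cbot a M) (cpass a); rewrite cpass_disj => /eqP/eqP.
    by apply: eq_card => x; rewrite inE fr.
  have cbotk i : cbot i (k |: M) = if i == a then cbot a M :\ k else cbot i M.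
    case: eqP => [->|/eqP ia]; apply/setP => x; rewrite !inE ?negb_or -?andbA //.
    case: (eqVneq x k) => [->|] //=; rewrite Hbk eq_sym (negPf ia) ?andbF //.
  have card_a : #|cbot a M| = (#|ctop a P|).+1.
    rewrite HB // ctopS eqxx Hbj cardsU1 !inE jn //.
  rewrite IH ?(ltnW Pn) //.
  - rewrite (bigD1_seq a) ?iota_uniq //= cbotk eqxx; congr (_ * _).
    apply: eq_bigr => i ia; rewrite cbotk (negPf ia) ctopS.
    by rewrite -/a [a == i]eq_sym (negPf ia).
  - move=> i hi; rewrite cbotk; case: eqP => [->|/eqP ia].
      apply/eqP; rewrite -eqSS -card_a (cardsD1 k (cbot a M)) in_cbot Hbk Hck kM eqxx.
      by rewrite add1n.
    by rewrite HB // ctopS -/a [a == i]eq_sym (negPf ia).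
  - move=> x xP cx Ex; rewrite !inE negb_or (HM x (ltnW xP) cx Ex) andbT.
    by apply: contraNneq Hck => E; rewrite -E -Ex E Hbk.
rewrite (eq_bigr _ (fun k _ => Hstep k)) -big_mkcond /=.
have card_a : #|cbot a M| = (#|ctop a P|).+1.
  by rewrite HB // ctopS eqxx Hbj cardsU1 !inE jn.
have cd : 1 - Q a * tt ^+ (#|cbot a M| + #|cpass a|) != 0.
  by apply: cQ_neq1; case/andP: aj.
have VC := @V_classic K n (Q a) (ctop a P) (cbot a M) (cpass a) j.
rewrite ctopS -/a eqxx Hbj /=.
set X := \prod_(A0 <= i < A1 | i != a) _; set d := 1 - _ * tt ^+ #|cpass a|.
rewrite mulrAC; apply: (mulfI cd); rewrite [RHS]mulrCA VC //; last 7 first.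
- by move=> e; apply: cQ_neq1; case/andP: aj.
- by rewrite !inE jn.
- by rewrite in_cbot (negPf Hbj).
- rewrite inE -/a; have := adm j cj; rewrite /cadm -/a.
  by case: (b j) => //= bj; rewrite leqNgt => /negPf->.
- exact: cpass_disj.
- rewrite -setI_eq0; apply/eqP/setP => x; rewrite !inE.
  by case: (c x == a); rewrite ?andbF.
- rewrite -setI_eq0; apply/eqP/setP => x; rewrite !inE.
  case: (eqVneq (c x) a) => [E|]; rewrite ?andbF // ?andbT.
  have := adm x; rewrite /cadm E => /(_ (cj : a != 0%N)).
  by case: (b x) => [|bx]; rewrite ?andbF //= leqNgt => /negPf->; rewrite andbF.
rewrite !mulr_sumr; apply: eq_bigr => k _.
have -> : (k < P)%N = (k < j)%N by [].
move: d cd (if _ then _ else _) (V _ _ _ _) X (tt ^+ #|_|) => d cd d1 d2 X d3.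
by field.
Qed.

Definition cloc (a : nat) (j : 'I_n) (b c : nat) (z : int) : {poly K} :=
  if c == a then
    if b == a then 1 else if (b == 0%N) || (a < b)%N then 1 - tX K z else 0
  else if (0 < b)%N && (b < a)%N then tX K z else 1.

Lemma cge_rho (S T : {set 'I_n}) a (j : 'I_n) :
  (forall x, (x \in S)%:Z - (x \in T)%:Z = (b x == a)%:Z - (c x == a)%:Z) ->
  crho S T j = rho a b c j.
Proof.
move=> H; rewrite /crho /cge /rho big_mkcond [in X in _ - X]big_mkcond -sumrB.
rewrite [RHS]big_mkcond; apply: eq_bigr => x _; rewrite -H.
by case: (x \in S); case: (x \in T); case: ltnP.
Qed.

Lemma csumE : csum = \prod_(A0 <= a < A1)
  ((1 - Q a * tt ^+ #|[set x : 'I_n | (0 < b x)%N && (b x < a)%N]|)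
   * lamb (Q a) (colprod cloc a b c)).
Proof.
rewrite csum_seqchoice.
(* If a top ball stands above a smaller ball, no pairing is valid, and the value 0 of [cloc] in that
   column makes the right side vanish as well. *)
case: (boolP [forall j, (c j != 0%N) ==> cadm j]) => [/forallP adm|]; last first.
  rewrite negb_forall => /existsP[j]; rewrite negb_imply => /andP[cj adm].
  have -> : seqchoice act cstep n set0 = 0.
    rewrite -seqchoiceE // big1 // => p _; rewrite (bigD1 j) ?ltn_ord ?andbT //=.
    by rewrite {1}/cstep (negPf adm) !andbF mul0r.
  apply/esym; rewrite (bigD1_seq (c j)) ?iota_uniq ?mem_index_iota ?cA //=.
  rewrite /colprod (bigD1 j) //= /cloc eqxx.
  move: adm; rewrite /cadm negb_or -ltnNge => /andP[bj0 bj].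
  by rewrite (ltn_eqF bj) (negPf bj0) ltnNge (ltnW bj) /= mul0r lamb0p mulr0 mul0r.
have {}adm j : c j != 0%N -> cadm j by move=> cj; apply: (implyP (adm j)).
rewrite seqchoice_classic //; last first.
- by move=> x; rewrite inE.
- move=> a /andP[ha _].
  have := cnt ha; rewrite -(cardsID [set j | c j == a] [set j | b j == a]).
  rewrite -(cardsID [set j | b j == a] [set j | c j == a]) setIC => /addnI.
  rewrite /cbot setD0 => E.
  rewrite (_ : [set x | _] = [set j | b j == a] :\: [set j | c j == a]).
    rewrite E; apply: eq_card => x; rewrite !inE ltn_ord andbC; done.
  by apply/setP => x; rewrite !inE andbC.
rewrite big_nat [RHS]big_nat; apply: eq_bigr => a ha; congr (_ * lamb _ _).
rewrite /Vpoly /colprod.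
have Hrho j : crho (cbot a set0) (ctop a n) j = rho a b c j.
  apply: cge_rho => x; rewrite !inE ltn_ord /=.
  by case: (b x == a); case: (c x == a).
rewrite big_mkcond [X in _ * X]big_mkcond -big_split /=; apply: eq_bigr => j _.
rewrite Hrho ?ltn0 subr0 !inE ltn_ord /cloc /=.
case: (eqVneq (c j) a) => Hc /=.
  have := adm j; rewrite /cadm Hc; have -> : a != 0%N by case/andP: ha; lia.
  move=> /(_ isT); case: (eqVneq (b j) a) => [->|Hb] /=; first by rewrite ltnn andbF mulr1.
  case: (b j) Hb => [|bj] Hb /=; first by rewrite mulr1.
  by rewrite leq_eqVlt eq_sym (negPf Hb) /= => Ha; rewrite Ha ltnNge (ltnW Ha) /= mulr1.
by rewrite mul1r.
Qed.

End ClassicPairings.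

(** * The pairing sum of a signed layer *)

Section SignedPairings.
Variables (K : generic_pair) (n : nat) (b c : 'I_n -> nat) (c0 : K).
Local Notation tt := (gt K).
Implicit Types (p : {ffun 'I_n -> 'I_n}) (M : {set 'I_n}) (j k x : 'I_n) (a : nat)
  (sg : {ffun 'I_n -> bool}).

Definition srow_exp p j : nat :=
  let a := c j in
  let k := p j in
  let earlier (j2 : 'I_n) :=
    (c j2 != 0%N) && ((a < c j2)%N || ((c j2 == a) && (j < j2)%N)) in
  let matched (k2 : 'I_n) := [exists j2 : 'I_n, earlier j2 && (p j2 == k2)] in
  let free (k2 : 'I_n) := (b k2 != 0%N) && ~~ matched k2 in
  let between (k2 : 'I_n) := (j < k2)%N && (k2 < k)%N in
  let sk := #|[pred k2 : 'I_n | between k2 && free k2]| in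
  let em := #|[pred k2 : 'I_n | between k2 && (b k2 == 0%N)]| in
  (sk + em)%N.

Definition srow (s : bool) p j : K :=
  (if s then 1 else -1) * (1 - tt) * tt ^+ srow_exp p j.

Definition srow_ok sg p : bool :=
  [forall j : 'I_n,
    if c j == 0%N then p j == j else
    [&& b (p j) == c j, (j <= p j)%N &
        if sg j then (c j <= b j)%N && ((b j == c j) ==> (p j == j))
        else (b j <= c j)%N]]
  && [forall j1 : 'I_n, forall j2 : 'I_n,
        [&& c j1 != 0%N, c j2 != 0%N & p j1 == p j2] ==> (j1 == j2)].

Definition ssum : {mpoly K[n]} :=
  \sum_(sg : {ffun 'I_n -> bool} | [forall j, (c j == 0%N) ==> sg j])
  \sum_(p : {ffun 'I_n -> 'I_n} | srow_ok sg p)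
    (\prod_(j : 'I_n | c j != 0%N) (if sg j then 'X_j else (- c0)%:MP))
    * \prod_(j : 'I_n | (c j != 0%N) && (p j != j)) (srow (sg j) p j)%:MP.

Definition sbase_ok p : bool :=
  [forall j : 'I_n,
    if c j == 0%N then p j == j else (b (p j) == c j) && (j <= p j)%N]
  && [forall j1 : 'I_n, forall j2 : 'I_n,
        [&& c j1 != 0%N, c j2 != 0%N & p j1 == p j2] ==> (j1 == j2)].

(** Empty positions of the lower row count in the exponent too, so 0 acts as an ordinary label below
    all others. *)
Definition sfree j M x : bool := (b x < c j)%N || ((b x == c j) && (x \notin M)).

(** The sum over the two signs of the top ball. Both signs are possible for a vertical pairing;
    otherwise the label below decides. A negative ball on a nontrivial strand brings two minus
    signs, whence [+ c0]. *)
Definition sstep j k M : {mpoly K[n]} :=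
  if [&& b k == c j, (j <= k)%N & k \notin M]
  then if k == j then 'X_j - c0%:MP else
    (if (c j < b j)%N then 'X_j else c0%:MP)
    * ((1 - tt) * tt ^+ #|[set x : 'I_n | [&& (j < x)%N, (x < k)%N & sfree j M x]]|)%:MP
  else 0.

Let act : pred 'I_n := fun j => c j != 0%N.

Hypothesis cnt : forall a, (0 < a)%N ->
  #|[set j | b j == a]| = #|[set j | c j == a]|.

Let in_used p j y : (y \in used act n set0 p j) =
  [exists x : 'I_n, [&& c x != 0%N, (j < x)%N & p x == y]].
Proof. by rewrite !inE /=; apply: eq_existsb => x; rewrite ltn_ord. Qed.

Section Fixed.
Variable p : {ffun 'I_n -> 'I_n}.
Hypothesis pok : sbase_ok p.

Let okP j : c j != 0%N -> b (p j) = c j.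
Proof.
by move=> cj; have /andP[/forallP/(_ j)] := pok; rewrite (negPf cj) => /andP[/eqP].
Qed.

Let ok_le j : c j != 0%N -> (j <= p j)%N.
Proof.
by move=> cj; have /andP[/forallP/(_ j)] := pok; rewrite (negPf cj) => /andP[_].
Qed.

Let ok_inj j1 j2 : c j1 != 0%N -> c j2 != 0%N -> p j1 = p j2 -> j1 = j2.
Proof.
move=> c1 c2 E; have /andP[_ /forallP/(_ j1)/forallP/(_ j2)] := pok.
by rewrite c1 c2 E eqxx => /eqP.
Qed.

Let ok_surj x : (0 < b x)%N -> exists2 j, c j = b x & p j = x.
Proof.
move=> bx; have bx0 : b x != 0%N by lia.
have E : [set p j | j in [set j | c j == b x]] = [set j | b j == b x].
  apply/eqP; rewrite eqEcard; apply/andP; split.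
    apply/subsetP => y /imsetP[j]; rewrite inE => /eqP cj ->.
    by rewrite inE okP ?cj.
  rewrite card_in_imset ?cnt // => j1 j2; rewrite !inE => /eqP c1 /eqP c2.
  by apply: ok_inj; rewrite ?c1 ?c2.
have : x \in [set p j | j in [set j | c j == b x]] by rewrite E inE.
by move=> /imsetP[j]; rewrite inE => /eqP cj Ex; exists j.
Qed.

Lemma srow_free j k2 : c j != 0%N ->
  (b k2 == 0%N) || ~~ [exists j2 : 'I_n, (c j2 != 0%N)
          && ((c j < c j2)%N || ((c j2 == c j) && (j < j2)%N)) && (p j2 == k2)]
  = sfree j (used act n set0 p j) k2.
Proof.
move=> cj; rewrite /sfree in_used.
case: (ltngtP (b k2) (c j)) => Hb /=.
- apply/orP; case: (eqVneq (b k2) 0%N) => b0; [by left|right].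
  apply/existsP => -[j2 /andP[/andP[c2 H] /eqP E]].
  by have := okP c2; rewrite E; lia.
- apply/norP; split; first by lia.
  have [|j2 c2 p2] := @ok_surj k2; first by lia.
  rewrite negbK; apply/existsP; exists j2; rewrite c2 p2 eqxx Hb andbT /= andbT; lia.
- have -> : [exists j2 : 'I_n, (c j2 != 0%N)
      && ((c j < c j2)%N || ((c j2 == c j) && (j < j2)%N)) && (p j2 == k2)]
    = [exists x : 'I_n, [&& c x != 0%N, (j < x)%N & p x == k2]].
    apply: eq_existsb => j2; case: (boolP (c j2 != 0%N)) => //= c2.
    case: (eqVneq (p j2) k2) => E; rewrite ?andbF ?andbT //=.
    by have := okP c2; rewrite E Hb => <-; rewrite ltnn eqxx.
  by rewrite Hb (negPf cj).
Qed.

Lemma srow_expE j : c j != 0%N -> srow_exp p j =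
  #|[set x : 'I_n | [&& (j < x)%N, (x < p j)%N & sfree j (used act n set0 p j) x]]|.
Proof.
move=> cj; rewrite /srow_exp -cardUI addnC [X in (X + _)%N = _]eq_card0 ?add0n.
  apply: eq_card => x; rewrite !inE -srow_free //.
  by case: (j < x)%N; case: (x < p j)%N; case: (b x == 0%N) => //=; rewrite ?orbF.
by move=> x; rewrite !inE; case: (b x == 0%N); rewrite ?andbF.
Qed.

Lemma sstep_sign j : c j != 0%N ->
  \sum_(s : bool) (if (if s then (c j <= b j)%N && ((b j == c j) ==> (p j == j))
        else (b j <= c j)%N)
     then (if s then 'X_j else (- c0)%:MP)
       * (if p j != j then (srow s p j)%:MP else 1) else 0)
  = sstep j (p j) (used act n set0 p j).
Proof.
move=> cj; rewrite big_bool /= /sstep okP // eqxx ok_le //=.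
have -> : p j \notin used act n set0 p j.
  rewrite in_used; apply/existsP => -[x /and3P[cx jx /eqP /(ok_inj cx cj) E]].
  by rewrite E ltnn in jx.
rewrite /srow srow_expE //.
case: (eqVneq (p j) j) => [E|E] /=.
  by have := okP cj; rewrite E => ->; rewrite leqnn eqxx !mulr1 mpolyCN.
case: (ltngtP (b j) (c j)) => Hb /=; rewrite ?eqxx ?add0r ?addr0 ?mul1r //.
  by rewrite -!mpolyCM; congr (_%:MP); ring.
by rewrite -!mpolyCM; congr (_%:MP); ring.
Qed.

End Fixed.

Lemma ssum_seqchoice : ssum = seqchoice act sstep n set0.
Proof.
pose F p j (s : bool) : {mpoly K[n]} :=
  if c j == 0%N then s%:R else
  (if (if s then (c j <= b j)%N && ((b j == c j) ==> (p j == j)) else (b j <= c j)%N)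
     then (if s then 'X_j else (- c0)%:MP)
       * (if p j != j then (srow s p j)%:MP else 1) else 0).
have FE sg p : sbase_ok p -> \prod_j F p j (sg j) =
    if [forall j, (c j == 0%N) ==> sg j] && srow_ok sg p then
    (\prod_(j : 'I_n | c j != 0%N) (if sg j then 'X_j else (- c0)%:MP))
    * \prod_(j : 'I_n | (c j != 0%N) && (p j != j)) (srow (sg j) p j)%:MP else 0.
  move=> ok; case: ifP => [/andP[/forallP H1 /andP[/forallP H2 _]]|].
    rewrite [X in _ = X * _]big_mkcond [X in _ = _ * X]big_mkcond -big_split /=.
    apply: eq_bigr => j _; rewrite /F; have := H2 j; have := H1 j.
    case: (eqVneq (c j) 0%N) => [_ /= -> _|_ _ /= /and3P[_ _ ->]].
      by rewrite mulr1.
    by case: (p j != j); rewrite ?mulr1.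
  move=> H; apply/eqP; apply: contraFT H => /prodf_neq0 H.
  apply/andP; split.
    apply/forallP => j; apply/implyP => cj; have := H j isT; rewrite /F cj.
    by case: (sg j); rewrite ?eqxx.
  have /andP[/forallP ok1 ok2] := ok; apply/andP; split=> //.
  apply/forallP => j; have := H j isT; have := ok1 j; rewrite /F.
  case: ifP => // _ /andP[-> ->] /=.
  by case: (if sg j then _ else _) => //; rewrite eqxx.
rewrite -seqchoiceE // /ssum (exchange_big_dep xpredT) //= [RHS]big_mkcond /=.
apply: eq_bigr => p _.
case: (boolP (sbase_ok p)) => ok; last first.
  rewrite big1 => [|sg /andP[_ /andP[/forallP H1 H2]]]; last first.
    case/negP: ok; apply/andP; split=> //; apply/forallP => j; have := H1 j.
    by case: ifP => // _ /and3P[-> ->].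
  case: ifP => // /forallP id; apply/esym/eqP; apply: contraR ok => /prodf_neq0 H.
  have G j : c j != 0%N ->
      [&& b (p j) == c j, (j <= p j)%N & p j \notin used act n set0 p j].
    move=> cj; have := H j; rewrite /act cj ltn_ord /sstep => /(_ isT).
    by case: ifP; rewrite ?eqxx.
  apply/andP; split.
    apply/forallP => j; case: ifP => [/eqP c0'|/negbT /G/and3P[-> -> _] //].
    by have := id j; rewrite /act c0' eqxx orbT.
  apply/forallP => j1; apply/forallP => j2; apply/implyP => /and3P[c1 c2 /eqP E].
  have [_ _ N1] := and3P (G j1 c1); have [_ _ N2] := and3P (G j2 c2).
  rewrite in_used in N1; rewrite in_used in N2.
  apply/eqP/val_inj; case: (ltngtP j1 j2) => // H'.
    by case/existsP: N1; exists j2; rewrite c2 H' E eqxx.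
  by case/existsP: N2; exists j1; rewrite c1 H' E eqxx.
have -> : idle act n p.
  apply/forallP => j; rewrite leqNgt ltn_ord /= /act negbK; apply/implyP => cj.
  by have /andP[/forallP/(_ j)] := ok; rewrite cj.
(* For a fixed pairing the signs in different columns are independent, so the sum over sign vectors
   is a product over columns. *)
rewrite big_mkcond /= (eq_bigr _ (fun sg _ => esym (FE sg p ok))) -bigA_distr_bigA.
rewrite [RHS]big_mkcond; apply: eq_bigr => j _; rewrite ltn_ord andbT /act.
case: (eqVneq (c j) 0%N) => cj /=.
  by rewrite big_bool /F cj eqxx /= addr0.
by rewrite -sstep_sign // /F (negPf cj).
Qed.

Variable A1 : nat.
Hypothesis cA : forall j, (c j < A1)%N.

Definition stop a P : {set 'I_n} := [set j : 'I_n | (j < P)%N && (c j == a)].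
Definition sbot a M : {set 'I_n} := [set x | b x == a] :\: M.
Definition spass a : {set 'I_n} := [set x | (b x < a)%N].

(** If the label below [j] is smaller than [a], column [j] also belongs to [spass a], and its factor
    in [dpart] still counts the ball that the strand of [j] takes; [t^-1] corrects this. *)
Definition stopw a j (z : int) : {mpoly K[n]} :=
  if (a < b j)%N then (1 - tt ^ z) *: 'X_j
  else if (b j < a)%N then (c0 * tt^-1 * (1 - tt ^ z))%:MP
  else 'X_j - (c0 * tt ^ z)%:MP.

Definition dpart (B T D : {set 'I_n}) : K := \prod_(d in D) tt ^ crho B T d.

Definition sval a P M : {mpoly K[n]} :=
  (\prod_(j in stop a P) stopw a j (crho (sbot a M) (stop a P) j))
  * (dpart (sbot a M) (stop a P) (spass a))%:MP.

(** This is [V_signed] for an empty set of tops: the tops in [T] only contribute the constant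
    [u]. *)
Lemma dpart_sum (B T D : {set 'I_n}) j : j \notin T -> j \notin D ->
  [disjoint B & D] ->
  \sum_(k in B | (j < k)%N) (1 - tt) *
     tt ^+ #|[set x in B :|: D | (j < x)%N && (x < k)%N]| * dpart (B :\ k) T D =
  (1 - tt ^ cge B j.+1) * dpart B (j |: T) D.
Proof.
move=> jT jD dBD.
pose u := \prod_(d in D) tt ^ (- cge T d.+1).
have E (B' : {set 'I_n}) : dpart B' T D = V 0 set0 B' D * u.
  rewrite /V lamb_Q0 /Vpoly big_set0 mul1r horner_prod -big_split /=.
  apply: eq_bigr => d _; rewrite horner_tX -expfzDr ?tt_neq0 //.
  by rewrite /crho [cge set0 _]big_set0 !subr0.
have := @V_signed K n set0 B D j; rewrite inE => /(_ isT jD dBD) H.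
under eq_bigr => k _ do rewrite E mulrA.
rewrite -mulr_suml H => [|k]; last by rewrite inE.
rewrite -mulrA; congr (_ * _).
rewrite /Vpoly big_set0 mul1r horner_prod -big_split /=; apply: eq_bigr => d _.
rewrite horner_tX -expfzDr ?tt_neq0 //; congr (_ ^ _).
by rewrite /crho cge_U1 // [cge set0 _]big_set0; ring.
Qed.

Lemma seqchoice_signed P M : (P <= n)%N ->
  (forall a, (0 < a < A1)%N -> #|sbot a M| = #|stop a P|) ->
  (forall x, x \in M -> (P <= x)%N) ->
  seqchoice act sstep P M = \prod_(1 <= a < A1) sval a P M.
Proof.
elim: P M => [|P IH] M Pn HB HM.
  rewrite /= big_nat big1 // => a ha.
  have T0 : stop a 0 = set0 by apply/setP => x; rewrite !inE.
  have B0 : sbot a M = set0.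
    by apply/eqP; rewrite -cards_eq0 HB // T0 cards0.
  rewrite /sval T0 B0 big_set0 mul1r /dpart big1 // => d _.
  by rewrite /crho /cge !big_set0 subrr expr0z.
pose j : 'I_n := Ordinal Pn.
have Ej : insub P = Some j by rewrite insubT.
rewrite /= Ej.
have jP (x : 'I_n) : (x < P.+1)%N = (x == j) || (x < P)%N.
  by rewrite ltnS leq_eqVlt.
have jn : (j < P)%N = false by rewrite ltnn.
have stopS a : stop a P.+1 = if c j == a then j |: stop a P else stop a P.
  apply/setP => x; rewrite !inE jP.
  case: ifP => Hj; rewrite !inE; case: (eqVneq x j) => [->|] //=.
  by rewrite jn Hj.
case: (boolP (act j)) => cj; last first.
  have ca a : (0 < a < A1)%N -> (c j == a) = false.
    by case: eqP cj => [<-|//]; rewrite /act negbK => /eqP ->.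
  rewrite IH ?(ltnW Pn) //.
  - rewrite big_nat [RHS]big_nat; apply: eq_bigr => a ha.
    by rewrite /sval stopS ca.
  - by move=> a ha; rewrite HB // stopS ca.
  - by move=> x /HM /ltnW.
have aj : (0 < c j < A1)%N by rewrite lt0n cA andbT; exact: cj.
set a := c j in aj *.
have ain : a \in index_iota 1 A1 by rewrite mem_index_iota.
have in_sbot k : (k \in sbot a M) = (b k == a) && (k \notin M) by rewrite !inE andbC.
have jM : j \notin M by apply/negP => /HM; rewrite ltnn.
have jT : j \notin stop a P by rewrite inE jn.
have Tj k : k \in stop a P -> (k < j)%N by rewrite inE => /andP[].
have cT k : (j <= k)%N -> cge (stop a P) k.+1 = 0.
  by move=> jk; apply: cge_out => x /Tj xj; lia.
set T := stop a P in jT Tj cT *; set B := sbot a M in in_sbot *; set D := spass a.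
have dBD : [disjoint B & D].
  rewrite -setI_eq0; apply/eqP/setP => x; rewrite !inE.
  by case: (eqVneq (b x) a) => [->|]; rewrite ?ltnn ?andbF.
(* For tops to the left of [j], the removal of a ball [k >= j] and the additional top [j] change the
   label balance equally, so these factors are the same for every choice of [k]. *)
set TP := \prod_(i in T) stopw a i (crho B (j |: T) i).
set X := \prod_(1 <= i < A1 | i != a) sval i P.+1 M.
have Hstep k : sstep j k M * seqchoice act sstep P (k |: M) =
   if (k \in B) && (j <= k)%N then
     (if k == j then 'X_j - c0%:MP else
       (if (a < b j)%N then 'X_j else c0%:MP)
       * ((1 - tt) * tt ^+ #|[set x in B :|: D | (j < x)%N && (x < k)%N]|)%:MP)
     * (TP * (dpart (B :\ k) T D)%:MP * X)
   else 0.
  rewrite in_sbot /sstep -/a; case: (eqVneq (b k) a) => Hbk /=; last by rewrite mul0r.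
  rewrite andbC; case: (boolP (k \in M)) => kM; rewrite ?mul0r //=.
  case: (leqP j k) => jk; rewrite ?mul0r //=.
  have fr x : sfree j M x = (x \in B :|: D).
    by rewrite inE in_sbot inE orbC.
  congr (_ * _).
    case: ifP => // _; congr (_ * (_ * _ ^+ _)%:MP).
    apply: eq_card => x; rewrite !inE fr !inE; case: (j < x)%N; case: (x < k)%N; rewrite ?andbF ?andbT //.
  have sbotk i : sbot i (k |: M) = if i == a then B :\ k else sbot i M.
    case: eqP => [->|/eqP ia]; apply/setP => x; rewrite !inE ?negb_or -?andbA //.
    by case: (eqVneq x k) => [->|] //=; rewrite Hbk eq_sym (negPf ia) ?andbF.
  have kB : k \in B by rewrite in_sbot Hbk eqxx.
  rewrite IH ?(ltnW Pn) //.
  - rewrite (bigD1_seq a) ?iota_uniq //=; congr (_ * _); last first.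
      apply: eq_bigr => i ia; rewrite /sval sbotk (negPf ia) stopS.
      by rewrite -/a [a == i]eq_sym (negPf ia).
    rewrite /sval sbotk eqxx -/T; congr (_ * _); apply: eq_bigr => i /Tj ij.
    by rewrite /crho cge_D1 // cge_U1 // ij (leq_trans ij jk) opprD addrA addrAC.
  - move=> i hi; rewrite sbotk; case: eqP => [->|/eqP ia].
      apply/eqP; rewrite -eqSS; have := HB a aj.
      rewrite stopS eqxx cardsU1 -/T jT add1n => <-.
      by rewrite (cardsD1 k B) kB.
    by rewrite HB // stopS -/a [a == i]eq_sym (negPf ia).
  - move=> x; rewrite !inE => /orP[/eqP->//|/HM/ltnW//].
rewrite (eq_bigr _ (fun k _ => Hstep k)) -big_mkcond /=.
rewrite (bigD1_seq a) ?iota_uniq //= -/X.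
have crj : crho B (j |: T) j = cge B j.+1.
  by rewrite /crho cge_U1 // ltnn addr0 cT // subr0.
set dfin := dpart B (j |: T) D.
have -> : sval a P.+1 M = stopw a j (cge B j.+1) * dfin%:MP * TP.
  by rewrite /sval stopS eqxx -/T -/B -/D big_setU1 //= crj mulrAC.
have Sgt : \sum_(k in B | (j < k)%N) (1 - tt) *
     tt ^+ #|[set x in B :|: D | (j < x)%N && (x < k)%N]| * dpart (B :\ k) T D =
  (1 - tt ^ cge B j.+1) * (if (b j < a)%N then tt^-1 else 1) * dfin.
  case: ifP => bja; last by rewrite mulr1 dpart_sum // inE bja.
  have jD : j \in D by rewrite inE.
  have dBD' : [disjoint B & D :\ j] by apply: disjointWr dBD; apply: subD1set.
  have := @dpart_sum B T (D :\ j) j jT _ dBD'; rewrite !inE eqxx => /(_ isT) H.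
  have -> : dfin = tt ^ (cge B j.+1) * dpart B (j |: T) (D :\ j).
    by rewrite /dfin /dpart (big_setD1 j) //= crj.
  rewrite (eq_bigr (fun k => tt ^ (cge B j.+1 - 1) * ((1 - tt) *
     tt ^+ #|[set x in B :|: D :\ j | (j < x)%N && (x < k)%N]|
     * dpart (B :\ k) T (D :\ j)))).
    rewrite -mulr_sumr H expfzDr ?tt_neq0 // exprN1; ring.
  move=> k /andP[kB jk]; rewrite [dpart _ T D](big_setD1 j) //=.
  rewrite [in LHS]/crho cge_D1 // cT // jk subr0 mulrCA; congr (_ * (_ * _ ^+ _ * _)).
  apply: eq_card => x; rewrite !inE; case: (eqVneq x j) => [->|] //=.
  by rewrite ltnn !andbF.
rewrite (eq_bigr (fun k => (if k == j then 'X_j - c0%:MP else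
       (if (a < b j)%N then 'X_j else c0%:MP)
       * ((1 - tt) * tt ^+ #|[set x in B :|: D | (j < x)%N && (x < k)%N]|)%:MP)
       * (dpart (B :\ k) T D)%:MP * (TP * X))); last first.
  by move=> k _; rewrite -!mulrA; congr (_ * _); rewrite mulrCA.
rewrite -mulr_suml -[RHS]mulrA; congr (_ * _).
have Sgt' : \sum_(k in B | (j < k)%N) (if k == j then 'X_j - c0%:MP else
       (if (a < b j)%N then 'X_j else c0%:MP)
       * ((1 - tt) * tt ^+ #|[set x in B :|: D | (j < x)%N && (x < k)%N]|)%:MP)
       * (dpart (B :\ k) T D)%:MP =
  (if (a < b j)%N then 'X_j else c0%:MP) *
  ((1 - tt ^ cge B j.+1) * (if (b j < a)%N then tt^-1 else 1) * dfin)%:MP.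
  rewrite -Sgt raddf_sum mulr_sumr; apply: eq_bigr => k /andP[_ jk].
  by rewrite -val_eqE /= gtn_eqF // -mulrA -mpolyCM.
have le_lt k : ((k \in B) && (j <= k)%N) && (k != j) = (k \in B) && (j < k)%N.
  by rewrite -andbA; congr (_ && _); rewrite [RHS]ltn_neqAle andbC eq_sym.
case: (ltngtP (b j) a) Sgt' => Hb Sgt'.
- rewrite (eq_bigl (fun k => (k \in B) && (j < k)%N)) => [|k].
    rewrite Sgt' /stopw ltnNge (ltnW Hb) Hb /= -!mpolyCM; congr (_%:MP); ring.
  rewrite -le_lt; case: (eqVneq k j) => [->|]; rewrite ?andbT // andbF in_sbot.
  by rewrite (ltn_eqF Hb).
- rewrite (eq_bigl (fun k => (k \in B) && (j < k)%N)) => [|k].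
    by rewrite Sgt' /stopw Hb mulr1 mpolyCM mulrA -mul_mpolyC [_ * 'X_j]mulrC.
  rewrite -le_lt; case: (eqVneq k j) => [->|]; rewrite ?andbT // andbF in_sbot.
  by rewrite (gtn_eqF Hb).
- have jB : j \in B by rewrite in_sbot Hb eqxx.
  rewrite (bigD1 j) ?jB ?leqnn //= eqxx (eq_bigl _ _ le_lt) Sgt' mulr1.
  have -> : dpart (B :\ j) T D = dfin.
    by apply: eq_bigr => d _; rewrite /crho cge_D1 // cge_U1 // opprD addrA addrAC.
  rewrite /stopw Hb ltnn -mpolyCM mulrA mpolyCM -mulrDl; congr (_ * _).
  by rewrite mulrBr mulr1 mpolyCB addrA subrK.
Qed.

Definition sloc (a : nat) (j : 'I_n) (b c : nat) (z : int) : {mpoly K[n]} :=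
  if c == a then
    if (a < b)%N then (1 - tt ^ z) *: 'X_j
    else if (b < a)%N then (c0 * tt^-1 * (1 - tt ^ z) * tt ^ z)%:MP
    else 'X_j - (c0 * tt ^ z)%:MP
  else if (b < a)%N then (tt ^ z)%:MP else 1.

Lemma ssumE : ssum = \prod_(1 <= a < A1) colprod sloc a b c.
Proof.
rewrite ssum_seqchoice seqchoice_signed // => [|a ha|x]; last by rewrite inE.
- rewrite big_nat [RHS]big_nat; apply: eq_bigr => a ha.
  rewrite /sval /dpart /colprod rmorph_prod /=.
  have Hrho j : crho (sbot a set0) (stop a n) j = rho a b c j.
    rewrite /crho /cge /rho big_mkcond [in X in _ - X]big_mkcond -sumrB.
    rewrite [RHS]big_mkcond; apply: eq_bigr => x _; rewrite !inE ltn_ord /=.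
    by case: (b x == a); case: (c x == a); case: ltnP.
  rewrite big_mkcond [X in _ * X]big_mkcond -big_split /=; apply: eq_bigr => j _.
  rewrite Hrho !inE ltn_ord /sloc /stopw /=.
  case: (c j == a); last by rewrite mul1r.
  by case: (ltngtP (b j) a) => _; rewrite ?mulr1 -?mpolyCM.
- rewrite (_ : sbot a set0 = [set j | b j == a]); last by apply/setP => x; rewrite !inE.
  rewrite cnt; first by apply: eq_card => x; rewrite !inE ltn_ord.
  by case/andP: ha.
Qed.

End SignedPairings.

(** * Exchange relations *)

(* Bottom labels are compared with [0] playing the role of infinity. *)
Definition igt (b1 b2 : nat) : bool := (b2 != 0%N) && ((b1 == 0%N) || (b2 < b1)%N).

Ltac split_ifs := repeat (match goal with
  | |- context [nat_of_bool ?b] => case: (boolP b) => ? /=; try (exfalso; lia)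
  | |- context [if ?b then _ else _] => case: (boolP b) => ? /=; try (exfalso; lia)
  end).

(** * Exchange relations of the classic layer *)

Section ClassicExchange.
Variables (K : generic_pair) (n : nat) (i : 'I_n).
Hypothesis Hi : (i.+1 < n)%N.
Local Notation tt := (gt K).
Local Notation two a := (twocol (@cloc K n) i a).

Lemma tXe z : (tX K (z + (0%:Z - 0%:Z)) = tX K z) * (tX K (z + (1%:Z - 1%:Z)) = tX K z)
  * (tX K (z + (1%:Z - 0%:Z)) = tt *: tX K z)
  * (tX K (z + (0%:Z - 1%:Z)) = tt^-1 *: tX K z).
Proof.
rewrite !subrr subr0 sub0r addr0 /(tX _) !expfzDr ?tt_neq0 // expr1z exprN1 !scalerA.
by rewrite ![tt ^ z * _]mulrC.
Qed.

Ltac fin := rewrite ?tXe ?expr0 ?expr1 ?scale1r ?mul1r ?mulr1 ?mul0r ?mulr0 ?scaler0 //.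

(** The two-column identities are organised by the larger top label [p] and the smaller bottom label
    [B2]. Both tops fit above [B2] if [p <= B2], equality allows a trivial pairing, and for [p > B2]
    the arrangements with [p] above [B2] vanish. Swapping the bottom labels costs [t] in the species
    of the larger one. *)
Lemma two_swap a B1 B2 p q z : (0 < a)%N -> igt B1 B2 -> (q <= p <= B2)%N ->
  two a B2 B1 p q z = tt ^+ (a == B1) *: two a B1 B2 q p z.
Proof.
rewrite /igt => a0 HB pq; rewrite /twocol /cloc; split_ifs.
all: fin.
Qed.

Lemma two_bad1 B1 B2 p q z : igt B1 B2 -> (B2 < p)%N -> two p B2 B1 p q z = 0.
Proof. rewrite /igt => HB pq; rewrite /twocol /cloc; split_ifs; by fin. Qed.

Lemma two_bad2 B1 B2 p q z : igt B1 B2 -> (B2 < p)%N -> two p B1 B2 q p z = 0.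
Proof. rewrite /igt => HB pq; rewrite /twocol /cloc; split_ifs; by fin. Qed.

Lemma two_bad3 B1 B2 p q z : (0 < B1 < p)%N -> two p B1 B2 p q z = 0.
Proof. move=> HB; rewrite /twocol /cloc; split_ifs; by fin. Qed.

Lemma two_bad4 B1 B2 p q z : (0 < B2 < p)%N -> two p B1 B2 q p z = 0.
Proof. move=> HB; rewrite /twocol /cloc; split_ifs; by fin. Qed.

Lemma two_over a B1 B2 p q z : (0 < a)%N -> igt B1 B2 -> (q <= B2 < p)%N ->
  (B1 = 0%N \/ p <= B1)%N ->
  tt ^+ (a == p) *: two a B2 B1 q p z = tt ^+ (a == B1) *: two a B1 B2 p q z.
Proof.
rewrite /igt => a0 HB pq pB; rewrite /twocol /cloc; split_ifs.
all: fin.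
by rewrite -scalerAl scalerA mulfV ?tt_neq0 // scale1r mulrC.
Qed.

Lemma two_under a B1 B2 p q z : (0 < a)%N -> igt B1 B2 -> (q < p <= B2)%N ->
  (a != p) || (p != B2) ->
  (two a B2 B1 q p z = tt ^+ (a == B1) *: two a B1 B2 q p z)
  * (two a B1 B2 p q z = two a B1 B2 q p z).
Proof.
rewrite /igt => a0 HB pq pB; split; rewrite /twocol /cloc; split_ifs.
all: fin.
Qed.

(** With a trivial pairing on one side the relation genuinely involves three terms; in the other
    cases the terms are proportional or some of them vanish. *)
Lemma two_at B1 p q z : (0 < p)%N -> igt B1 p -> (q < p)%N ->
  tt *: two p p B1 q p z = two p B1 p p q z + (tt - 1) *: two p B1 p q p z.
Proof.
rewrite /igt => p0 HB pq; rewrite /twocol /cloc; split_ifs.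
all: fin.
by rewrite scalerBr scalerBl scale1r [_ - 1]addrC addrACA subrr add0r addrC.
Qed.

Lemma two_equal a B p q z : (0 < a)%N -> (B = 0%N \/ p <= B)%N -> (q < p)%N ->
  two a B B p q z = two a B B q p z.
Proof.
move=> a0 HB pq; rewrite /twocol /cloc; split_ifs.
all: fin.
Qed.

Variables (m1 A0 A1 : nat).
Hypothesis A0_gt0 : (0 < A0)%N.
Local Notation s := (sgen i).
Local Notation i' := (nxt i).
Implicit Types b c : 'I_n -> nat.

Definition Cmat (k : nat) (m1 A0 A1 : nat) (b c : 'I_k -> nat) : K :=
  \prod_(A0 <= a < A1)
    ((1 - gq K ^+ (a - m1) * tt ^+ #|[set x : 'I_k | (0 < b x)%N && (b x < a)%N]|)
   * lamb (gq K ^+ (a - m1)) (colprod (@cloc K k) a b c)).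
Local Notation C := (@Cmat n m1 A0 A1).

Lemma card_pass_swap b a :
  #|[set x : 'I_n | (0 < (b \o s) x)%N && ((b \o s) x < a)%N]|
  = #|[set x : 'I_n | (0 < b x)%N && (b x < a)%N]|.
Proof.
rewrite -(card_imset _ (can_inj (@sgenK _ i))); apply: eq_card => x.
apply/imsetP/idP => [[y]|].
  by rewrite !inE => H ->.
by rewrite inE => H; exists (s x); rewrite ?inE /= sgenK.
Qed.

Lemma prod_tt_eq B : \prod_(A0 <= a < A1) tt ^+ (a == B) =
  tt ^+ (A0 <= B < A1)%N.
Proof.
case: (boolP (A0 <= B < A1)%N) => HB.
  rewrite (bigD1_seq B) ?iota_uniq ?mem_index_iota //= eqxx.
  by rewrite big1 ?mulr1 // => a /negPf->.
by rewrite big_nat big1 // => a; case: eqP => // ->; rewrite (negPf HB).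
Qed.

Lemma Cmat_ext b c b' c' : b =1 b' -> c =1 c' -> C b c = C b' c'.
Proof.
move=> Eb Ec; apply: eq_bigr => a _; rewrite (colprod_ext _ _ Eb Ec).
by congr ((1 - _ * _ ^+ _) * _); apply: eq_card => x; rewrite !inE Eb.
Qed.

Lemma Cmat_zero b c a : (A0 <= a < A1)%N -> colprod (@cloc K n) a b c = 0 -> C b c = 0.
Proof.
move=> ha E; rewrite /Cmat (bigD1_seq a) ?iota_uniq ?mem_index_iota //=.
by rewrite E lamb0p mulr0 mul0r.
Qed.

Lemma Cmat_scale b c b' c' B B' :
  (forall a, #|[set x : 'I_n | (0 < b x)%N && (b x < a)%N]|
    = #|[set x : 'I_n | (0 < b' x)%N && (b' x < a)%N]|) ->
  (forall a, (A0 <= a < A1)%N -> tt ^+ (a == B) *: colprod (@cloc K n) a b c =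
     tt ^+ (a == B') *: colprod (@cloc K n) a b' c') ->
  tt ^+ (A0 <= B < A1)%N * C b c = tt ^+ (A0 <= B' < A1)%N * C b' c'.
Proof.
move=> Hc H; rewrite -!prod_tt_eq /Cmat -!big_split /=.
rewrite big_nat [RHS]big_nat; apply: eq_bigr => a ha.
by rewrite mulrCA -lambZ H // lambZ Hc [RHS]mulrCA.
Qed.

Section Rows.
Variables b c : 'I_n -> nat.
Hypothesis Hb : forall j, b j = 0%N \/ (A0.-1 <= b j < A1)%N.
Hypothesis Hc : forall j, c j = 0%N \/ (A0 <= c j < A1)%N.

Let sb := colprod_split_swapb (@cloc K n) Hi.
Let sc := colprod_split_swapc (@cloc K n) Hi.
Let s0 := colprod_split (@cloc K n) Hi.

Let crange j : c j != 0%N -> (A0 <= c j < A1)%N.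
Proof. by case: (Hc j) => [->|]. Qed.

(** The lower row may carry the label [A0 - 1], which has no strands in this layer. Being minimal
    for [igt], it is never the larger of two bottom labels. *)
Let B1range : igt (b i) (b i') -> (A0 <= b i < A1)%N = (b i != 0%N).
Proof.
by rewrite /igt; case: (Hb i) => [->|]; case: (Hb i') => [->|] //; lia.
Qed.

Lemma Cmat_exch_ge : igt (b i) (b i') -> (c i' <= c i)%N ->
  tt * C b (c \o s) = (if b i == 0%N then tt else 1) * C (b \o s) c.
Proof.
move=> HB pq; have := B1range HB => HR.
case: (leqP (c i) (b i')) => pB.
  have := @Cmat_scale (b \o s) c b (c \o s) 0%N (b i) (card_pass_swap b) _.
  rewrite HR leqn0 (gtn_eqF A0_gt0) /= expr0 mul1r => ->; last first.
    move=> a /andP[ha _]; have a0 : (0 < a)%N by lia.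
    rewrite (gtn_eqF a0) scale1r sb sc (two_swap _ _ HB) ?pq //.
    by rewrite -scalerAr.
  by case: (b i == 0%N) => /=; rewrite ?expr1 ?expr0 ?mul1r.
have cr : (A0 <= c i < A1)%N by apply: crange; lia.
rewrite !(Cmat_zero cr) ?mulr0 // ?sb ?sc.
  by rewrite (two_bad1 _ _ HB pB) mulr0.
by rewrite (two_bad2 _ _ HB pB) mulr0.
Qed.

Lemma Cmat_exch_lt : igt (b i) (b i') -> (c i < c i')%N ->
  C b (c \o s) + (tt - 1) * C b c = (if b i == 0%N then tt else 1) * C (b \o s) c.
Proof.
move=> HB pq; have := B1range HB => HR.
have cr : (A0 <= c i' < A1)%N by apply: crange; lia.
have b'0 : (0 < b i')%N by move: HB; rewrite /igt lt0n => /andP[].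
case: (ltngtP (c i') (b i')) => pB.
- have E a : (A0 <= a < A1)%N -> (a != c i') || (c i' != b i') by rewrite (ltn_eqF pB) orbT.
  have pqB : (c i < c i' <= b i')%N by rewrite pq ltnW.
  have := @Cmat_scale (b \o s) c b c 0%N (b i) (card_pass_swap b) _.
  rewrite HR leqn0 (gtn_eqF A0_gt0) /= expr0 mul1r => ->; last first.
    move=> a ha; have a0 : (0 < a)%N by lia.
    by rewrite (gtn_eqF a0) scale1r sb s0 (two_under _ a0 HB pqB (E a ha)) -scalerAr.
  have := @Cmat_scale b (c \o s) b c 0%N 0%N (fun=> erefl) _.
  rewrite leqn0 (gtn_eqF A0_gt0) /= expr0 !mul1r => ->; last first.
    move=> a ha; have a0 : (0 < a)%N by lia.
    by rewrite sc s0 (two_under _ a0 HB pqB (E a ha)).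
  by case: (b i == 0%N) => /=; rewrite ?expr1 ?expr0 ?mul1r; ring.
- rewrite (Cmat_zero (c := c) cr) ?mulr0 ?addr0; last first.
    by rewrite s0 two_bad4 ?mulr0 // b'0.
  case: (leqP (c i) (b i')) => qB; last first.
    have cr' : (A0 <= c i < A1)%N by apply: crange; lia.
    rewrite !(Cmat_zero cr') ?mulr0 // ?sb ?sc.
      by rewrite two_bad3 ?mulr0 // b'0.
    by rewrite two_bad4 ?mulr0 // b'0.
  case: (boolP ((b i == 0%N) || (c i' <= b i)%N)) => pB1; last first.
    have pB2 : (0 < b i < c i')%N by lia.
    rewrite !(Cmat_zero cr) ?mulr0 // ?sb ?sc.
      by rewrite two_bad4 ?mulr0.
    by rewrite two_bad3 ?mulr0.
  have := @Cmat_scale (b \o s) c b (c \o s) (c i') (b i) (card_pass_swap b) _.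
  rewrite HR cr expr1 => H.
  have {}H : tt * C (b \o s) c = tt ^+ (b i != 0%N) * C b (c \o s).
    apply: H => a ha; have a0 : (0 < a)%N by lia.
    have H1 : (c i <= b i' < c i')%N by rewrite qB.
    have H2 : b i = 0%N \/ (c i' <= b i)%N by case/orP: pB1 => [/eqP|]; [left|right].
    by rewrite sb sc [LHS]scalerAr [RHS]scalerAr (two_over _ a0 HB H1 H2).
  case: (b i == 0%N) H => /= H; first by rewrite H expr0 mul1r.
  by rewrite mul1r; apply: (mulfI (tt_neq0 K)); rewrite H.
- have pqB : (c i < c i' <= b i')%N by rewrite pq pB leqnn.
  have HB' : igt (b i) (c i') by rewrite pB.
  pose nrm a := 1 - gq K ^+ (a - m1) * tt ^+ #|[set x : 'I_n | (0 < b x)%N && (b x < a)%N]|.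
  have split_c b1 c1 : (forall a, #|[set x : 'I_n | (0 < b1 x)%N && (b1 x < a)%N]|
      = #|[set x : 'I_n | (0 < b x)%N && (b x < a)%N]|) ->
      C b1 c1 = nrm (c i') * lamb (gq K ^+ (c i' - m1)) (colprod (@cloc K n) (c i') b1 c1)
      * \prod_(A0 <= a < A1 | a != c i')
          (nrm a * lamb (gq K ^+ (a - m1)) (colprod (@cloc K n) a b1 c1)).
    move=> Hcard; rewrite /Cmat (bigD1_seq (c i')) ?iota_uniq ?mem_index_iota //=.
    by rewrite /nrm Hcard; congr (_ * _); apply: eq_bigr => a _; rewrite Hcard.
  rewrite !split_c //; last exact: card_pass_swap.
  set X := \prod_(A0 <= a < A1 | _) _; set Y := \prod_(A0 <= a < A1 | _) _.
  set Z := \prod_(A0 <= a < A1 | _) _.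
  have ne a : a != c i' -> (a != c i') || (c i' != b i') by move=> ->.
  have XY : X = Y.
    rewrite /X /Y big_nat_cond [RHS]big_nat_cond; apply: eq_bigr => a.
    move=> /andP[/andP[ha _] na]; have a0 : (0 < a)%N by lia.
    by rewrite sc s0 (two_under _ a0 HB pqB (ne a na)).
  have ZY : Z = tt ^+ (b i != 0%N) * Y.
    have <- : \prod_(A0 <= a < A1 | a != c i') tt ^+ (a == b i) = tt ^+ (b i != 0%N).
      rewrite -HR -prod_tt_eq [RHS](bigD1_seq (c i')) ?iota_uniq ?mem_index_iota //=.
      have -> : (c i' == b i) = false by move: HB'; rewrite /igt; lia.
      by rewrite expr0 mul1r.
    rewrite /Z /Y -big_split /= big_nat_cond [RHS]big_nat_cond; apply: eq_bigr => a.
    move=> /andP[/andP[ha _] na]; have a0 : (0 < a)%N by lia.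
    by rewrite sb s0 (two_under _ a0 HB pqB (ne a na)) -scalerAr lambZ; ring.
  rewrite XY ZY.
  have : tt * lamb (gq K ^+ (c i' - m1)) (colprod (@cloc K n) (c i') (b \o s) c)
     = lamb (gq K ^+ (c i' - m1)) (colprod (@cloc K n) (c i') b (c \o s))
     + (tt - 1) * lamb (gq K ^+ (c i' - m1)) (colprod (@cloc K n) (c i') b c).
    rewrite -!lambZ -lambD; congr lamb; rewrite sb sc s0 -pB.
    rewrite [LHS]scalerAr two_at //; last by rewrite pB.
    by rewrite mulrDr -scalerAr.
  set l1 := lamb _ (colprod _ _ (b \o s) c).
  set l2 := lamb _ (colprod _ _ b (c \o s)); set l3 := lamb _ (colprod _ _ b c) => El.
  have -> : l2 = tt * l1 - (tt - 1) * l3 by rewrite El; ring.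
  by case: (b i == 0%N) => /=; rewrite ?expr1 ?expr0; ring.
Qed.

Lemma Cmat_exch_eq : b i = b i' -> C b (c \o s) = C b c.
Proof.
move=> HB.
have gen p q : (q < p)%N -> p != 0%N ->
    forall c1 c2 : 'I_n -> nat, (forall a, colprod (@cloc K n) a b c1 =
        colrest (@cloc K n) i a b c * two a (b i) (b i) p q (rho a b c i')) ->
    (forall a, colprod (@cloc K n) a b c2 =
        colrest (@cloc K n) i a b c * two a (b i) (b i) q p (rho a b c i')) ->
    (A0 <= p < A1)%N -> C b c1 = C b c2.
  move=> pq p0 c1 c2 E1 E2 hp.
  case: (boolP ((b i == 0%N) || (p <= b i)%N)) => pB.
    rewrite /Cmat big_nat [RHS]big_nat; apply: eq_bigr => a ha.
    have a0 : (0 < a)%N by lia.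
    by rewrite E1 E2 (two_equal _ a0 _ pq) //; case/orP: pB => [/eqP|]; [left|right].
  have pB' : (0 < b i < p)%N by lia.
  by rewrite !(Cmat_zero hp) ?E1 ?E2 ?two_bad3 ?two_bad4 ?mulr0.
case: (ltngtP (c i) (c i')) => H.
- apply: (gen _ _ H) => [|a|a|].
  + by lia.
  + by rewrite sc -HB.
  + by rewrite s0 -HB.
  + by apply: crange; lia.
- apply/esym; apply: (gen _ _ H) => [|a|a|].
  + by lia.
  + by rewrite s0 -HB.
  + by rewrite sc -HB.
  + by apply: crange; lia.
- apply: Cmat_ext => // j /=; rewrite /sgen.
  by case: tpermP => [->|->|].
Qed.

End Rows.
End ClassicExchange.

(** * Exchange relations of the signed layer *)

Section SignedLocal.
Variables (R : comRingType) (t c1 : R).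
Implicit Types (a b c p q B : nat) (v w x y : R).

(* Here [c1 = c0 / t], and [t w] is the state to the right of both columns. *)
Definition slw a b c v x : R :=
  if c == a then
    if (a < b)%N then (1 - v) * x
    else if (b < a)%N then c1 * (1 - v) * v else x - t * c1 * v
  else if (b < a)%N then v else 1.

Definition tww a b1 b2 e1 e2 w x y : R :=
  slw a b1 e1 (if b2 == a then if e2 == a then t * w else t * (t * w)
               else if e2 == a then w else t * w) x
  * slw a b2 e2 (t * w) y.

(** The factor left over from the species other than [p] and [q]: by [signed_local_other] the
    species [B1] gives [t] unless it is one of these two. For [B1 = B2] it is the eigenvalue [t] of
    [T_i]. *)
Definition kap B1 B2 p q : R :=
  if B1 == B2 then t else if (B1 == p) || (B1 == q) then 1 else t.

Lemma signed_local_neq B1 B2 p q wp wq x y : (B2 <= B1)%N -> (0 < q < p)%N ->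
  let W b1 b2 e1 e2 x y := tww p b1 b2 e1 e2 wp x y * tww q b1 b2 e1 e2 wq x y in
  (x - y) * (kap B1 B2 p q * W B2 B1 p q x y) =
    t * (x - y) * W B1 B2 q p y x
    + (1 - t) * y * (W B1 B2 p q x y - W B1 B2 p q y x)
  /\ (x - y) * (kap B1 B2 p q * W B2 B1 q p x y) =
    (x - y) * W B1 B2 p q y x + (t - 1) * (x - y) * W B1 B2 q p y x
    + (1 - t) * y * (W B1 B2 q p x y - W B1 B2 q p y x).
Proof.
move=> HB pq /=; rewrite /tww /slw /kap; split; split_ifs; ring.
Qed.

Lemma signed_local_zero B1 B2 q w x y : (B2 <= B1)%N -> (0 < q)%N ->
  let W b1 b2 e1 e2 x y := tww q b1 b2 e1 e2 w x y in
  (x - y) * (kap B1 B2 q q * W B2 B1 0%N q x y) =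
    (x - y) * W B1 B2 q 0%N y x
    + (1 - t) * y * (W B1 B2 0%N q x y - W B1 B2 0%N q y x)
  /\ (x - y) * (kap B1 B2 q q * W B2 B1 q 0%N x y) =
    t * (x - y) * W B1 B2 0%N q y x + (t - 1) * (x - y) * W B1 B2 q 0%N y x
    + (1 - t) * y * (W B1 B2 q 0%N x y - W B1 B2 q 0%N y x).
Proof.
move=> HB q0 /=; rewrite /tww /slw /kap; split; split_ifs; ring.
Qed.

Lemma signed_local_eq B1 B2 p w x y : (B2 <= B1)%N -> (0 < p)%N ->
  let W b1 b2 e1 e2 x y := tww p b1 b2 e1 e2 w x y in
  (x - y) * (kap B1 B2 p p * W B2 B1 p p x y) =
    t * (x - y) * W B1 B2 p p y x
    + (1 - t) * y * (W B1 B2 p p x y - W B1 B2 p p y x).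
Proof.
move=> HB q0 /=; rewrite /tww /slw /kap; split_ifs; ring.
Qed.

Lemma signed_local_other a B1 B2 e1 e2 f1 f2 w x y : (B2 <= B1)%N ->
  e1 != a -> e2 != a -> f1 != a -> f2 != a ->
  tww a B2 B1 e1 e2 w x y =
  (if (B1 == a) && (B1 != B2) then t else 1) * tww a B1 B2 f1 f2 w y x.
Proof.
move=> HB h1 h2 h3 h4; rewrite /tww /slw; split_ifs; ring.
Qed.

Section AllSpecies.
Variables (A1 : nat) (w : nat -> R).

Definition twall b1 b2 e1 e2 x y : R := \prod_(1 <= a < A1) tww a b1 b2 e1 e2 (w a) x y.

Definition twswap B1 B2 e1 e2 x y : R :=
  if B1 == B2 then t * twall B1 B2 e1 e2 x y else twall B2 B1 e1 e2 x y.

Lemma twall_other (P : pred nat) B1 B2 e1 e2 f1 f2 x y : (B2 <= B1 < A1)%N ->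
  (forall a, (0 < a)%N -> P a -> [&& e1 != a, e2 != a, f1 != a & f2 != a]) ->
  \prod_(1 <= a < A1 | P a) tww a B2 B1 e1 e2 (w a) x y =
  (if (B1 != B2) && P B1 then t else 1)
  * \prod_(1 <= a < A1 | P a) tww a B1 B2 f1 f2 (w a) y x.
Proof.
move=> /andP[HB hB] HP.
have -> : (if (B1 != B2) && P B1 then t else 1) =
    \prod_(1 <= a < A1 | P a) (if (B1 == a) && (B1 != B2) then t else 1).
  case: ifP => [/andP[n12 PB]|H].
    rewrite big_mkcond (bigD1_seq B1) ?iota_uniq ?mem_index_iota //=; last by lia.
    rewrite PB eqxx n12 big1 ?mulr1 // => a aB.
    by rewrite eq_sym (negPf aB); case: (P a).
  rewrite big1 // => a Pa; case: eqP => //= E; rewrite -E in Pa.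
  by rewrite Pa andbT in H; rewrite H.
rewrite -big_split /= big_nat_cond [RHS]big_nat_cond; apply: eq_bigr => a.
move=> /andP[/andP[ha _] Pa]; have /and4P[h1 h2 h3 h4] := HP a ha Pa.
exact: signed_local_other.
Qed.

Lemma twall_neq B1 B2 p q x y : (B2 <= B1 < A1)%N -> (0 < q < p)%N -> (p < A1)%N ->
  (x - y) * twswap B1 B2 p q x y =
    t * (x - y) * twall B1 B2 q p y x
    + (1 - t) * y * (twall B1 B2 p q x y - twall B1 B2 p q y x)
  /\ (x - y) * twswap B1 B2 q p x y =
    (x - y) * twall B1 B2 p q y x + (t - 1) * (x - y) * twall B1 B2 q p y x
    + (1 - t) * y * (twall B1 B2 q p x y - twall B1 B2 q p y x).
Proof.
move=> HB pq pA; have /andP[HB1 HB2] := HB.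
pose P a := (a != p) && (a != q).
pose W b1 b2 e1 e2 x y := tww p b1 b2 e1 e2 (w p) x y * tww q b1 b2 e1 e2 (w q) x y.
have sp b1 b2 e1 e2 u v : twall b1 b2 e1 e2 u v =
    W b1 b2 e1 e2 u v * \prod_(1 <= a < A1 | P a) tww a b1 b2 e1 e2 (w a) u v.
  rewrite /twall (bigD1_seq p) ?iota_uniq ?mem_index_iota //=; last by lia.
  rewrite -big_filter (bigD1_seq q) ?filter_uniq ?iota_uniq //=.
    by rewrite big_filter_cond mulrA.
  by rewrite mem_filter mem_index_iota; lia.
set G := \prod_(1 <= a < A1 | P a) tww a B1 B2 p q (w a) x y.
have E e1 e2 u v : (e1 == p) && (e2 == q) || (e1 == q) && (e2 == p) ->
    \prod_(1 <= a < A1 | P a) tww a B1 B2 e1 e2 (w a) u v = G.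
  move=> He; have Hf f1 f2 : (f1 == p) && (f2 == q) || (f1 == q) && (f2 == p) ->
    forall a, (0 < a)%N -> P a -> [&& e1 != a, e2 != a, f1 != a & f2 != a].
    by move=> Hf a _ /andP[h1 h2]; lia.
  rewrite /G big_nat_cond [RHS]big_nat_cond; apply: eq_bigr => a.
  move=> /andP[/andP[ha _] Pa].
  have /and4P[h1 h2 h3 h4] : [&& e1 != a, e2 != a, p != a & q != a].
    by apply: Hf Pa => //; rewrite !eqxx.
  by rewrite /tww /slw (negPf h1) (negPf h2) (negPf h3) (negPf h4).
have S' e1 e2 : (e1 == p) && (e2 == q) || (e1 == q) && (e2 == p) ->
    twswap B1 B2 e1 e2 x y = kap B1 B2 p q * W B2 B1 e1 e2 x y * G.
  move=> He; rewrite /twswap /kap; case: (eqVneq B1 B2) => [E12|n12].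
    by rewrite sp E // -mulrA E12.
  rewrite sp (@twall_other P B1 B2 e1 e2 p q x y HB); last first.
    by move=> a _ /andP[h1 h2]; lia.
  rewrite n12 /= -(E p q y x) ?eqxx //; rewrite /P.
  by case: (B1 == p); case: (B1 == q) => /=; ring.
have [H1 H2] := signed_local_neq (w p) (w q) x y HB1 pq.
rewrite -/(W _ _ _ _ _ _) in H1; split.
  rewrite S' ?eqxx // !sp !E ?eqxx ?orbT // mulrA H1 /W; ring.
rewrite S' ?eqxx ?orbT // !sp !E ?eqxx ?orbT // mulrA H2 /W; ring.
Qed.

Lemma twall_zero B1 B2 q x y : (B2 <= B1 < A1)%N -> (0 < q < A1)%N ->
  (x - y) * twswap B1 B2 0%N q x y =
    (x - y) * twall B1 B2 q 0%N y x
    + (1 - t) * y * (twall B1 B2 0%N q x y - twall B1 B2 0%N q y x)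
  /\ (x - y) * twswap B1 B2 q 0%N x y =
    t * (x - y) * twall B1 B2 0%N q y x + (t - 1) * (x - y) * twall B1 B2 q 0%N y x
    + (1 - t) * y * (twall B1 B2 q 0%N x y - twall B1 B2 q 0%N y x).
Proof.
move=> HB qA; have /andP[HB1 HB2] := HB.
pose P a := (a != q).
have sp b1 b2 e1 e2 u v : twall b1 b2 e1 e2 u v =
    tww q b1 b2 e1 e2 (w q) u v * \prod_(1 <= a < A1 | P a) tww a b1 b2 e1 e2 (w a) u v.
  by rewrite /twall (bigD1_seq q) ?iota_uniq ?mem_index_iota.
set G := \prod_(1 <= a < A1 | P a) tww a B1 B2 0%N q (w a) x y.
have E e1 e2 u v : (e1 == 0%N) && (e2 == q) || (e1 == q) && (e2 == 0%N) ->
    \prod_(1 <= a < A1 | P a) tww a B1 B2 e1 e2 (w a) u v = G.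
  move=> He; rewrite /G big_nat_cond [RHS]big_nat_cond; apply: eq_bigr => a.
  move=> /andP[/andP[ha _]]; rewrite /P => Pa.
  have /and4P[h1 h2 h3 h4] : [&& e1 != a, e2 != a, 0%N != a & q != a] by lia.
  by rewrite /tww /slw (negPf h1) (negPf h2) (negPf h3) (negPf h4).
have S' e1 e2 : (e1 == 0%N) && (e2 == q) || (e1 == q) && (e2 == 0%N) ->
    twswap B1 B2 e1 e2 x y = kap B1 B2 q q * tww q B2 B1 e1 e2 (w q) x y * G.
  move=> He; rewrite /twswap /kap; case: (eqVneq B1 B2) => [E12|n12].
    by rewrite sp E // -mulrA E12.
  rewrite sp (@twall_other P B1 B2 e1 e2 0%N q x y HB); last first.
    by move=> a a0; rewrite /P => h1; lia.
  rewrite n12 /= -(E 0%N q y x) ?eqxx //; rewrite /P.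
  by case: (B1 == q) => /=; ring.
have [H1 H2] := signed_local_zero (w q) x y HB1 (proj1 (andP qA)); split.
  rewrite S' ?eqxx // !sp !E ?eqxx ?orbT // mulrA H1; ring.
rewrite S' ?eqxx ?orbT // !sp !E ?eqxx ?orbT // mulrA H2; ring.
Qed.

Lemma twall_eq B1 B2 p x y : (B2 <= B1 < A1)%N -> (p < A1)%N ->
  (x - y) * twswap B1 B2 p p x y = t * (x - y) * twall B1 B2 p p y x
    + (1 - t) * y * (twall B1 B2 p p x y - twall B1 B2 p p y x).
Proof.
move=> HB pA; have /andP[HB1 HB2] := HB.
pose P a := (a != p).
pose W b1 b2 u v := if p == 0%N then 1 else tww p b1 b2 p p (w p) u v.
have sp b1 b2 u v : twall b1 b2 p p u v =
    W b1 b2 u v * \prod_(1 <= a < A1 | P a) tww a b1 b2 p p (w a) u v.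
  rewrite /W; case: eqP => [p0|/eqP p0].
    rewrite mul1r /twall big_nat_cond [RHS]big_nat_cond; apply: eq_bigl => a.
    by rewrite /P p0; lia.
  by rewrite /twall (bigD1_seq p) ?iota_uniq ?mem_index_iota // lt0n p0.
set G := \prod_(1 <= a < A1 | P a) tww a B1 B2 p p (w a) x y.
have E u v : \prod_(1 <= a < A1 | P a) tww a B1 B2 p p (w a) u v = G.
  apply: eq_bigr => a; rewrite /P eq_sym => /negPf Pa.
  by rewrite /tww /slw Pa.
pose kp := if p == 0%N then t else kap B1 B2 p p.
have S' : twswap B1 B2 p p x y = kp * W B2 B1 x y * G.
  rewrite /twswap /kp /kap; case: (eqVneq B1 B2) => [E12|n12].
    by rewrite sp E -mulrA E12; case: (p == 0%N).
  rewrite sp (@twall_other P B1 B2 p p p p x y HB); last first.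
    by move=> a a0; rewrite /P => h1; lia.
  rewrite n12 /= -(E y x) /P /W orbb.
  case: (eqVneq p 0%N) => [->|_]; last by case: (B1 == p) => /=; ring.
  have -> : B1 != 0%N by lia.
  by ring.
rewrite S' !sp !E /kp /W; case: (eqVneq p 0%N) => [_|p0]; first by ring.
have p0' : (0 < p)%N by lia.
by rewrite mulrA (signed_local_eq (w p) x y HB1 p0'); ring.
Qed.

End AllSpecies.
End SignedLocal.

Section SignedMatrix.
Variables (K : generic_pair) (n : nat) (i : 'I_n).
Hypothesis Hi : (i.+1 < n)%N.
Variables (c0 : K) (A1 : nat).
Local Notation tt := (gt K).
Local Notation s := (sgen i).
Local Notation i' := (nxt i).
Local Notation X := ('X_i : {mpoly K[n]}).
Local Notation Y := ('X_(nxt i) : {mpoly K[n]}).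
Implicit Types b c : 'I_n -> nat.

Definition Smat (k : nat) (c0 : K) (A1 : nat) (b c : 'I_k -> nat) : {mpoly K[k]} :=
  \prod_(1 <= a < A1) colprod (sloc c0) a b c.

Lemma Smat_ext b c b' c' : b =1 b' -> c =1 c' -> Smat c0 A1 b c = Smat c0 A1 b' c'.
Proof. by move=> Eb Ec; apply: eq_bigr => a _; apply: colprod_ext. Qed.

Let tC : {mpoly K[n]} := tt%:MP.
Let c1C : {mpoly K[n]} := (c0 * tt^-1)%:MP.

Lemma slocE a (j : 'I_n) (b c : nat) z :
  sloc c0 a j b c z = slw tC c1C a b c (tt ^ z)%:MP ('X_j).
Proof.
rewrite /sloc /slw -mpolyC1 /tC /c1C; case: ifP => _ //.
case: ifP => _; first by rewrite -mpolyCB mul_mpolyC.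
case: ifP => _; first by rewrite -mpolyCB -!mpolyCM.
congr (_ - _); rewrite -!mpolyCM; congr (_%:MP).
by rewrite [tt * _]mulrCA mulfV ?tt_neq0 ?mulr1.
Qed.

Lemma twocolE a (b1 b2 e1 e2 : nat) z :
  twocol (sloc c0) i a b1 b2 e1 e2 z
  = tww tC c1C a b1 b2 e1 e2 (tt ^ (z - 1))%:MP X Y.
Proof.
have tz u : (tt ^ (u + 1))%:MP = tC * (tt ^ u)%:MP :> {mpoly K[n]}.
  by rewrite /tC -mpolyCM expfzDr ?tt_neq0 // expr1z mulrC.
rewrite /twocol /tww !slocE -!tz subrK; congr (slw _ _ _ _ _ _ _ * _).
case: (b2 == a); case: (e2 == a); rewrite ?subrr ?addr0 ?subr0 ?tz //.
Qed.

Definition Srest b c : {mpoly K[n]} := \prod_(1 <= a < A1) colrest (sloc c0) i a b c.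
Definition Sw b c a : {mpoly K[n]} := (tt ^ (rho a b c i' - 1))%:MP.
Local Notation tw b c := (twall tC c1C A1 (Sw b c)).

Lemma Smat_split b c :
  Smat c0 A1 b c = Srest b c * tw b c (b i) (b i') (c i) (c i') X Y.
Proof.
rewrite /Smat /Srest /twall -big_split; apply: eq_bigr => a _.
by rewrite (colprod_split (sloc c0) Hi) twocolE.
Qed.

Lemma Smat_split_swapb b c :
  Smat c0 A1 (b \o s) c = Srest b c * tw b c (b i') (b i) (c i) (c i') X Y.
Proof.
rewrite /Smat /Srest /twall -big_split; apply: eq_bigr => a _.
by rewrite (colprod_split_swapb (sloc c0) Hi) twocolE.
Qed.

Lemma Smat_split_swapc b c :
  Smat c0 A1 b (c \o s) = Srest b c * tw b c (b i) (b i') (c i') (c i) X Y.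
Proof.
rewrite /Smat /Srest /twall -big_split; apply: eq_bigr => a _.
by rewrite (colprod_split_swapc (sloc c0) Hi) twocolE.
Qed.

Local Notation ms f := (msym s (f : {mpoly K[n]})).

Lemma ms_slw a (b c : nat) z x : ms (slw tC c1C a b c (tt ^ z)%:MP x)
  = slw tC c1C a b c (tt ^ z)%:MP (ms x).
Proof.
rewrite /slw /tC /c1C msymE_subst.
case: ifP => _; last by case: ifP => _; rewrite ?substC ?rmorph1.
case: ifP => _; first by rewrite rmorphM rmorphB rmorph1 /= substC.
case: ifP => _; first by rewrite !rmorphM rmorphB rmorph1 /= !substC.
by rewrite rmorphB !rmorphM /= !substC.
Qed.

Lemma ms_twall b c (b1 b2 e1 e2 : nat) :
  ms (tw b c b1 b2 e1 e2 X Y) = tw b c b1 b2 e1 e2 Y X.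
Proof.
rewrite /twall msymE_subst rmorph_prod; apply: eq_bigr => a _ /=.
have tz u : tC * (tt ^ u)%:MP = (tt ^ (u + 1))%:MP :> {mpoly K[n]}.
  by rewrite /tC -mpolyCM expfzDr ?tt_neq0 // expr1z mulrC.
rewrite rmorphM /= /tww /Sw !tz.
have -> : (if b2 == a then if e2 == a then (tt ^ (rho a b c i' - 1 + 1))%:MP
      else (tt ^ (rho a b c i' - 1 + 1 + 1))%:MP
    else if e2 == a then (tt ^ (rho a b c i' - 1))%:MP
      else (tt ^ (rho a b c i' - 1 + 1))%:MP)
  = (tt ^ (if b2 == a then if e2 == a then rho a b c i' - 1 + 1
      else rho a b c i' - 1 + 1 + 1
    else if e2 == a then rho a b c i' - 1 else rho a b c i' - 1 + 1))%:MP :> {mpoly K[n]}.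
  by case: (b2 == a); case: (e2 == a).
rewrite -!msymE_subst !ms_slw; congr (slw _ _ _ _ _ _ _ * slw _ _ _ _ _ _ _).
  by rewrite msym_sgenX sgenL.
by rewrite msym_sgenX sgenR.
Qed.

Lemma ms_Srest b c : ms (Srest b c) = Srest b c.
Proof.
rewrite /Srest msymE_subst rmorph_prod; apply: eq_bigr => a _ /=.
rewrite /colrest rmorph_prod; apply: eq_bigr => j /andP[j1 j2] /=.
by rewrite -msymE_subst !slocE ms_slw msym_sgenX sgen_out.
Qed.

Lemma ms_Smat b c :
  ms (Smat c0 A1 b c) = Srest b c * tw b c (b i) (b i') (c i) (c i') Y X.
Proof. by rewrite Smat_split msymM ms_Srest ms_twall. Qed.

Lemma ms_Smat_swapc b c :
  ms (Smat c0 A1 b (c \o s)) = Srest b c * tw b c (b i) (b i') (c i') (c i) Y X.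
Proof. by rewrite Smat_split_swapc msymM ms_Srest ms_twall. Qed.

Definition Sswap b c : {mpoly K[n]} :=
  if b i == b i' then tt *: Smat c0 A1 b c else Smat c0 A1 (b \o s) c.

Lemma SswapE b c : Sswap b c =
  Srest b c * twswap tC c1C A1 (Sw b c) (b i) (b i') (c i) (c i') X Y.
Proof.
rewrite /Sswap /twswap; case: ifP => [_|_]; last by rewrite Smat_split_swapb.
by rewrite Smat_split -mul_mpolyC mulrCA.
Qed.

(** The right side is the coefficient of [h c] in [(x_i - x_(i+1)) T_i] of a row sum: the twisted
    Leibniz rule gives the last term, the relations [infrel] of [h] give the case distinction. *)
Lemma Smat_exch b c : (b i' <= b i < A1)%N -> (forall j, c j < A1)%N ->
  (X - Y) * Sswap b c =
  (if igt (c i) (c i') then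
    (if c i == 0%N then 1 else tC) * (X - Y) * ms (Smat c0 A1 b (c \o s))
   else if igt (c i') (c i) then
    (if c i' == 0%N then tC else 1) * (X - Y) * ms (Smat c0 A1 b (c \o s))
    + (tC - 1) * (X - Y) * ms (Smat c0 A1 b c)
   else tC * (X - Y) * ms (Smat c0 A1 b c))
  + (1 - tC) * Y * (Smat c0 A1 b c - ms (Smat c0 A1 b c)).
Proof.
move=> HB Hc; rewrite SswapE ms_Smat_swapc ms_Smat Smat_split.
have aux (R : comRingType) (r d l e : R) : d * l = e -> d * (r * l) = r * e.
  by move=> <-; rewrite mulrCA.
have d1 (R : comRingType) (r u v f g : R) : r * (u * f + v * g) = u * (r * f) + v * (r * g).
  by ring.
have d2 (R : comRingType) (r f g : R) : r * f - r * g = r * (f - g) by ring.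
have d3 (R : comRingType) (r u f v g y h : R) :
  r * (u * f + v * g + y * h) = u * (r * f) + v * (r * g) + y * (r * h) by ring.
rewrite d2; case: ifP => [/andP[q0 H]|H].
  case: (eqVneq (c i) 0%N) H => [->|p0] /= H.
    have Hq : (0 < c i' < A1)%N by rewrite lt0n q0 Hc.
    have [E _] := @twall_zero _ tC c1C A1 (Sw b c) _ _ (c i') X Y HB Hq.
    by rewrite (aux _ _ _ _ _ E) mul1r d1.
  have Hq : (0 < c i' < c i)%N by rewrite lt0n q0.
  have [E _] := @twall_neq _ tC c1C A1 (Sw b c) _ _ (c i) (c i') X Y HB Hq (Hc _).
  by rewrite (aux _ _ _ _ _ E) d1.
case: ifP => [/andP[q0 H']|H'].
  case: (eqVneq (c i') 0%N) H' => [->|p0] /= H'.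
    have Hq : (0 < c i < A1)%N by rewrite lt0n q0 Hc.
    have [_ E] := @twall_zero _ tC c1C A1 (Sw b c) _ _ (c i) X Y HB Hq.
    by rewrite (aux _ _ _ _ _ E) d3.
  have Hq : (0 < c i < c i')%N by rewrite lt0n q0.
  have [_ E] := @twall_neq _ tC c1C A1 (Sw b c) _ _ (c i') (c i) X Y HB Hq (Hc _).
  by rewrite (aux _ _ _ _ _ E) mul1r d3.
have Ec : c i = c i' by move: H H'; rewrite /igt; lia.
rewrite -Ec; have E := @twall_eq _ tC c1C A1 (Sw b c) _ _ (c i) X Y HB (Hc i).
by rewrite (aux _ _ _ _ _ E) d1.
Qed.

End SignedMatrix.

Lemma exch_ring (R : comNzRingType) (x s a f b f' d : R) :
  x * s * (a * f + b * f') + d * f = (x * a * s + d) * f + x * b * s * f'.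
Proof. by ring. Qed.

(** * Exchange relations for families of functions indexed by rows *)

Section Families.
Variables (K : generic_pair) (n L : nat).
Local Notation tt := (gt K).
Local Notation Row := {ffun 'I_n -> 'I_L.+1}.
Local Notation MP := {mpoly K[n]}.
Local Notation T := (@ghecke K n).
Implicit Types (r : Row) (F g h : Row -> MP) (i j : 'I_n).

Definition rv r : 'I_n -> nat := fun j => r j.
Definition rswap i r : Row := [ffun j => r (sgen i j)].

Lemma rswapE i r : rv (rswap i r) =1 rv r \o sgen i.
Proof. by move=> j; rewrite /rv ffunE. Qed.

Lemma rswapK i : involutive (rswap i).
Proof. by move=> r; apply/ffunP => j; rewrite !ffunE sgenK. Qed.

Lemma rswapL i r : rswap i r i = r (nxt i).
Proof. by rewrite ffunE sgenL. Qed.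

Lemma rswapR i r : rswap i r (nxt i) = r i.
Proof. by rewrite ffunE sgenR. Qed.

Definition swap_closed (O : pred Row) := forall i r, O (rswap i r) = O r.

Definition natrel (O : pred Row) F := forall i, (i.+1 < n)%N -> forall r, O r ->
  ((r (nxt i) < r i)%N -> T i (F r) = F (rswap i r))
  /\ (r i = r (nxt i) :> nat -> T i (F r) = tt *: F r).

(** Above an empty spot a classic layer admits every label, so 0 is the largest label for functions
    attached to signed rows, and [T_i] moves an empty spot to the right at the cost of [t]. *)
Definition infrel (O : pred Row) F := forall i, (i.+1 < n)%N -> forall r, O r ->
  (igt (r i) (r (nxt i)) ->
     T i (F r) = (if r i == 0%N :> nat then tt else 1) *: F (rswap i r))
  /\ (r i = r (nxt i) :> nat -> T i (F r) = tt *: F r).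

Section Relations.
Variable O : pred Row.
Hypothesis HO : swap_closed O.

Lemma natrel_lt F i r : natrel O F -> (i.+1 < n)%N -> O r ->
  (r i < r (nxt i))%N -> T i (F r) = (tt - 1) *: F r + tt *: F (rswap i r).
Proof.
move=> HF Hi Or lt; have [E _] := HF i Hi (rswap i r) (etrans (HO i r) Or).
rewrite rswapL rswapR rswapK in E; rewrite -[in LHS]E // hecke_square //.
by rewrite E.
Qed.

Lemma infrel_lt F i r : infrel O F -> (i.+1 < n)%N -> O r ->
  igt (r (nxt i)) (r i) ->
  T i (F r) = (tt - 1) *: F r
    + (if r (nxt i) == 0%N :> nat then 1 else tt) *: F (rswap i r).
Proof.
move=> HF Hi Or lt; have [E _] := HF i Hi (rswap i r) (etrans (HO i r) Or).
rewrite rswapL rswapR rswapK in E; have {}E := E lt.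
have := hecke_square Hi (F (rswap i r)); rewrite E; case: (_ == _).
  rewrite heckeZ // scalerA mulrC -scalerA -scalerDr => /scalerI -> //.
    by rewrite scale1r.
  exact: tt_neq0.
by rewrite !scale1r => ->.
Qed.

Lemma reindex_swap i (G : Row -> MP) :
  \sum_(r | O r) G (rswap i r) = \sum_(r | O r) G r.
Proof.
rewrite [RHS](reindex_inj (can_inj (rswapK i))).
by apply: eq_bigl => r; rewrite HO.
Qed.

End Relations.

Variables (m1 A0 A1 : nat).
Hypothesis A0_gt0 : (0 < A0)%N.

Definition range_ok (lo : nat) (O : pred Row) := forall r, O r ->
  forall j, r j = 0%N :> nat \/ (lo <= r j < A1)%N.

Variables (Ob Ot : pred Row).
Hypotheses (HOb : swap_closed Ob) (HOt : swap_closed Ot).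
Hypotheses (Rb : range_ok A0.-1 Ob) (Rt : range_ok A0 Ot).

Definition hfam g (k : Row) : MP := \sum_(v | Ot v) Cmat K m1 A0 A1 (rv k) (rv v) *: g v.

(** Expanding [T_i] on the top family and reindexing by the swap reduces the claim to
    [Cmat_exch_ge], [Cmat_exch_lt] and [Cmat_exch_eq], coefficient by coefficient. *)
Lemma hfam_infrel g : natrel Ot g -> infrel Ob (hfam g).
Proof.
move=> Hg i Hi k Ok.
pose C (v : Row) : K := Cmat K m1 A0 A1 (rv k) (rv v).
have TE : T i (hfam g k) = \sum_(v | Ot v)
    (if (v (nxt i) <= v i)%N then tt * C (rswap i v)
     else C (rswap i v) + (tt - 1) * C v) *: g v.
  rewrite /hfam hecke_sum //.
  pose al (v : Row) : K := if (v (nxt i) < v i)%N then 0 else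
    if (v i < v (nxt i))%N then (tt - 1) * C v else tt * C v.
  pose be (v : Row) : K := if (v (nxt i) < v i)%N then C v else
    if (v i < v (nxt i))%N then tt * C v else 0.
  rewrite (eq_bigr (fun v => al v *: g v + be (rswap i (rswap i v)) *: g (rswap i v))); last first.
    move=> v Ov; rewrite heckeZ // rswapK /al /be -/(C v).
    case: ltngtP => H.
    - by rewrite scale0r add0r (proj1 (Hg i Hi v Ov) H).
    - by rewrite (natrel_lt HOt Hg Hi Ov H) scalerDr !scalerA ![C v * _]mulrC.
    - by rewrite (proj2 (Hg i Hi v Ov) (esym H)) scale0r addr0 scalerA mulrC.
  rewrite big_split /= (reindex_swap HOt i (fun v => be (rswap i v) *: g v)) -big_split /=.
  apply: eq_bigr => v Ov; rewrite -scalerDl; congr (_ *: _).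
  rewrite /al /be rswapL rswapR; case: (ltngtP (v i) (v (nxt i))) => H.
  - by rewrite addrC.
  - by rewrite add0r.
  - rewrite addr0 (_ : rswap i v = v) //; apply/ffunP => j; rewrite ffunE /sgen.
    by case: tpermP => [->|->|//]; apply/val_inj.
have Rk := Rb Ok.
have CE v : C (rswap i v) = Cmat K m1 A0 A1 (rv k) (rv v \o sgen i).
  by apply: Cmat_ext => // j; rewrite rswapE.
split=> H; rewrite TE.
  rewrite /hfam scaler_sumr; apply: eq_bigr => v Ov; rewrite scalerA; congr (_ *: _).
  have -> : Cmat K m1 A0 A1 (rv (rswap i k)) (rv v) =
      Cmat K m1 A0 A1 (rv k \o sgen i) (rv v).
    by apply: Cmat_ext => // j; rewrite rswapE.
  case: leqP => Hv; rewrite CE.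
    exact: (Cmat_exch_ge K Hi m1 A0_gt0 Rk (Rt Ov) H Hv).
  exact: (Cmat_exch_lt K Hi m1 A0_gt0 Rk (Rt Ov) H Hv).
rewrite /hfam scaler_sumr; apply: eq_bigr => v Ov; rewrite scalerA; congr (_ *: _).
have E : C (rswap i v) = C v.
  by rewrite CE; exact: (Cmat_exch_eq K Hi m1 A0_gt0 Rk (Rt Ov) H).
by rewrite E; case: ifP => // _; rewrite /C; ring.
Qed.

Variable c0 : K.
Hypothesis A1_gt0 : (0 < A1)%N.

Definition Ffam h (m : Row) : MP := \sum_(k | Ob k) Smat c0 A1 (rv m) (rv k) * h k.

Lemma Ffam_swap h : infrel Ob h -> forall i, (i.+1 < n)%N -> forall m, Ob m ->
  (m (nxt i) <= m i)%N ->
  T i (Ffam h m) = \sum_(k | Ob k) Sswap i c0 A1 (rv m) (rv k) * h k.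
Proof.
move=> Hh i Hi m Om Hm.
have rng (r : Row) : Ob r -> forall j, (rv r j < A1)%N.
  by move=> Or j; case: (Rb Or j) => [E|/andP[]//]; rewrite /rv E.
pose xy : MP := 'X_i - 'X_(nxt i).
have xy0 : xy != 0 := xy_neq0 K Hi.
apply: (mulfI xy0); rewrite /Ffam hecke_sum // !mulr_sumr.
pose S (k : Row) : MP := Smat c0 A1 (rv m) (rv k).
pose sS (k : Row) : MP := msym (sgen i) (S k).
pose d (k : Row) : MP := (1 - tt%:MP) * 'X_(nxt i) * (S k - sS k).
pose al (k : Row) : K := if igt (k i) (k (nxt i)) then 0 else
  if igt (k (nxt i)) (k i) then tt - 1 else tt.
pose be (k : Row) : K := if igt (k i) (k (nxt i)) then (if k i == 0%N :> nat then tt else 1) else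
  if igt (k (nxt i)) (k i) then (if k (nxt i) == 0%N :> nat then 1 else tt) else 0.
have TE k : Ob k -> T i (h k) = al k *: h k + be k *: h (rswap i k).
  move=> Ok; rewrite /al /be; case: ifP => H1.
    by rewrite scale0r add0r (proj1 (Hh i Hi k Ok) H1).
  case: ifP => H2; first exact: (infrel_lt HOb Hh Hi Ok H2).
  rewrite scale0r addr0 (proj2 (Hh i Hi k Ok)) //.
  by move: H1 H2; rewrite /igt; lia.
have step1 k : Ob k -> xy * T i (S k * h k) =
    (xy * (al k)%:MP * sS k + d k) * h k
    + xy * (be (rswap i (rswap i k)))%:MP * sS (rswap i (rswap i k)) * h (rswap i k).
  move=> Ok; rewrite hecke_Leib // TE // rswapK -/(sS k) -/(d k) -/xy.
  by rewrite -!mul_mpolyC exch_ring.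
rewrite (eq_bigr _ step1) big_split /=.
rewrite (reindex_swap HOb i (fun k => xy * (be (rswap i k))%:MP * sS (rswap i k) * h k)).
rewrite -big_split /=; apply: eq_bigr => k Ok; rewrite -mulrDl [RHS]mulrA.
congr (_ * _).
have Hm' : (rv m (nxt i) <= rv m i < A1)%N by rewrite Hm rng.
rewrite (Smat_exch Hi c0 Hm' (rng k Ok)) addrAC; congr (_ + _).
have sw : Smat c0 A1 (rv m) (rv k \o sgen i) = S (rswap i k).
  by apply: Smat_ext => // j; rewrite rswapE.
rewrite sw -/(sS (rswap i k)) -/(S k) -/(sS k) -/xy /al /be rswapL rswapR.
have tC1 : (tt - 1)%:MP = tt%:MP - 1 :> MP by rewrite mpolyCB mpolyC1.
rewrite -/(rv k i) -/(rv k (nxt i)).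
case: ifP => H1.
  have -> : igt (rv k (nxt i)) (rv k i) = false by move: H1; rewrite /igt; lia.
  rewrite mpolyC0 mulr0 mul0r add0r; congr (_ * _); rewrite mulrC; congr (_ * _).
  by case: (_ == _); rewrite ?mpolyC1.
case: ifP => H2.
  rewrite tC1 addrC; congr (_ * _ + _ * _); last by rewrite mulrC.
  by rewrite mulrC; congr (_ * _); case: (_ == _); rewrite ?mpolyC1.
by rewrite mpolyC0 mulr0 mul0r addr0 [xy * _]mulrC.
Qed.

Lemma Ffam_natrel h : infrel Ob h -> natrel Ob (Ffam h).
Proof.
move=> Hh i Hi m Om; split=> H.
  rewrite (Ffam_swap Hh Hi Om (ltnW H)); apply: eq_bigr => k _; congr (_ * _).
  rewrite /Sswap -/(rv m i) (gtn_eqF H); apply: Smat_ext => // j.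
  by rewrite rswapE.
rewrite (Ffam_swap Hh Hi Om) ?H // /Ffam scaler_sumr; apply: eq_bigr => k _.
by rewrite /Sswap /rv H eqxx scalerAl.
Qed.

End Families.

(** * Cyclicity and the raising operator *)

Section ClassicRotation.
Variables (K : generic_pair) (n : nat).
Local Notation qq := (gq K).
Local Notation tt := (gt K).
Implicit Types b c : 'I_n.+1 -> nat.

Definition rotl (T : Type) (b : 'I_n.+1 -> T) : 'I_n.+1 -> T := fun i => b (ord_pred i).

Lemma rotlS (T : Type) (b : 'I_n.+1 -> T) i : rotl b (ordS i) = b i.
Proof. by rewrite /rotl ordSK. Qed.

Local Notation dl a b c i := ((b i == a)%:Z - (c i == a)%:Z : int).

Lemma card_label_sum (k : nat) a (b : 'I_k -> nat) :
  #|[set j | b j == a]|%:Z = \sum_j (b j == a)%:Z.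
Proof.
transitivity (\sum_(j in [set j | b j == a]) (1 : int)); first by rewrite sumr_const natz.
rewrite big_mkcond; apply: eq_bigr => j _; rewrite inE.
by case: (_ == _).
Qed.

Lemma lt_ordS (j k : 'I_n.+1) :
  (ordS j < ordS k)%N = (k != ord_max) && ((j == ord_max) || (j < k)%N).
Proof.
rewrite !val_ordS; case: (k =P ord_max) => [_|/eqP km]; first by case: ifP.
case: (j =P ord_max) => [_|/eqP jm] //=.
Qed.

Lemma rho_max a b c : rho a b c ord_max = 0.
Proof. by rewrite /rho big_pred0 // => k; rewrite ltnNge -ltnS ltn_ord. Qed.

Lemma rho_rotl a b c (j : 'I_n.+1) : #|[set j | b j == a]| = #|[set j | c j == a]| ->
  rho a (rotl b) (rotl c) (ordS j) = rho a b c j - dl a b c ord_max.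
Proof.
move=> cnt; rewrite /rho [LHS](reindex_inj (@ordS_inj n.+1)) /=.
under eq_bigl do rewrite lt_ordS; under eq_bigr do rewrite !rotlS.
case: (j =P ord_max) => [->|/eqP jm].
  rewrite [X in _ = X - _]big_pred0; last by move=> k; rewrite ltnNge -ltnS ltn_ord.
  rewrite (eq_bigl (fun k => k != ord_max)) => [|k]; last by rewrite andbT.
  have : \sum_k dl a b c k = 0 by rewrite sumrB -!card_label_sum cnt subrr.
  by rewrite (bigD1 ord_max) //= => H; apply/eqP; rewrite sub0r -addr_eq0 addrC H.
have jm' : (j < n)%N.
  by rewrite ltn_neqAle -[(j <= n)%N]/(j < n.+1)%N ltn_ord andbT; apply: contra jm.
rewrite [in RHS](bigD1 ord_max) //= addrAC subrr add0r.
by apply: eq_bigl => k; rewrite andbC.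
Qed.

Lemma cloc_shift a j (e1 e2 : nat) z : pshift (cloc K (n := n.+1) a j e1 e2 z)
  = cloc K (n := n.+1) a j e1 e2 (z + 1).
Proof.
rewrite /cloc; case: ifP => _; last by case: ifP => _; rewrite ?pshift_tX // /pshift rmorph1.
case: ifP => _; first by rewrite /pshift rmorph1.
by case: ifP => _; rewrite ?pshift1B // /pshift rmorph0.
Qed.

Local Notation P := (colprod (@cloc K n.+1)).

Lemma colprod_rotl a b c : #|[set j | b j == a]| = #|[set j | c j == a]| ->
  P a (rotl b) (rotl c)
  = \prod_j cloc K a j (b j) (c j) (rho a b c j - dl a b c ord_max).
Proof.
move=> cnt; rewrite /colprod (reindex_inj (@ordS_inj n.+1)) /=.
by apply: eq_bigr => j _; rewrite rho_rotl // !rotlS.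
Qed.

Lemma horner_cloc0 a j (e1 e2 : nat) : e1 != a -> e2 = a ->
  (cloc K (n := n.+1) a j e1 e2 0).[1] = 0.
Proof.
move=> /negPf h1 ->; rewrite /cloc eqxx h1; case: ifP => _; last by rewrite horner0.
by rewrite hornerD hornerN hornerC horner_tX expr0z subrr.
Qed.

Lemma horner_colprod0 a b c (j : 'I_n.+1) : b j != a -> c j = a -> rho a b c j = 0 ->
  (P a b c).[1] = 0.
Proof.
move=> bj cj r0; rewrite /colprod (bigD1 j) //= hornerM r0.
by rewrite horner_cloc0 // mul0r.
Qed.

(* The label balance vanishes to the right of all columns; if it is negative to the right of
   column [0], it leaves the value [0] at a column whose only [a] is on top. *)
Lemma rho_descent a b c : rho a b c ord0 < 0 ->
  exists j, [/\ b j != a, c j = a & rho a b c j = 0].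
Proof.
move=> r0; have ex : exists k, (k < n.+1)%N && (0 <= rho a b c (inord k)).
  exists n; rewrite ltnSn /= (_ : inord n = ord_max) ?rho_max //.
  by apply/val_inj; rewrite /= inordK.
case: (ex_minnP ex) => -[|k] /andP[kn rk] kmin.
  by move: rk; rewrite (_ : inord 0 = ord0) 1?leNgt ?r0 //; apply/val_inj; rewrite /= inordK.
pose i : 'I_n.+1 := inord k.
have vi : (i : nat) = k by rewrite /i inordK // ltnW.
have Hi : (i.+1 < n.+1)%N by rewrite vi.
have Ei : nxt i = inord k.+1 by apply/val_inj; rewrite /= val_nxt // vi inordK.
have := rho_step Hi a b c; rewrite Ei.
have ri : rho a b c i < 0.
  rewrite ltNge; apply/negP => H.
  by have := kmin k; rewrite (ltnW kn) H ltnn => /(_ isT).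
move=> E; exists (inord k.+1).
move: ri rk; rewrite E; move: (rho a b c _) => x.
by case: eqP; case: eqP => //= h1 h2 h3 h4; split=> //; lia.
Qed.

(** Rotation moves the last column to the front. If just one of its two labels is [a], all label
    balances change by one and one column product is the shift of the other; [lamb_shift0] then
    yields [Q], as the unshifted product vanishes at 1. *)
Lemma lamb_rotl (Q : K) a b c : (forall k, 1 - Q * tt ^+ k != 0) ->
  #|[set j | b j == a]| = #|[set j | c j == a]| ->
  Q ^+ (b ord_max == a) * lamb Q (P a b c)
  = Q ^+ (c ord_max == a) * lamb Q (P a (rotl b) (rotl c)).
Proof.
move=> HQ cnt; have E := colprod_rotl cnt.
case: (boolP (b ord_max == a)) => hb; case: (boolP (c ord_max == a)) => hc.
- congr (_ * lamb _ _); rewrite E hb hc; apply: eq_bigr => j _.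
  by rewrite subrr subr0.
- have -> : P a b c = pshift (P a (rotl b) (rotl c)).
    rewrite E pshift_prod; apply: eq_bigr => j _.
    by rewrite cloc_shift hb (negPf hc) subr0 subrK.
  rewrite expr0 expr1 mul1r [RHS](lamb_shift0 HQ) //.
  have [] := @rho_descent a (rotl b) (rotl c).
    have -> : ord0 = ordS ord_max :> 'I_n.+1 by apply/eqP; rewrite eq_sym ordS_eq0.
    by rewrite rho_rotl // rho_max hb (negPf hc).
  by move=> j [h1 h2 h3]; exact: (horner_colprod0 h1 h2 h3).
- have -> : P a (rotl b) (rotl c) = pshift (P a b c).
    rewrite E /colprod pshift_prod; apply: eq_bigr => j _.
    by rewrite cloc_shift hc (negPf hb) sub0r opprK.
  rewrite expr0 expr1 mul1r [LHS](lamb_shift0 HQ) //.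
  exact: (horner_colprod0 hb (eqP hc) (rho_max _ _ _)).
- congr (_ * lamb _ _); rewrite E (negPf hb) (negPf hc); apply: eq_bigr => j _.
  by rewrite !subr0.
Qed.

(** The product of [lamb_rotl] over the species. By truncated subtraction the exponent is 0 for an
    empty last position and for the label [m1], neither of which is a species of this layer. *)
Lemma Cmat_rotl m1 A1 b c :
  (b ord_max = 0%N \/ (m1 < (b ord_max).+1 <= A1)%N) ->
  (c ord_max = 0%N \/ (m1 < (c ord_max).+1 <= A1)%N) ->
  (forall a, (m1 < a)%N -> #|[set j | b j == a]| = #|[set j | c j == a]|) ->
  qq ^+ (b ord_max - m1) * Cmat K m1 m1.+1 A1 b c
  = qq ^+ (c ord_max - m1) * Cmat K m1 m1.+1 A1 (rotl b) (rotl c).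
Proof.
have pw x : (x = 0%N \/ (m1 < x.+1 <= A1)%N) ->
    qq ^+ (x - m1) = \prod_(m1.+1 <= a < A1) (qq ^+ (a - m1)) ^+ (x == a).
  move=> hx; case: (leqP x m1) => h1.
    rewrite (eqP (h1 : (x - m1 == 0)%N)) expr0 big_nat big1 // => a ha.
    by rewrite (_ : (x == a) = false) ?expr0 //; lia.
  have hx' : (m1.+1 <= x < A1)%N by lia.
  rewrite (bigD1_seq x) ?iota_uniq ?mem_index_iota //=.
  rewrite eqxx expr1 big1 ?mulr1 // => a /negPf h.
  by rewrite eq_sym h expr0.
move=> hb hc cnt; rewrite (pw _ hb) (pw _ hc) /Cmat -!big_split /= big_nat [RHS]big_nat.
apply: eq_bigr => a ha; rewrite mulrCA [RHS]mulrCA.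
have -> : #|[set x | (0 < rotl b x < a)%N]| = #|[set x | (0 < b x < a)%N]|.
  rewrite -[RHS](card_imset _ (@ordS_inj n.+1)); apply: eq_card => x; rewrite !inE.
  apply/idP/imsetP => [H|[y Hy ->]]; last by rewrite rotlS; rewrite inE in Hy.
  by exists (ord_pred x); rewrite ?ord_predK // inE.
congr (_ * _); apply: lamb_rotl => [k|]; last by apply: cnt; lia.
by apply: qt_neq1; lia.
Qed.
End ClassicRotation.

Lemma xi_ring (R : comNzRingType) (x f g u w : R) :
  x * (w - g) + (f - u * w) = 0 -> x * g = f + (x - u) * w.
Proof.
by move=> H; apply/eqP; rewrite -subr_eq0 -oppr_eq0 -H; apply/eqP; ring.
Qed.

(** * The raising identity *)

Section Xi.
Variables (K : generic_pair) (n : nat).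
Local Notation tt := (gt K).
Local Notation MP := {mpoly K[n.+1]}.
Local Notation T := (@ghecke K n.+1).
Implicit Types (f g : MP) (c : K).

(** In [n+1] variables with columns counted from 0, [hup n] is the full product of Hecke operators
    that precedes the rotation. *)
Fixpoint hup k f : MP := if k is k'.+1 then T (inord k') (hup k' f) else f.

Lemma msize_hup k f : (k <= n)%N -> (msize (hup k f) <= msize f)%N.
Proof.
elim: k => //= k IH kn; apply: leq_trans (IH (ltnW kn)).
by apply: msize_hecke; rewrite inordK ?ltnS ?(ltnW kn).
Qed.

Lemma hup_vanish k c f d : c != 0 -> (k <= n)%N ->
  (forall mu : 'X_{1..n.+1}, (mdeg mu < d)%N -> f.@[pt c mu] = 0) ->
  forall mu : 'X_{1..n.+1}, (mdeg mu < d)%N -> (hup k f).@[pt c mu] = 0.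
Proof.
move=> c0; elim: k => //= k IH kn Hf; apply: hecke_vanish => //.
  by rewrite inordK ?ltnS ?(ltnW kn).
by apply: IH => //; apply: ltnW.
Qed.

(** Iterates [hecke_subst0]: where a variable vanishes, the product of Hecke operators becomes [t^k]
    times a cyclic permutation of variables, which the rotation in [Xi] undoes. *)
Lemma subst0_hup m k (h : 'I_n.+1 -> {mpoly K[m]}) f : (k <= n)%N ->
  h (inord k) = 0 -> (forall j : 'I_n.+1, (j < k)%N -> h j != 0) ->
  subst h (hup k f) = tt ^+ k *: subst (fun j => if j == ord0 then h (inord k)
    else if (j <= k)%N then h (inord j.-1) else h j) f.
Proof.
elim: k h => [|k IH] h kn h0 hn /=.
  rewrite expr0 scale1r; apply: subst_ext => j.
  case: eqP => [->|/eqP j0]; first by congr h; apply/val_inj; rewrite /= inordK.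
  by rewrite leqn0; case: eqP => // E; case/eqP: j0; apply/val_inj.
have vk : (inord k : 'I_n.+1) = k :> nat by rewrite inordK ?ltnS ?(ltnW kn).
have Hk : ((inord k : 'I_n.+1).+1 < n.+1)%N by rewrite vk.
have nk : nxt (inord k) = inord k.+1 :> 'I_n.+1.
  by apply/val_inj; rewrite /= val_nxt // vk inordK.
have E0 : h (nxt (inord k)) = 0 by rewrite nk.
have E1 : h (inord k) != 0 by apply: hn; rewrite vk.
have F0 : h (sgen (inord k) (inord k)) = 0 by rewrite sgenL.
have F1 (j : 'I_n.+1) : (j < k)%N -> h (sgen (inord k) j) != 0.
  move=> jk; rewrite /sgen tpermD; first exact/hn/ltnW.
    by rewrite -val_eqE /= vk gtn_eqF.
  by rewrite nk -val_eqE /= inordK // gtn_eqF // ltnW.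
rewrite (hecke_subst0 _ E0 E1) (IH _ (ltnW kn) F0 F1).
rewrite scalerA -exprS; congr (_ *: _); apply: subst_ext => j.
case: ifP => j0; first by rewrite F0 h0.
rewrite [(j <= k.+1)%N]leq_eqVlt ltnS; case: (j =P k.+1 :> nat) => [jk|jk] /=.
  rewrite jk ltnn /= (_ : j = nxt (inord k)) ?sgenR //.
  by rewrite nk; apply/val_inj; rewrite /= inordK.
case: (leqP j k) => jk'.
  have jv : (inord j.-1 : 'I_n.+1) = j.-1 :> nat by rewrite inordK //; lia.
  have j0' : (0 < j)%N by rewrite lt0n; apply: contraFneq j0 => E; apply/eqP/val_inj.
  rewrite /sgen tpermD // -val_eqE /= ?nk ?vk jv ?inordK //; lia.
rewrite /sgen tpermD // -val_eqE /= ?nk ?vk ?inordK //; lia.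
Qed.

(* Both sides agree at [X_0 = 0], so their difference is [X_0] times a polynomial of smaller
   degree, which vanishes at too many spectral points. *)
Lemma Xi c d f g : c != 0 ->
  (msize f <= d.+1)%N -> (msize g <= d.+1)%N ->
  (forall mu : 'X_{1..n.+1}, (mdeg mu < d)%N -> f.@[pt c mu] = 0) ->
  (forall mu : 'X_{1..n.+1}, (mdeg mu < d)%N -> g.@[pt c mu] = 0) ->
  (msize (om (hup n f) - g) <= d)%N ->
  'X_ord0 * g = c *: f + ('X_ord0 - (c * tt ^- n)%:MP) * om (hup n f).
Proof.
move=> c0 sf sg vf vg sw; set w := om (hup n f) in sw *.
have sw' : (msize w <= d.+1)%N.
  by apply: leq_trans (msize_om _) _; apply: leq_trans sf; apply: msize_hup.
pose y : MP := 'X_ord0 * (w - g) + (c *: f - (c * tt ^- n) *: w).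
suff y0 : y = 0.
  by apply: xi_ring; rewrite -y0 /y mul_mpolyC.
have sy : (msize y <= d.+1)%N.
  apply: leq_trans (msizeD_le _ _) _; rewrite geq_max; apply/andP; split.
    case: (eqVneq (w - g) 0) => [->|z0]; first by rewrite mulr0 msize0.
    by rewrite -['X_ord0]subr0 -(mpolyC0 _ K) msizeXC_mul.
  apply: leq_trans (msizeD_le _ _) _; rewrite geq_max msizeN.
  by rewrite !(leq_trans (msizeZ_le _ _)).
(* At [X_0 = 0] the rotated product [w] is [t^n f], which the coefficient [c t^-n] turns into
   [c f]. *)
have r0 : subst (restr_at ord0 0) y = 0.
  rewrite /y rmorphD rmorphM !rmorphB /= substX {1}/restr_at eqxx mpolyC0 mul0r add0r !substZ.
  rewrite /w subst_subst.
  have En : inord n = ord_max :> 'I_n.+1 by apply/val_inj; rewrite /= inordK.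
  set h : 'I_n.+1 -> MP := fun i => subst _ _.
  have h0 : h (inord n) = 0.
    rewrite /h En substZ substX (_ : ordS ord_max = ord0).
      by rewrite /restr_at eqxx mpolyC0 scaler0.
    by apply/eqP; rewrite ordS_eq0.
  have hX (j : 'I_n.+1) : (j < n)%N -> h j = 'X_(ordS j).
    move=> jn; have jm : (j == ord_max) = false by rewrite -val_eqE /= ltn_eqF.
    by rewrite /h substZ substX jm scale1r /restr_at ordS_eq0 jm.
  rewrite (subst0_hup _ (leqnn n) h0); last first.
    by move=> j jn; rewrite hX // -msize_poly_eq0 msizeX.
  rewrite scalerA -mulrA mulVf ?exptt_neq0 // mulr1 -scalerBr.
  apply/eqP; rewrite scaler_eq0 (negPf c0) subr_eq0 /=; apply/eqP; apply: subst_ext => j.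
  case: ifP => j0; first by rewrite h0 /restr_at j0 mpolyC0.
  have j0' : (0 < j)%N by rewrite lt0n; apply: contraFneq j0 => E; apply/eqP/val_inj.
  have jn := ltn_ord j; rewrite -ltnS jn.
  have jv : (inord j.-1 : 'I_n.+1) = j.-1 :> nat by rewrite inordK //; lia.
  rewrite hX ?jv; last by lia.
  rewrite /restr_at j0 (_ : ordS (inord j.-1) = j) //.
  apply: ord_inj; rewrite val_ordS -val_eqE /= jv; case: eqP; lia.
have [z Ez sz] := factor_at r0 sy.
suff z0 : z = 0 by rewrite Ez z0 mulr0.
case: d vf vg sz {sf sg sw sw' sy} => [|d] vf vg sz.
  by apply/eqP; rewrite -msize_poly_eq0 -leqn0.
apply: (interp_uniq c0 sz) => mu md.
have md' : (mdeg mu < d.+1)%N by [].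
have : y.@[pt c mu] = 0.
  rewrite /y mevalD mevalM !mevalB !mevalZ mevalXU vf // vg // mulr0 !subr0 add0r.
  (* At these points [y] equals [(x_0 - c t^-n) w]. The first factor is zero if the first part is 0;
     otherwise [om] refers [w] to a point of smaller degree. *)
  case: (posnP (mu ord0)) => m0; first by rewrite pt_eq0 // subrr.
  rewrite -(munshiftK m0) meval_om (hup_vanish _ _ vf) ?mulr0 ?subrr //.
  by rewrite -ltnS -mdeg_mshift munshiftK // ltnW.
rewrite Ez mevalM mevalB mevalXU mevalC subr0 => /eqP; rewrite mulf_eq0.
by case/orP => [|/eqP //]; rewrite /pt mulf_eq0 (negPf c0) /= /gtilde mulf_eq0
  ?(negPf (expqq_neq0 _ _)) ?invr_eq0 ?(negPf (exptt_neq0 _ _)).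
Qed.
End Xi.

(** * The induction on rows *)

Lemma sum_le_eq (I : finType) (b c : I -> nat) :
  (forall j, c j <= b j)%N -> (\sum_j b j <= \sum_j c j)%N -> b =1 c.
Proof.
move=> H S j; apply/eqP; rewrite eqn_leq H andbT; move: S.
rewrite (bigD1 j) //= [X in (_ <= X)%N](bigD1 j) //= => S.
have : (\sum_(i | i != j) c i <= \sum_(i | i != j) b i)%N by apply: leq_sum.
by lia.
Qed.

(** * Rearrangements of a row *)

Section Orbits.
Variables (n L : nat) (la : 'X_{1..n}).
Hypothesis laL : forall j, (la j <= L)%N.
Local Notation Row := {ffun 'I_n -> 'I_L.+1}.
Implicit Types (v : Row) (r : nat).

Definition orb r : pred Row :=
  fun v => perm_eq [seq (v j : nat) | j <- enum 'I_n] (lamr la r).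

Definition lrow r : Row := [ffun j => inord (if (r <= la j)%N then la j else 0)].

Lemma val_lrow r j : lrow r j = (if (r <= la j)%N then la j else 0%N) :> nat.
Proof. by rewrite ffunE inordK //; case: ifP => // _; rewrite ltnS. Qed.

Lemma lamrE r : lamr la r = [seq (lrow r j : nat) | j <- enum 'I_n].
Proof. by apply: eq_map => j; rewrite val_lrow. Qed.

Lemma orb_lrow r : orb r (lrow r).
Proof. by rewrite /orb lamrE. Qed.

Lemma orb_perm r v v' (s : 'I_n -> 'I_n) : injective s ->
  (forall j, v' j = v (s j)) -> orb r v' = orb r v.
Proof.
move=> sI E; rewrite /orb; apply: (@permPl _ _ _ _ (lamr la r)).
rewrite (eq_map (g := fun j => (v (s j) : nat))) => [|j]; last by rewrite E.
rewrite (map_comp (fun j => v j : nat) s); apply: perm_map.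
apply: uniq_perm => [||x]; first by rewrite map_inj_uniq //; exact: enum_uniq.
  exact: enum_uniq.
rewrite mem_enum inE; apply/mapP; exists (invF sI x); rewrite ?f_invF //.
by rewrite mem_enum.
Qed.

Lemma orb_swap r : swap_closed (orb r).
Proof.
move=> i v; apply: (@orb_perm _ _ _ (sgen i)); first exact: (can_inj (@sgenK _ i)).
by move=> j; rewrite ffunE.
Qed.

Section InOrbit.
Variables (r : nat) (v : Row).
Hypothesis Ov : orb r v.

Lemma orb_card (P : pred nat) : #|[set j | P (v j)]| = #|[set j | P (lrow r j)]|.
Proof.
have S (w : Row) :
    #|[set j | P (w j)]| = (\sum_(x <- [seq (w j : nat) | j <- enum 'I_n]) P x)%N.
  rewrite big_map big_enum -sum1_card big_mkcond; apply: eq_bigr => j _.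
  by rewrite inE; case: (P _).
by rewrite !S -lamrE; apply: perm_big.
Qed.

Lemma orb_sum : (\sum_j v j = \sum_j lrow r j)%N.
Proof.
have S (w : Row) :
    (\sum_j w j = \sum_(x <- [seq (w j : nat) | j <- enum 'I_n]) x)%N.
  by rewrite big_map big_enum.
by rewrite !S -lamrE; apply: perm_big.
Qed.

Lemma orb_range j : v j = 0%N :> nat \/ (r <= v j < L.+1)%N.
Proof.
case: (posnP (v j)) => [|v0]; [by left|right]; rewrite ltn_ord andbT leqNgt.
apply/negP => vr; have := orb_card (fun a => (0 < a < r)%N).
rewrite [X in _ = X]eq_card0 => [/eqP|x]; last first.
  by rewrite !inE val_lrow; case: ifP; lia.
by rewrite cards_eq0 => /eqP/setP/(_ j); rewrite !inE v0 vr.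
Qed.

Lemma orb_ge (b : Row) : (forall j, lrow r j <= b j)%N -> (\sum_j b j <= \sum_j v j)%N ->
  b = lrow r.
Proof.
move=> H S; apply/ffunP => j; apply/val_inj.
by apply: (@sum_le_eq _ (fun j => b j) (fun j => lrow r j)) => //; rewrite -orb_sum.
Qed.

End InOrbit.

Section Sorted.
Hypothesis part : forall i j : 'I_n, (i <= j)%N -> (la j <= la i)%N.

Lemma lrow_sorted r (i j : 'I_n) : (i <= j)%N -> (lrow r j <= lrow r i)%N.
Proof. by move=> /part H; rewrite !val_lrow; case: ifP; case: ifP; lia. Qed.

Lemma sorted_orbE r v : orb r v ->
  (forall i : 'I_n, (i.+1 < n)%N -> (v (nxt i) <= v i)%N) -> v = lrow r.
Proof.
move=> Ov H; have srt (w : Row) : (forall i : 'I_n, (i.+1 < n)%N -> (w (nxt i) <= w i)%N) ->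
    sorted geq [seq (w j : nat) | j <- enum 'I_n].
  move=> Hw; apply/(sortedP 0%N) => i; rewrite size_map size_enum_ord => Hi.
  have x0 : 'I_n := Ordinal Hi.
  rewrite !(nth_map x0) -?enumT ?size_enum_ord ?(ltnW Hi) //.
  have -> : nth x0 (enum 'I_n) i.+1 = nxt (nth x0 (enum 'I_n) i).
    by apply: ord_inj; rewrite val_nxt !nth_enum_ord // ltnW.
  by apply: Hw; rewrite nth_enum_ord // ltnW.
have E : [seq (v j : nat) | j <- enum 'I_n] = [seq (lrow r j : nat) | j <- enum 'I_n].
  apply: (@sorted_eq _ geq) => [a b c|a b|||].
  - by rewrite /geq /= => h1 h2; apply: leq_trans h2 h1.
  - by rewrite /geq /= => h; apply/eqP; rewrite eqn_leq andbC.
  - exact: srt.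
  - by apply: srt => i Hi; apply: lrow_sorted; rewrite val_nxt.
  - by rewrite -lamrE.
apply/ffunP => j; apply/val_inj.
by move/eq_in_map: E => /(_ j); rewrite mem_enum => /(_ isT).
Qed.

Lemma sum_swap_lt (f : 'I_n -> nat) (i : 'I_n) : (i.+1 < n)%N -> (f i < f (nxt i))%N ->
  (\sum_(j < n) j * f (sgen i j) < \sum_(j < n) j * f j)%N.
Proof.
move=> Hi lt; have ne := nxt_neq Hi.
rewrite (bigD1 i) // [X in (_ < X)%N](bigD1 i) //=.
rewrite (bigD1 (nxt i)) 1?eq_sym // [X in (_ < _ + X)%N](bigD1 (nxt i)) 1?eq_sym //=.
rewrite sgenL sgenR val_nxt // (eq_bigr (fun j : 'I_n => (j * f j)%N)); first by nia.
by move=> j /andP[j1 j2]; rewrite sgen_out.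
Qed.

Lemma orb_ind r (P : Row -> Prop) : P (lrow r) ->
  (forall (i : 'I_n) v, (i.+1 < n)%N -> orb r v -> (v (nxt i) < v i)%N -> P v -> P (rswap i v)) ->
  forall v, orb r v -> P v.
Proof.
move=> P0 PS v; have [N] := ubnP (\sum_(j < n) j * v j)%N.
elim: N v => // N IH v HN Ov.
case: (boolP [exists i : 'I_n, (i.+1 < n)%N && (v i < v (nxt i))%N]).
  case/existsP => i /andP[Hi lt]; rewrite -[v](rswapK i); apply: PS => //.
  - by rewrite orb_swap.
  - by rewrite rswapL rswapR.
  - apply: IH; last by rewrite orb_swap.
    under eq_bigr do rewrite ffunE.
    exact: leq_trans (sum_swap_lt Hi lt) HN.
rewrite negb_exists => /forallP H; rewrite (sorted_orbE Ov) // => i Hi.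
by have := H i; rewrite Hi -leqNgt.
Qed.

End Sorted.
End Orbits.

Lemma msizeM_leq (K : fieldType) (k u v : nat) (f g : {mpoly K[k]}) :
  (msize f <= u.+1)%N -> (msize g <= v.+1)%N -> (msize (f * g) <= (u + v).+1)%N.
Proof.
move=> sf sg; case: (eqVneq f 0) => [->|f0]; first by rewrite mul0r msize0.
case: (eqVneq g 0) => [->|g0]; first by rewrite mulr0 msize0.
by rewrite msizeM //; move: sf sg; move: (msize f) (msize g) => x y; clear; lia.
Qed.

(** * Degrees and special entries of the layer matrices *)

Section MatrixEntries.
Variables (K : generic_pair) (n : nat).
Implicit Types b c : 'I_n -> nat.

Lemma rho_eq0 a b c (j : 'I_n) : (forall k : 'I_n, (j < k)%N -> (b k == a) = (c k == a)) ->
  rho a b c j = 0.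
Proof. by move=> H; rewrite /rho big1 // => k /H ->; rewrite subrr. Qed.

Lemma prod_label (R : comNzRingType) (x A1 : nat) (y : R) : (x < A1)%N ->
  \prod_(1 <= a < A1) (if x == a then y else 1) = if x == 0%N then 1 else y.
Proof.
move=> xA; case: (posnP x) => [->|x0].
  by rewrite big_nat big1 // => a ha; case: eqP => //; lia.
have hx : (1 <= x < A1)%N by rewrite x0.
rewrite (bigD1_seq x) ?iota_uniq ?mem_index_iota //= eqxx big1 ?mulr1 ?gtn_eqF //.
by move=> a /negPf h; rewrite eq_sym h.
Qed.

Lemma Smat_diag (c0 : K) A1 b : (forall j, b j < A1)%N ->
  Smat c0 A1 b b = \prod_(j | b j != 0%N) ('X_j - c0%:MP) :> {mpoly K[n]}.
Proof.
move=> bA; rewrite /Smat /colprod exchange_big [RHS]big_mkcond /=; apply: eq_bigr => j _.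
rewrite -[RHS]if_neg negbK -(prod_label _ (bA j)); apply: eq_bigr => a _.
rewrite rho_eq0 // /sloc; case: ifP => [/eqP ->|_]; last by case: ifP => _; rewrite ?expr0z ?mpolyC1.
by rewrite !ltnn expr0z mulr1.
Qed.

(** Signed strands only run to the right. In the last column where the rows differ the label balance
    is 0 and the factor [1 - t^0] vanishes. Sortedness of [b] and the equal number of empty spots
    ensure that this column carries a ball on top. *)
Lemma Smat_sorted0 (c0 : K) A1 b c : (forall j, c j < A1)%N ->
  (forall i j : 'I_n, (i <= j)%N -> (b j <= b i)%N) ->
  #|[set j | b j == 0%N]| = #|[set j | c j == 0%N]| ->
  ~ b =1 c -> Smat c0 A1 b c = 0 :> {mpoly K[n]}.
Proof.
move=> cA srt cnt ne.
have [j0 j0P] : exists j, b j != c j.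
  case: (pickP (fun j => b j != c j)) => [j Hj|H]; first by exists j.
  by case: ne => j; apply/eqP/negbFE/H.
case: (@arg_maxnP _ j0 (fun j => b j != c j) (fun j => j : nat) j0P) => j bc jmax.
have eqr (k : 'I_n) : (j < k)%N -> b k = c k.
  by move=> jk; apply/eqP; apply: contraTT jk => /jmax; rewrite -leqNgt.
have cj0 : c j != 0%N.
  apply/negP => cj; have bj : (0 < b j)%N by rewrite lt0n (eqP cj) in bc *.
  have : [set j | b j == 0%N] \proper [set j | c j == 0%N].
    apply/properP; split; last by exists j; rewrite !inE // -lt0n.
    apply/subsetP => k; rewrite !inE => bk; rewrite -eqr //.
    by rewrite ltnNge; apply/negP => /srt; rewrite (eqP bk); lia.
  by move/proper_card; rewrite cnt ltnn.
have ha : (1 <= c j < A1)%N by rewrite lt0n cj0 cA.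
rewrite /Smat (bigD1_seq (c j)) ?iota_uniq ?mem_index_iota //= /colprod.
rewrite (bigD1 j) //= rho_eq0 => [|k jk]; last by rewrite eqr.
rewrite /sloc eqxx expr0z subrr; case: ltngtP bc => // _ _.
  by rewrite scale0r !mul0r.
by rewrite mulr0 mul0r mpolyC0 !mul0r.
Qed.

Lemma msize_prod_le (k : nat) (I : Type) (r : seq I) (F : I -> {mpoly K[k]})
    (w : I -> nat) :
  (forall i, msize (F i) <= (w i).+1)%N ->
  (msize (\prod_(i <- r) F i) <= (\sum_(i <- r) w i).+1)%N.
Proof.
move=> H; elim: r => [|i r IH]; first by rewrite !big_nil msize1.
by rewrite !big_cons; apply: msizeM_leq.
Qed.

Lemma msize_sloc (c0 : K) a (j : 'I_n) (b c : nat) z :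
  (msize (sloc c0 a j b c z : {mpoly K[n]}) <= ((c == a) && (a <= b)%N).+1)%N.
Proof.
rewrite /sloc; case: ifP => _ /=; last first.
  by case: ifP => _; rewrite ?msizeC ?msize1 ?leq_b1.
case: ltngtP => _ /=.
- by apply: leq_trans (msizeZ_le _ _) _; rewrite msizeX mdeg1.
- by rewrite msizeC leq_b1.
- by rewrite msizeXC.
Qed.

(* A column whose bottom label is smaller than its top label contributes no variable. *)
Lemma msize_Smat (c0 : K) A1 b c :
  (msize (Smat c0 A1 b c : {mpoly K[n]}) <= #|[set j | (0 < c j <= b j)%N]|.+1)%N.
Proof.
pose w a (j : 'I_n) : nat := (c j == a) && (a <= b j)%N.
have := @msize_prod_le n _ (index_iota 1 A1) (fun a => colprod (sloc c0) a b c)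
  (fun a => \sum_j w a j)%N.
move=> H; apply: leq_trans (H _) _.
  by move=> a; apply: msize_prod_le => j; apply: msize_sloc.
rewrite ltnS exchange_big /= -sum1_card [X in (_ <= X)%N]big_mkcond /=.
apply: leq_sum => j _; rewrite inE.
case: (boolP (0 < c j <= b j)%N) => hc.
  apply: (@leq_trans (\sum_(1 <= a < A1) (a == c j : nat))%N).
    by apply: leq_sum => a _; rewrite /w [a == _]eq_sym; case: (_ == _); rewrite ?leq_b1.
  case: (boolP (c j \in index_iota 1 A1)) => hi.
    by rewrite (bigD1_seq (c j)) ?iota_uniq //= eqxx big1 // => a /negPf ->.
  by rewrite big1_seq // => a /= ha; case: eqP => // E; rewrite -E ha in hi.
rewrite big1_seq // => a /andP[_]; rewrite mem_index_iota /w => ha.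
by case: eqP hc => //= ->; lia.
Qed.

Lemma Cmat_neq0 m1 A0 A1 b c : Cmat K m1 A0 A1 b c != 0 ->
  forall j, (A0 <= c j < A1)%N -> b j = 0%N \/ (c j <= b j)%N.
Proof.
move=> C0 j ha; case: (boolP ((b j == 0%N) || (c j <= b j)%N)) => [/orP[/eqP|]|].
- by left.
- by right.
rewrite negb_or -ltnNge => /andP[b0 lt]; case/eqP: C0; apply: (Cmat_zero _ ha).
rewrite /colprod (bigD1 j) //= /cloc eqxx (ltn_eqF lt) (negPf b0) ltnNge (ltnW lt) /=.
by rewrite mul0r.
Qed.

Lemma Cmat_diag m1 A0 A1 b c : (m1 < A0)%N ->
  (forall a j, (A0 <= a)%N -> (b j == a) = (c j == a)) -> Cmat K m1 A0 A1 b c = 1.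
Proof.
move=> m1A0 H; rewrite /Cmat big_nat big1 // => a ha.
have -> : colprod (cloc K (n := n)) a b c =
    'X^#|[set x : 'I_n | (0 < b x)%N && (b x < a)%N]|.
  rewrite -[RHS]mulr1 -prodr_const /= [RHS]mulr1 [RHS]big_mkcond; apply: eq_bigr => j _.
  rewrite rho_eq0 => [|k _]; last by apply: H; lia.
  have aA : (A0 <= a)%N by lia.
  rewrite inE /cloc -(H a j aA).
  case: (b j =P a) => [->|_]; first by rewrite ltnn andbF.
  by case: ifP => //; rewrite /tX expr0z scale1r.
by rewrite lambXn mulfV // qt_neq1 //; lia.
Qed.

End MatrixEntries.

Lemma msize_sum_le (K : fieldType) (n d : nat) (I : Type) (r : seq I) (P : pred I)
    (F : I -> {mpoly K[n]}) :
  (forall i, P i -> msize (F i) <= d)%N -> (msize (\sum_(i <- r | P i) F i) <= d)%N.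
Proof.
move=> H; apply: (big_ind (fun f => (msize f <= d)%N)) => //; first by rewrite msize0.
by move=> f g hf hg; apply: leq_trans (msizeD_le _ _) _; rewrite geq_max hf.
Qed.

Lemma msizeM_lt (K : fieldType) (k u v : nat) (f g : {mpoly K[k]}) :
  (msize f <= u.+1)%N -> (msize g <= v)%N -> (msize (f * g) <= u + v)%N.
Proof.
move=> sf; case: v => [|v sg]; last by rewrite addnS; apply: msizeM_leq.
by rewrite leqn0 msize_poly_eq0 => /eqP ->; rewrite mulr0 msize0.
Qed.

Lemma msize_prodXC (K : fieldType) (n : nat) (c : K) (r : seq 'I_n) (P : pred 'I_n) :
  (msize (\prod_(j <- r | P j) 'X_j : {mpoly K[n]}) <= (\sum_(j <- r | P j) 1).+1)%N
  /\ (msize (\prod_(j <- r | P j) ('X_j - c%:MP) - \prod_(j <- r | P j) 'X_j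
       : {mpoly K[n]}) <= \sum_(j <- r | P j) 1)%N.
Proof.
elim: r => [|j r [IH1 IH2]]; first by rewrite !big_nil subrr msize0 msize1.
rewrite !big_cons; case: (P j) => //; split.
  by apply: msizeM_leq => //; rewrite msizeX mdeg1.
set A := (X in msize (X - _)) in IH2 *; set B := (X in msize (X - _)) in IH2.
set C := \prod_(j <- r | P j) 'X_j in IH1 IH2 *.
have -> : ('X_j - c%:MP) * A - 'X_j * C = ('X_j - c%:MP) * (A - C) - c *: C.
  by rewrite -mul_mpolyC; ring.
apply: leq_trans (msizeD_le _ _) _; rewrite geq_max msizeN; apply/andP; split.
  by apply: msizeM_lt => //; rewrite msizeXC.
by apply: leq_trans (msizeZ_le _ _) _; rewrite add1n.
Qed.

Lemma down_card (n : nat) (P : pred 'I_n) :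
  (forall i j : 'I_n, (i <= j)%N -> P j -> P i) -> forall i, P i = (i < #|P|)%N.
Proof.
move=> down i; have cz k : (k <= n)%N -> #|[pred j : 'I_n | (j < k)%N]| = k.
  move=> kn; rewrite -sum1_card (big_ord_narrow_cond (P := xpredT) kn) /=.
  by rewrite sum1_card card_ord.
case: (boolP (P i)) => Pi.
  rewrite -{1}(cz i.+1 (ltn_ord i)); apply/esym/subset_leq_card/subsetP => j.
  by rewrite !inE ltnS => /down; apply.
apply/esym/negbTE; rewrite -leqNgt -[X in (_ <= X)%N](cz i (ltnW (ltn_ord i))).
apply/subset_leq_card/subsetP => j; rewrite !inE => Pj.
by rewrite ltnNge; apply: contra Pi => /down; apply.
Qed.

(** Columns to the left are positive and columns to the right nonnegative, so all of them count. The
    coordinate is therefore [t^-n], which matches the weight of a negative ball. *)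
Lemma kk_first0 (n : nat) (mu : 'X_{1..n.+1}) i : mu i = 0%N ->
  (forall j : 'I_n.+1, (j < i)%N -> (0 < mu j)%N) -> kk mu i = n.
Proof.
move=> m0 H; rewrite kkE.
have E j : kterm mu i j = (j != i) :> nat.
  rewrite /kterm m0 leq0n andbT -val_eqE /=; case: ltngtP => //= ji.
  by rewrite H.
rewrite (eq_bigr _ (fun j _ => E j)).
have := sum_ord_eq i; have : (\sum_(j < n.+1) 1 = n.+1)%N by rewrite sum1_card card_ord.
rewrite (eq_bigr (fun j => (j == i) + (j != i)))%N; last by move=> j _; case: eqP.
by rewrite big_split /=; lia.
Qed.

(** * One step down: invariants of the functions of a row *)

Section Step.
Variables (K : generic_pair) (n L : nat) (la : 'X_{1..n.+1}).
Hypothesis laL : forall j, (la j <= L)%N.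
Hypothesis part : forall i j : 'I_n.+1, (i <= j)%N -> (la j <= la i)%N.
Local Notation qq := (gq K).
Local Notation tt := (gt K).
Local Notation Row := {ffun 'I_n.+1 -> 'I_L.+1}.
Local Notation MP := {mpoly K[n.+1]}.
Local Notation orb m := (@orb n.+1 L la m).
Local Notation lrow m := (@lrow n.+1 L la m).
Implicit Types (v k : Row) (F G : Row -> MP) (m : nat).

Definition rrot v : Row := [ffun i => v (ord_pred i)].
Definition ladeg m : nat := (\sum_j (la j - m))%N.
Definition lasub m : 'X_{1..n.+1} := [multinom (la j - m)%N | j < n.+1].
Definition supX v : MP := \prod_(j | v j != 0%N :> nat) 'X_j.

(* The properties of the generating functions of the rows above [m] that are inherited by the
   next row down; the spectral points are scaled by [q^m] because labels have dropped by [m]. *)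
Record good m F : Prop := Good {
  good_size : forall v, orb m.+1 v -> (msize (F v) <= (ladeg m).+1)%N;
  good_rel : natrel (orb m.+1) F;
  good_van : forall v, orb m.+1 v -> forall mu : 'X_{1..n.+1},
    (mdeg mu < ladeg m)%N -> (F v).@[pt (qq ^+ m) mu] = 0;
  good_cyc : forall v, orb m.+1 v ->
    (msize (qq ^+ (v ord_max - m) *: om (F v) - F (rrot v)) <= ladeg m)%N;
  good_lead : forall v, orb m.+1 v -> (F v)@_(lasub m) = (v == lrow m.+1)%:R }.

(** With [m] counted from 0, [step m G] belongs to row [m+1], [hrow m G] to the signed row on top of
    it, and [G] to row [m+2]. *)
Definition hrow m G : Row -> MP := hfam m.+1 m.+2 L.+1 (orb m.+2) G.
Definition step m G : Row -> MP :=
  Ffam L.+1 (orb m.+1) (qq ^+ m * tt ^- n) (hrow m G).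

Lemma rrotE v : rv (rrot v) =1 rotl (rv v).
Proof. by move=> j; rewrite /rv ffunE. Qed.

Lemma rrot_bij : bijective rrot.
Proof.
exists (fun v => [ffun i => v (ordS i)]) => v; apply/ffunP => j; rewrite !ffunE.
  by rewrite ordSK.
by rewrite ord_predK.
Qed.

Lemma orb_rrot m v : orb m (rrot v) = orb m v.
Proof.
apply: (@orb_perm _ _ _ _ _ _ (@ord_pred n.+1)); first exact: (can_inj (@ord_predK n.+1)).
by move=> j; rewrite ffunE.
Qed.

Lemma orb_range_ok r : range_ok L.+1 r (orb r).
Proof. by move=> v Ov j; apply: (orb_range laL Ov). Qed.

Section OneStep.
Variables (m : nat) (G : Row -> MP).
Hypothesis Gg : good m.+1 G.
Local Notation h := (hrow m G).
Local Notation d1 := (ladeg m.+1).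
Local Notation Ob := (orb m.+1).
Local Notation Ot := (orb m.+2).

Lemma hrow_size k : Ob k -> (msize (h k) <= d1.+1)%N.
Proof.
move=> Ok; apply: msize_sum_le => v Ov; apply: leq_trans (msizeZ_le _ _) _.
exact: (good_size Gg).
Qed.

Lemma hrow_rel : infrel Ob h.
Proof.
apply: (hfam_infrel _ (ltn0Sn _) (orb_swap la m.+2)).
- exact: orb_range_ok.
- exact: orb_range_ok.
- exact: (good_rel Gg).
Qed.

Lemma hrow_van k : Ob k -> forall mu : 'X_{1..n.+1},
  (mdeg mu < d1)%N -> (h k).@[pt (qq ^+ m.+1) mu] = 0.
Proof.
move=> Ok mu Hmu; rewrite /hrow /hfam raddf_sum big1 // => v Ov.
by rewrite /= mevalZ (good_van Gg) // mulr0.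
Qed.

Lemma card_label_orb k v a : Ob k -> Ot v -> (m.+1 < a)%N ->
  #|[set j | rv k j == a]| = #|[set j | rv v j == a]|.
Proof.
move=> Ok Ov ha; rewrite /rv (orb_card laL Ok (fun x => x == a)).
rewrite (orb_card laL Ov (fun x => x == a)); apply: eq_card => j; rewrite !inE.
by rewrite !val_lrow //; case: ifP; case: ifP; lia.
Qed.

(** The powers of [q] in [Cmat_rotl] convert covariance of the top row into covariance of the bottom
    row, with the exponent still taken relative to [m+1]. *)
Lemma hrow_cyc k : Ob k ->
  (msize (qq ^+ (k ord_max - m.+1) *: om (h k) - h (rrot k)) <= d1)%N.
Proof.
move=> Ok; pose C v := Cmat K m.+1 m.+2 L.+1 (rotl (rv k)) (rotl (rv v)).
have -> : h (rrot k) = \sum_(v | Ot v) C v *: G (rrot v).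
  rewrite /hrow /hfam (reindex rrot) /=; last exact: onW_bij rrot_bij.
  apply: eq_big => v; rewrite orb_rrot // => Ov; congr (_ *: _).
  by apply: Cmat_ext; apply: rrotE.
rewrite /hrow /hfam rmorph_sum /= scaler_sumr -sumrB; apply: msize_sum_le => v Ov /=.
have -> : qq ^+ (k ord_max - m.+1) *: om (Cmat K m.+1 m.+2 L.+1 (rv k) (rv v) *: G v)
    - C v *: G (rrot v)
  = C v *: (qq ^+ (v ord_max - m.+1) *: om (G v) - G (rrot v)).
  rewrite substZ scalerA.
  have := @Cmat_rotl K n m.+1 L.+1 (rv k) (rv v); rewrite /rv => ->.
  - by rewrite scalerBr scalerA [_ * C v]mulrC.
  - by case: (orb_range laL Ok ord_max) => H; [left|right].
  - case: (orb_range laL Ov ord_max) => [H|/andP[/ltnW H _]]; [by left|right].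
    by rewrite ltn_ord ltnS H.
  - by move=> a ha; apply: card_label_orb.
by apply: leq_trans (msizeZ_le _ _) _; apply: (good_cyc Gg).
Qed.

Lemma hupZ j a (f : MP) : (j <= n)%N -> hup j (a *: f) = a *: hup j f.
Proof.
elim: j => //= j IH jn; rewrite IH ?(ltnW jn) // heckeZ //.
by rewrite inordK ?ltnS // ltnW.
Qed.

(** The empty spot that [rrot] puts in front is carried back to the right by the Hecke operators,
    with one factor [t] per step by [infrel]. *)
Lemma hup_rrot k j : Ob k -> k ord_max = 0%N :> nat -> (j <= n)%N ->
  exists v, [/\ Ob v, hup j (h (rrot k)) = tt ^+ j *: h v &
    forall i : 'I_n.+1, v i = (if (i < j)%N then k i
      else if i == j :> nat then k ord_max else k (ord_pred i))].
Proof.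
move=> Ok k0; elim: j => [|j IH] jn.
  exists (rrot k); split; rewrite ?orb_rrot ?expr0 ?scale1r // => i.
  rewrite ffunE ltn0; case: eqP => // i0; congr (k _).
  by apply/eqP; rewrite ord_pred_eqmax; apply/eqP/val_inj.
have [v [Ov Ev vE]] := IH (ltnW jn); have vj : (inord j : 'I_n.+1) = j :> nat.
  by rewrite inordK // ltnS ltnW.
have Hi : ((inord j : 'I_n.+1).+1 < n.+1)%N by rewrite vj.
exists (rswap (inord j) v); split.
- by rewrite orb_swap.
- rewrite /= Ev heckeZ //; have [R1 R2] := hrow_rel Hi Ov.
  have v0 : v (inord j) = 0%N :> nat by rewrite vE vj ltnn eqxx.
  case: (posnP (v (nxt (inord j)))) => v1.
    rewrite R2 ?v0 ?v1 // scalerA -exprSr; congr (_ *: h _); apply/ffunP => i.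
    by rewrite ffunE /sgen; case: tpermP => [->|->|//]; apply: ord_inj; rewrite v0 v1.
  by rewrite R1 /igt v0 ?eqxx ?lt0n_neq0 // scalerA -exprSr.
move=> i; rewrite ffunE vE val_sgen // vj.
have [E|/eqP E] := eqVneq (i : nat) j.
  have -> : sgen (inord j) i = nxt (inord j).
    by rewrite (_ : i = inord j) ?sgenL //; apply: ord_inj; rewrite vj.
  rewrite E ltnS leqnn ltnNge leqnSn gtn_eqF //=; congr (k _).
  by apply: (can_inj (@ordSK n.+1)); rewrite ord_predK; apply: ord_inj;
    rewrite val_nxt // val_ordS -val_eqE /= vj E ltn_eqF.
have [E'|/eqP E'] := eqVneq (i : nat) j.+1.
  by rewrite E' !ltnn eqxx.
have -> : sgen (inord j) i = i.
  by apply: ord_inj; rewrite val_sgen // vj; case: eqP => //; case: eqP.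
have /negbTE E2 : (i : nat) != j by apply/eqP.
by rewrite ltnS [(i <= j)%N]leq_eqVlt E2.
Qed.

(** With [f = t^-n g] and [g = h (rrot k)] the identity [Xi] reads
    [(x_0 - c t^-n) (g - om (h k)) = 0], so the lower-degree error in cyclic covariance
    disappears. *)
Lemma hrow_rot0 k : Ob k -> k ord_max = 0%N :> nat -> om (h k) = h (rrot k).
Proof.
move=> Ok k0; have [v [Ov Ev vE]] := hup_rrot Ok k0 (leqnn n).
have vk : v = k.
  apply/ffunP => i; rewrite vE; case: ifP => // lt.
  have im : i = ord_max.
    by apply: ord_inj; apply/eqP; rewrite eqn_leq -ltnS ltn_ord /= leqNgt lt.
  by rewrite im eqxx.
rewrite vk in Ev; have Or : Ob (rrot k) by rewrite orb_rrot.
have Er : hup n (tt ^- n *: h (rrot k)) = h k.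
  by rewrite hupZ // Ev scalerA mulVf ?scale1r ?exptt_neq0.
have := @Xi K n (qq ^+ m.+1) d1 (tt ^- n *: h (rrot k)) (h (rrot k)).
rewrite Er scalerA => H; apply/esym/eqP; rewrite -subr_eq0.
suff : ('X_ord0 - (qq ^+ m.+1 * tt ^- n)%:MP) * (h (rrot k) - om (h k)) == 0.
  by rewrite mulf_eq0 (negPf (mpolyXC_neq0 _ _)).
rewrite mulrBr mulrBl H.
- by rewrite mul_mpolyC addrAC addrK subrr.
- exact: expqq_neq0.
- by apply: leq_trans (msizeZ_le _ _) _; apply: hrow_size.
- exact: hrow_size.
- by move=> mu Hmu; rewrite mevalZ hrow_van // mulr0.
- exact: hrow_van.
- by have := hrow_cyc Ok; rewrite k0 sub0n expr0 scale1r.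
Qed.

Lemma pt_pred (mu : 'X_{1..n.+1}) : (forall i, (0 < mu i)%N) ->
  pt (qq ^+ m) mu =1 pt (qq ^+ m.+1) [multinom (mu i).-1 | i < n.+1].
Proof.
move=> H i; rewrite /pt /gtilde mnmE !mulrA -!exprD addSnnS prednK //.
congr (_ / _ ^+ _); rewrite /kk; congr (_ + _)%N; apply: eq_card => j; rewrite !inE !mnmE.
  by congr (_ && _); have := H i; have := H j; lia.
by congr (_ && _); have := H i; have := H j; lia.
Qed.

(* An empty last column is rotated to the front, and this moves the spectral point by [mshift];
   when no empty columns are left the point is a [q]-multiple of a smaller one. *)
Lemma hrow_van_zeros j k (mu : 'X_{1..n.+1}) : (j <= n.+1)%N -> Ob k ->
  (forall i : 'I_n.+1, (n.+1 - j <= i)%N -> k i = 0%N :> nat) ->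
  (forall i : 'I_n.+1, (i < n.+1 - j)%N -> (0 < mu i)%N) ->
  (mdeg mu < d1 + (n.+1 - j))%N -> (h k).@[pt (qq ^+ m) mu] = 0.
Proof.
elim: j k mu => [|j IH] k mu jn Ok k0 mu0 Hmu.
  have mu1 i : (0 < mu i)%N by apply: mu0; rewrite subn0.
  rewrite (meval_eq _ (pt_pred mu1)) hrow_van //.
  have := mdegE mu; rewrite (eq_bigr (fun i => (mu i).-1 + 1))%N => [|i _].
    rewrite big_split /= sum1_card card_ord => E.
    rewrite mdegE (eq_bigr (fun i => (mu i).-1)) => [|i _]; last by rewrite mnmE.
    by move: Hmu; rewrite E; lia.
  by rewrite addn1 prednK.
have km : k ord_max = 0%N :> nat by apply: k0 => /=; lia.
rewrite -[h k]omK hrow_rot0 // meval_omV; apply: IH; rewrite ?orb_rrot ?(ltnW jn) //.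
- move=> i Hi; rewrite ffunE; have [->|i0] := eqVneq i ord0.
    by rewrite (_ : ord_pred ord0 = ord_max) //; apply/eqP; rewrite ord_pred_eqmax.
  apply: k0; have := val_ordS (ord_pred i); rewrite ord_predK ord_pred_eqmax (negPf i0); lia.
- move=> i Hi; rewrite mnmE; have [->|i0] := eqVneq i ord0; first by rewrite addn1.
  rewrite addn0; apply: mu0.
  by have := val_ordS (ord_pred i); rewrite ord_predK ord_pred_eqmax (negPf i0); lia.
- by rewrite mdeg_mshift; lia.
Qed.

End OneStep.
End Step.

Lemma subr_tele (V : zmodType) (x y z w : V) : x - w = (x - y) + ((y - z) - (w - z)).
Proof. by rewrite opprB [y - z + _]addrA subrK addrA subrK. Qed.

Section StepGood.
Variables (K : generic_pair) (n L : nat) (la : 'X_{1..n.+1}).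
Hypothesis laL : forall j, (la j <= L)%N.
Hypothesis part : forall i j : 'I_n.+1, (i <= j)%N -> (la j <= la i)%N.
Local Notation qq := (gq K).
Local Notation tt := (gt K).
Local Notation Row := {ffun 'I_n.+1 -> 'I_L.+1}.
Local Notation MP := {mpoly K[n.+1]}.
Local Notation orb m := (@orb n.+1 L la m).
Local Notation lrow m := (@lrow n.+1 L la m).
Implicit Types (v k : Row).

Variables (m : nat) (G : Row -> MP).
Hypothesis Gg : good la m.+1 G.
Local Notation h := (hrow la m G).
Local Notation F := (step la m G).
Local Notation d1 := (ladeg la m.+1).
Local Notation Ob := (orb m.+1).
Local Notation c0 := (qq ^+ m * tt ^- n).
Local Notation k0 := (#|[set j : 'I_n.+1 | lrow m.+1 j != 0%N :> nat]|).

Lemma supp_lrow j : (lrow m.+1 j != 0%N :> nat) = (m < la j)%N.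
Proof. by rewrite val_lrow //; case: ifP; lia. Qed.

Lemma ladegS : ladeg la m = (d1 + k0)%N.
Proof.
rewrite /ladeg -sum1_card [X in (_ + X)%N]big_mkcond -big_split /=.
by apply: eq_bigr => j _; rewrite inE supp_lrow; case: ifP; lia.
Qed.

Lemma card_supp v : Ob v -> #|[set j | v j != 0%N :> nat]| = k0.
Proof. by move=> Ov; rewrite (orb_card laL Ov (fun x => x != 0%N)). Qed.

Lemma supp_lrow_lt j : (lrow m.+1 j != 0%N :> nat) = (j < k0)%N.
Proof.
pose P (i : 'I_n.+1) := lrow m.+1 i != 0%N :> nat.
have := @down_card _ P _ j; rewrite /P => -> => [|i1 i2 H]; last first.
  by rewrite !supp_lrow => /leq_trans; apply; apply: part.
by congr (_ < _)%N; apply: eq_card => i; rewrite inE.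
Qed.

(** Above a sorted row the signed layer is rigid, which exposes the linear factors. *)
Lemma step_lrow : F (lrow m.+1)
  = \prod_(j | lrow m.+1 j != 0%N :> nat) ('X_j - c0%:MP) * h (lrow m.+1).
Proof.
rewrite /step /Ffam (bigD1 (lrow m.+1)) ?orb_lrow //= Smat_diag => [|j]; last exact: ltn_ord.
rewrite [X in _ + X]big1 ?addr0 // => k /andP[Ok ne]; rewrite Smat_sorted0 ?mul0r //.
- by move=> j; apply: ltn_ord.
- by move=> i j; apply: lrow_sorted.
- exact/esym/(orb_card laL Ok (fun x => x == 0%N)).
- by move=> E; case/eqP: ne; apply/ffunP => j; apply/esym/val_inj/E.
Qed.

(** If [mu] has a zero in an occupied column, its first zero is in an occupied column as well, and
    the linear factor there vanishes by [kk_first0]. Otherwise [mu] is positive on the [k0] occupied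
    columns, and [hrow_van_zeros] applies to the empty ones. *)
Lemma step_lrow_van (mu : 'X_{1..n.+1}) :
  (mdeg mu < ladeg la m)%N -> (F (lrow m.+1)).@[pt (qq ^+ m) mu] = 0.
Proof.
move=> Hmu; rewrite step_lrow mevalM.
case: (pickP (fun j => (lrow m.+1 j != 0%N :> nat) && (mu j == 0%N))) => [j /andP[lj /eqP mj]|H].
  have P0 : mu j == 0%N by rewrite mj.
  have [i /eqP mi imin] := @arg_minnP _ j (fun i => mu i == 0%N) (fun i => i : nat) P0.
  have li : lrow m.+1 i != 0%N :> nat.
    by move: lj; rewrite !supp_lrow_lt; apply: leq_ltn_trans; apply: imin.
  rewrite (bigD1 i) //= mevalM mevalB mevalXU mevalC /pt /gtilde mi mul1r.
  rewrite kk_first0 ?subrr ?mul0r // => i' lt; rewrite lt0n.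
  by apply: contraTN lt => /imin; rewrite -leqNgt.
have kn : (k0 <= n.+1)%N by apply: leq_trans (max_card _) _; rewrite card_ord.
rewrite (@hrow_van_zeros _ _ _ _ laL _ _ Gg (n.+1 - k0)) ?mulr0 ?leq_subr ?orb_lrow ?subKn //.
- by move=> i ki; apply/eqP; rewrite -[_ == _]negbK supp_lrow_lt -leqNgt.
- move=> i; rewrite -supp_lrow_lt => li; rewrite lt0n; apply/negP => mi.
  by have := H i; rewrite li mi.
- by rewrite -ladegS.
Qed.

Lemma step_rel : natrel Ob F.
Proof.
apply: (@Ffam_natrel _ _ _ m.+2 L.+1 (ltn0Sn _) _ (orb_swap la m.+1)) => //.
  exact: orb_range_ok.
exact: hrow_rel.
Qed.

Lemma step_van v : Ob v -> forall mu : 'X_{1..n.+1},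
  (mdeg mu < ladeg la m)%N -> (F v).@[pt (qq ^+ m) mu] = 0.
Proof.
move=> Ov; pose P w := forall mu : 'X_{1..n.+1}, (mdeg mu < ladeg la m)%N ->
  (F w).@[pt (qq ^+ m) mu] = 0.
apply: (orb_ind laL part (P := P) _ _ Ov); first exact: step_lrow_van.
move=> i w Hi Ow lt IH mu Hmu; have [R _] := step_rel Hi Ow; rewrite -(R lt).
exact: (hecke_vanish Hi (expqq_neq0 _ _) IH).
Qed.

(** A top row other than [v] has a column whose label exceeds the one below, hence an entry of
    smaller degree by [msize_Smat]; the diagonal entry has leading part [supX]. *)
Lemma step_top v : Ob v -> (msize (F v - supX K v * h v) <= ladeg la m)%N.
Proof.
move=> Ov; rewrite ladegS addnC -(card_supp Ov) /step /Ffam (bigD1 v) //=.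
rewrite Smat_diag => [|j]; last exact: ltn_ord.
rewrite addrAC -mulrBl; apply: leq_trans (msizeD_le _ _) _; rewrite geq_max.
have [s1 s2] := msize_prodXC c0 (index_enum 'I_n.+1) (fun j => v j != 0%N :> nat).
have sc : (\sum_(j | v j != 0%N :> nat) 1 = #|[set j | v j != 0%N :> nat]|)%N.
  by rewrite -sum1_card; apply: eq_bigl => j; rewrite inE.
apply/andP; split.
  by rewrite mulrC addnC; apply: msizeM_lt; rewrite -?sc //; apply: (hrow_size Gg).
apply: msize_sum_le => k /andP[Ok ne].
rewrite mulrC addnC; apply: msizeM_lt; first exact: (hrow_size Gg).
apply: leq_trans (msize_Smat _ _ _ _) _; rewrite (card_supp Ov) -(card_supp Ok).
apply/proper_card/properP; split.
  by apply/subsetP => j; rewrite !inE lt0n => /andP[].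
case: (pickP (fun j => rv v j < rv k j)%N) => [j lt|H].
  exists j; rewrite !inE; first by apply: contraTneq lt; rewrite /rv => ->.
  by apply/negP => /andP[_]; rewrite leqNgt (lt : (v j < k j)%N).
case/eqP: ne; apply/ffunP => j; apply/esym/val_inj.
apply: (@sum_le_eq _ (rv v) (rv k)) => [i|]; first by rewrite leqNgt H.
by rewrite /rv (orb_sum laL Ov) (orb_sum laL Ok).
Qed.

Lemma msize_supX v : Ob v -> (msize (supX K v) <= k0.+1)%N.
Proof.
move=> Ov; have [s1 _] := msize_prodXC c0 (index_enum 'I_n.+1) (fun j => v j != 0%N :> nat).
apply: leq_trans s1 _; rewrite ltnS -(card_supp Ov) -sum1_card.
by apply: eq_leq; apply: eq_bigl => j; rewrite inE.
Qed.

Lemma step_size v : Ob v -> (msize (F v) <= (ladeg la m).+1)%N.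
Proof.
move=> Ov; rewrite -[F v](subrK (supX K v * h v)).
apply: leq_trans (msizeD_le _ _) _; rewrite geq_max (leq_trans (step_top Ov)) //=.
by rewrite ladegS addnC; apply: msizeM_leq; rewrite ?msize_supX ?(hrow_size Gg).
Qed.

Lemma om_supX v : om (supX K v)
  = (if v ord_max == 0%N :> nat then 1 else qq^-1) *: supX K (rrot v).
Proof.
rewrite /supX rmorph_prod /=.
have -> : \prod_(j | rrot v j != 0%N :> nat) 'X_j
    = \prod_(j | v j != 0%N :> nat) 'X_(ordS j) :> MP.
  rewrite (reindex_inj (@ordS_inj n.+1)); apply: eq_bigl => j.
  by rewrite ffunE ordSK.
rewrite (eq_bigr (fun j => (if j == ord_max then qq^-1 else 1) *: 'X_(ordS j))) => [|j _];
  last exact: omX.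
case: ifP => vm; rewrite ?scale1r.
  apply: eq_bigr => j vj; case: eqP => [jm|_]; last by rewrite scale1r.
  by rewrite jm vm in vj.
rewrite (bigD1 ord_max) ?vm //= [in RHS](bigD1 ord_max) ?vm //= eqxx -scalerAl.
congr (_ *: (_ * _)); apply: eq_bigr => j /andP[_ /negPf ->].
by rewrite scale1r.
Qed.

Lemma step_cyc v : Ob v ->
  (msize (qq ^+ (v ord_max - m) *: om (F v) - F (rrot v)) <= ladeg la m)%N.
Proof.
move=> Ov; have Or : Ob (rrot v) by rewrite orb_rrot.
have -> : qq ^+ (v ord_max - m) *: om (F v) - F (rrot v)
  = qq ^+ (v ord_max - m) *: om (F v - supX K v * h v)
    + (supX K (rrot v) * (qq ^+ (v ord_max - m.+1) *: om (h v) - h (rrot v))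
       - (F (rrot v) - supX K (rrot v) * h (rrot v))).
  rewrite rmorphB rmorphM /= om_supX -scalerAl scalerBr scalerA mulrBr -scalerAr.
  (* An occupied last column contributes [q^-1] through [om_supX]; this lowers the exponent by one,
     from level [m] to level [m+1]. *)
  have -> : qq ^+ (v ord_max - m) * (if v ord_max == 0%N :> nat then 1 else qq^-1)
      = qq ^+ (v ord_max - m.+1).
    case: (orb_range laL Ov ord_max) => [->|/andP[lt _]]; first by rewrite !sub0n mulr1.
    have E : (v ord_max - m = (v ord_max - m.+1).+1)%N by move: lt; clear; lia.
    by rewrite gtn_eqF ?(leq_trans _ lt) // E exprSr mulfK ?qq_neq0.
  exact: subr_tele.
apply: leq_trans (msizeD_le _ _) _; rewrite geq_max; apply/andP; split.
  by apply: leq_trans (msizeZ_le _ _) _; apply: leq_trans (msize_om _) _; apply: step_top.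
apply: leq_trans (msizeD_le _ _) _; rewrite geq_max msizeN step_top // andbT.
by rewrite ladegS addnC; apply: msizeM_lt; [apply: msize_supX|apply: (hrow_cyc laL Gg)].
Qed.

(** The monomial has top degree, so only [supX v * h v] counts. Divisibility by [supX v] forces [v]
    to occupy the columns with [la j > m]; a nonzero entry of the classic layer then forces [v] to
    dominate the sorted row columnwise, hence to equal it. *)
Lemma step_lead v : Ob v -> (F v)@_(lasub la m) = (v == lrow m.+1)%:R.
Proof.
move=> Ov; have dl : mdeg (lasub la m) = ladeg la m.
  by rewrite mdegE; apply: eq_bigr => j _; rewrite mnmE.
rewrite -[F v](subrK (supX K v * h v)) mcoeffD (memN_msupp_eq0 (msize_mdeg_ge _)) ?add0r;
  last by rewrite dl step_top.
pose sm : 'X_{1..n.+1} := [multinom (v j != 0%N :> nat) : nat | j < n.+1].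
have -> : supX K v = 'X_[sm].
  rewrite mpolyXE_id /supX big_mkcond; apply: eq_bigr => j _.
  by rewrite mnmE; case: ifP.
rewrite mulrC.
case: (boolP [forall j, (v j != 0%N :> nat) ==> (m < la j)%N]) => [/forallP H|]; last first.
  rewrite negb_forall => /existsP[j]; rewrite negb_imply => /andP[vj lj].
  have -> : (v == lrow m.+1) = false.
    by apply: contraTF vj => /eqP ->; rewrite supp_lrow.
  apply: memN_msupp_eq0; rewrite (perm_mem (msuppMX _ _)); apply/mapP => -[mu' _ E].
  have := congr1 (fun mu : 'X_{1..n.+1} => mu j) E; rewrite !mnmE vj.
  by move: lj; rewrite -leqNgt -subn_eq0 => /eqP ->.
have sE j : (v j != 0%N :> nat) = (m < la j)%N.
  have : [set j | v j != 0%N :> nat] = [set j | lrow m.+1 j != 0%N :> nat].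
    apply/eqP; rewrite eqEcard (card_supp Ov) leqnn andbT; apply/subsetP => i.
    by rewrite !inE supp_lrow; apply/implyP.
  by move/setP/(_ j); rewrite !inE supp_lrow.
have -> : lasub la m = (sm + lasub la m.+1)%MM.
  by apply/mnmP => j; rewrite !mnmE sE; case: ltnP; lia.
rewrite mcoeffMX /hrow /hfam raddf_sum /= (bigD1 (lrow m.+2)) ?orb_lrow //=.
rewrite mcoeffZ (good_lead Gg) ?orb_lrow // eqxx mulr1 big1 ?addr0; last first.
  by move=> w /andP[Ow /negPf ne]; rewrite mcoeffZ (good_lead Gg) // ne mulr0.
case: eqP => [->|ne].
  apply: Cmat_diag => // a j ha; rewrite /rv !val_lrow //.
  by case: ifP; case: ifP; lia.
apply/eqP; rewrite -[_ == _]negbK; apply/negP => /Cmat_neq0 C0; case: ne.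
apply: (orb_ge laL Ov) => // j; rewrite val_lrow //; case: ifP => // lj.
case: (orb_range laL Ov j) => [vj|/andP[vj _]]; first by have := sE j; rewrite vj lj.
case: (ltngtP m.+1 (la j)) lj => // [lt|<-//] _.
have := C0 j; rewrite /rv val_lrow // lt ltnS laL andbT lt => /(_ isT) [v0|//].
by have := sE j; rewrite v0 (ltnW lt).
Qed.

Lemma step_good : good la m F.
Proof.
split; [exact: step_size|exact: step_rel|exact: step_van|exact: step_cyc|exact: step_lead].
Qed.

End StepGood.

(** * The bottom row *)

Section Final.
Variables (K : generic_pair) (n L : nat) (la : 'X_{1..n.+1}).
Hypothesis laL : forall j, (la j <= L)%N.
Hypothesis part : forall i j : 'I_n.+1, (i <= j)%N -> (la j <= la i)%N.
Local Notation qq := (gq K).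
Local Notation tt := (gt K).
Local Notation tilde := (@gtilde K n.+1).
Local Notation Row := {ffun 'I_n.+1 -> 'I_L.+1}.
Local Notation MP := {mpoly K[n.+1]}.
Local Notation T := (@ghecke K n.+1).
Local Notation orb m := (@orb n.+1 L la m).
Local Notation lrow m := (@lrow n.+1 L la m).
Implicit Types (v w : Row) (f g : MP).

Lemma hecke1 (i : 'I_n.+1) : (i.+1 < n.+1)%N -> T i 1 = tt *: 1.
Proof.
move=> Hi; apply: hecke_uniq => //; rewrite /is_ghecke rmorph1 subrr mulr0 subr0.
by rewrite mulr1 -scalerAr mulr1.
Qed.

Lemma good_base : good la L (fun _ : Row => 1 : MP).
Proof.
have z v : orb L.+1 v -> forall j, v j = 0%N :> nat.
  by move=> Ov j; case: (orb_range laL Ov j) => // H; move: (ltn_ord (v j)); lia.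
have d0 : ladeg la L = 0%N.
  by apply: big1 => j _; apply/eqP; rewrite subn_eq0.
split.
- by move=> v _; rewrite msize1.
- by move=> i Hi v Ov; rewrite !(z v Ov) ltnn; split=> // _; apply: hecke1.
- by move=> v _ mu; rewrite d0.
- by move=> v Ov; rewrite (z v Ov) sub0n expr0 scale1r rmorph1 subrr msize0.
- move=> v Ov; rewrite mcoeff1; congr (_%:R); congr nat_of_bool.
  have -> : lasub la L = 0%MM.
    by apply/mnmP => j; rewrite !mnmE; apply/eqP; rewrite subn_eq0.
  rewrite eqxx; apply/esym/eqP/ffunP => j; apply: ord_inj.
  by rewrite !z // orb_lrow.
Qed.

Fixpoint Fdown d : Row -> MP :=
  if d is d'.+1 then step la (L - d'.+1) (Fdown d') else fun=> 1.

Lemma good_Fdown d : (d <= L)%N -> good la (L - d) (Fdown d).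
Proof.
elim: d => [|d IH] dL; first by rewrite subn0; apply: good_base.
by apply: step_good => //; rewrite subnSK //; apply/IH/ltnW.
Qed.

Local Notation F := (Fdown L).
Local Notation Fl := (F (lrow 1)).

Lemma good_F : good la 0 F.
Proof. by have := good_Fdown (leqnn L); rewrite subnn. Qed.

Lemma ladeg0 : ladeg la 0 = mdeg la.
Proof. by rewrite mdegE; apply: eq_bigr => j _; rewrite subn0. Qed.

Lemma lasub0 : lasub la 0 = la.
Proof. by apply/mnmP => j; rewrite mnmE subn0. Qed.

Lemma val_lrow1 j : lrow 1 j = la j :> nat.
Proof. by rewrite val_lrow //; case: ifP => //; lia. Qed.

(** Ties contribute a factor [t], so a part can be carried across equal ones without case
    distinctions; in [column_eigen] only the exponents of [q] matter. *)
Lemma natrel_pow (i : 'I_n.+1) v : (i.+1 < n.+1)%N -> orb 1 v ->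
  (v (nxt i) <= v i)%N -> exists e, T i (F v) = tt ^+ e *: F (rswap i v).
Proof.
move=> Hi Ov; have [R1 R2] := good_rel good_F Hi Ov.
rewrite leq_eqVlt => /orP[/eqP E|lt]; last by exists 0%N; rewrite R1 // expr0 scale1r.
exists 1%N; rewrite R2 ?E // expr1 (_ : rswap i v = v) //; apply/ffunP => j.
by rewrite ffunE /sgen; case: tpermP => [->|->|//]; apply: ord_inj; rewrite E.
Qed.

Section Column.
Variable i : 'I_n.+1.
Local Notation Tj := (fun j : nat => T (inord j)).
Local Notation Vj := (fun j : nat => heckeV (inord j : 'I_n.+1)).
Local Notation Ti k := (foldr Tj Fl (iota k (i - k))).
Local Notation Vi k := (foldr Vj Fl (iota k (i - k))).

Lemma iota_cons k : (k < i)%N -> iota k (i - k) = k :: iota k.+1 (i - k.+1).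
Proof. by move=> ki; rewrite -subnSK. Qed.

Lemma inordK' k : (k < i)%N -> ((inord k : 'I_n.+1).+1 < n.+1)%N.
Proof. by move=> ki; rewrite inordK; have := ltn_ord i; lia. Qed.

Lemma hup_Vi k : (k <= i)%N -> hup k (Vi 0) = Vi k.
Proof.
elim: k => [|k IH] ki //=; rewrite IH ?(ltnW ki) // iota_cons //=.
by rewrite heckeVK // inordK'.
Qed.

(** Once the inverses have cancelled, the remaining operators carry the part [la i] to the right
    past parts that are not larger. *)
Lemma hup_right k : (i <= k <= n)%N -> exists e v,
  [/\ orb 1 v, hup k (Vi 0) = tt ^+ e *: F v &
   forall j : 'I_n.+1, v j = lrow 1 (if (j < i)%N then j else if (j < k)%N then ordS j
     else if j == k :> nat then i else j)].
Proof.
elim: k => [|k IH] /andP[ik kn].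
  have i0 : i = 0%N :> nat by apply/eqP; rewrite -leqn0.
  exists 0%N, (lrow 1); split; rewrite ?orb_lrow // ?i0 ?expr0 ?scale1r // => j.
  by rewrite !ltn0; case: eqP => // j0; congr (lrow 1 _); apply: ord_inj; rewrite i0.
move: ik; rewrite leq_eqVlt => /orP[/eqP ik|ik].
  exists 0%N, (lrow 1); split; rewrite ?orb_lrow ?expr0 ?scale1r //.
    by rewrite -ik hup_Vi // subnn.
  move=> j; rewrite -ik; case: ltnP => // ij; case: eqP => // E.
  by congr (lrow 1 _); apply: ord_inj.
have [|e [v [Ov Ev vE]]] := IH; first by rewrite -ltnS ik ltnW.
have vk : (inord k : 'I_n.+1) = k :> nat by rewrite inordK // ltnS ltnW.
have Hk : ((inord k : 'I_n.+1).+1 < n.+1)%N by rewrite vk.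
have h1 : (k < i)%N = false by move: ik; clear; lia.
have h2 : (k.+1 < i)%N = false by move: ik; clear; lia.
have h3 : (k.+1 < k)%N = false by clear; lia.
have h4 : (k.+1 == k)%N = false by clear; lia.
have [|e' Ee] := natrel_pow Hk Ov.
  rewrite !vE val_nxt // vk ltnn eqxx h1 h2 h3 h4 !val_lrow1; apply: part.
  by rewrite val_nxt // vk ltnW.
exists (e + e')%N, (rswap (inord k) v); split; rewrite ?orb_swap //.
  by rewrite /= Ev heckeZ // Ee scalerA exprD.
move=> j; rewrite ffunE vE; congr (lrow 1 _).
have [E|/eqP E] := eqVneq (j : nat) k.
  have -> : j = inord k by apply: ord_inj; rewrite vk.
  rewrite sgenL val_nxt // vk ltnSn h1 h2 h3 h4.
  by apply: ord_inj; rewrite val_nxt // val_ordS -val_eqE /= vk ltn_eqF.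
have [E'|/eqP E'] := eqVneq (j : nat) k.+1.
  have -> : j = nxt (inord k) by apply: ord_inj; rewrite val_nxt // vk.
  by rewrite sgenR val_nxt // vk h1 h2 !ltnn !eqxx.
have -> : sgen (inord k) j = j.
  by apply: ord_inj; rewrite val_sgen // vk; case: eqP => //; case: eqP.
by move/eqP/negPf: E => E; rewrite ltnS [(j <= k)%N]leq_eqVlt E.
Qed.

(** The part [la i] is carried to the left past parts that are not smaller, in the end to column 0.
    The resulting row is the rotation of the one reached by [hup_right]. *)
Lemma Ti_left l : (l <= i)%N -> exists e v,
  [/\ orb 1 v, Ti (i - l) = tt ^+ e *: F v &
   forall j : 'I_n.+1, v j = lrow 1 (if (j < i - l)%N then j
     else if j == (i - l)%N :> nat then i else if (j <= i)%N then ord_pred j else j)].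
Proof.
elim: l => [|l IH] li.
  exists 0%N, (lrow 1); rewrite subn0 subnn; split; rewrite ?orb_lrow ?expr0 ?scale1r // => j.
  by case: ltngtP => // E; congr (lrow 1 _); apply: ord_inj.
have [e [v [Ov Ev vE]]] := IH (ltnW li).
pose k := (i - l.+1)%N; have Ek : (i - l)%N = k.+1 by rewrite /k; lia.
have ki : (k < i)%N by rewrite /k; lia.
rewrite Ek in Ev vE; rewrite -/k.
have Hk := inordK' ki; have vk : (inord k : 'I_n.+1) = k :> nat.
  by rewrite inordK //; have := ltn_ord i; lia.
have [|e' Ee] := natrel_pow Hk Ov.
  rewrite !vE val_nxt // vk ltnn eqxx ltnSn !val_lrow1.
  by apply: part; rewrite vk ltnW.
exists (e + e')%N, (rswap (inord k) v); split; rewrite ?orb_swap //.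
  by rewrite iota_cons //= Ev heckeZ ?inordK' // Ee scalerA exprD.
move=> j; rewrite ffunE vE; congr (lrow 1 _).
have [E|/eqP E] := eqVneq (j : nat) k.
  have -> : j = inord k by apply: ord_inj; rewrite vk.
  by rewrite sgenL val_nxt // vk !ltnn !eqxx.
have [E'|/eqP E'] := eqVneq (j : nat) k.+1.
  have -> : j = nxt (inord k) by apply: ord_inj; rewrite val_nxt // vk.
  rewrite sgenR val_nxt // vk ltnSn ltnNge leqnSn ki /=.
  apply: (can_inj (@ordSK n.+1)); rewrite ord_predK; apply: ord_inj.
  by rewrite val_nxt // val_ordS -val_eqE /= vk ltn_eqF ?(leq_trans ki) // -ltnS.
have -> : sgen (inord k) j = j.
  by apply: ord_inj; rewrite val_sgen // vk; case: eqP => //; case: eqP.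
by move/eqP/negPf: E => E; move/eqP/negPf: E' => ->; rewrite ltnS [(j <= k)%N]leq_eqVlt E.
Qed.

Lemma heckeVZ (j : 'I_n.+1) a f : (j.+1 < n.+1)%N -> heckeV j (a *: f) = a *: heckeV j f.
Proof.
move=> Hj; rewrite /heckeV heckeZ // [(tt - 1) *: _]scalerA [_ * a]mulrC -[(a * _) *: f]scalerA.
by rewrite -scalerBr [LHS]scalerA [_ * a]mulrC -scalerA.
Qed.

Lemma Vi_bounds k : (k <= i)%N -> (msize (Vi k) <= (ladeg la 0).+1)%N /\
  forall mu : 'X_{1..n.+1}, (mdeg mu < ladeg la 0)%N -> (Vi k).@[pt 1 mu] = 0.
Proof.
move=> ki; rewrite -[k](subKn ki); move: (i - k)%N (leq_subr k i) => {ki}k.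
elim: k => [|k IH] ki.
  rewrite subn0 subnn /=; split; first exact: (good_size good_F (orb_lrow laL 1)).
  by move=> mu Hmu; have := good_van good_F (orb_lrow laL 1) Hmu; rewrite expr0.
have [sk vk] := IH (ltnW ki).
have kl : (i - k.+1 < i)%N by lia.
have Hk := inordK' kl; rewrite iota_cons //= (_ : (i - k.+1).+1 = i - k)%N; last by lia.
split.
  apply: leq_trans (msizeZ_le _ _) _; apply: leq_trans (msizeD_le _ _) _.
  rewrite geq_max msizeN (leq_trans (msize_hecke Hk _)) //=.
  exact: leq_trans (msizeZ_le _ _) _.
move=> mu Hmu; rewrite /heckeV mevalZ mevalB mevalZ vk // mulr0 subr0.
by rewrite (hecke_vanish Hk _ vk) ?mulr0 ?oner_neq0.
Qed.

(* At the points of top degree [Xi] says that [T_0^-1 ... T_(i-1)^-1 F_la] and a multiple of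
   [T_0 ... T_(i-1) F_la] differ by the spectral value at column [0]; the relation
   [hecke_jucys] transports this to column [i]. *)
Lemma column_eigen (mu : 'X_{1..n.+1}) : mdeg mu = ladeg la 0 ->
  Fl.@[pt 1 mu] != 0 -> mu i = la i.
Proof.
have inn : (i <= n <= n)%N by rewrite leqnn -ltnS ltn_ord.
have [e [v [Ov Ev vE]]] := hup_right inn.
have [e' [w [Ow Ew wE]]] := Ti_left (leqnn i); rewrite subnn in Ew wE.
have wv : w = rrot v.
  apply/ffunP => j; rewrite wE [rrot v j]ffunE vE ltn0; congr (lrow 1 _).
  have [->|j0] := eqVneq j ord0.
    have -> : ord_pred ord0 = ord_max :> 'I_n.+1 by apply/eqP; rewrite ord_pred_eqmax.
    by rewrite /= eqxx ltnn ltnNge -ltnS ltn_ord.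
  have := val_ordS (ord_pred j); rewrite ord_predK ord_pred_eqmax (negPf j0) => jv.
  have jn := ltn_ord j; rewrite (_ : (j == 0%N :> nat) = false); last by lia.
  rewrite jv; case: ltnP => h //.
  by rewrite (_ : (ord_pred j < n)%N) ?ord_predK //; lia.
have vm : v ord_max = la i :> nat.
  by rewrite vE /= ltnn eqxx ltnNge -ltnS ltn_ord val_lrow1.
(* Chosen so that [ce *: Ti 0] is [t^e q^(-la i) F w], the leading part of the rotation of
   [hup n (Vi 0)]. *)
pose ce : K := tt ^+ e * qq ^- la i * tt ^- e'.
have [sV vV] := Vi_bounds (leq0n i).
have base (nu : 'X_{1..n.+1}) : mdeg nu = ladeg la 0 ->
    tilde nu ord0 * (ce *: Ti 0).@[pt 1 nu] = (Vi 0).@[pt 1 nu].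
  move=> dnu; have := @Xi K n 1 (ladeg la 0) (Vi 0) (ce *: Ti 0) (oner_neq0 _) sV.
  have Eg : ce *: Ti 0 = (tt ^+ e * qq ^- la i) *: F w.
    by rewrite Ew scalerA /ce divfK // exptt_neq0.
  have vg (nu' : 'X_{1..n.+1}) : (mdeg nu' < ladeg la 0)%N -> (ce *: Ti 0).@[pt 1 nu'] = 0.
    move=> H; rewrite Eg mevalZ; have := good_van good_F Ow H; rewrite expr0 => ->.
    by rewrite mulr0.
  move=> H; have {}H := H _ vV vg; have : (msize (ce *: Ti 0) <= (ladeg la 0).+1)%N.
    by rewrite Eg; apply: leq_trans (msizeZ_le _ _) _; apply: (good_size good_F Ow).
  move/H => {}H; have : (msize (om (hup n (Vi 0)) - ce *: Ti 0) <= ladeg la 0)%N.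
    rewrite Ev Eg substZ wv.
    have -> : tt ^+ e *: om (F v) - (tt ^+ e * qq ^- la i) *: F (rrot v)
      = (tt ^+ e * qq ^- la i) *: (qq ^+ (v ord_max - 0) *: om (F v) - F (rrot v)).
      by rewrite scalerBr scalerA subn0 vm divfK ?expqq_neq0.
    by apply: leq_trans (msizeZ_le _ _) _; apply: (good_cyc good_F Ov).
  move/H => {}H; have := congr1 (fun f => f.@[pt 1 nu]) H.
  rewrite /= mevalM mevalXU pt1 => ->; rewrite mevalD mevalZ mul1r mevalM mevalB mevalXU mevalC.
  rewrite -[RHS]addr0; congr (_ + _); first by rewrite mul1r.
  case: (posnP (nu ord0)) => n0.
    by rewrite pt_eq0 // ?mul1r subrr mul0r.
  rewrite -{2}(munshiftK n0) meval_om (hup_vanish _ _ vV) ?mulr0 ?oner_neq0 //.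
  by rewrite -dnu -[X in (_ < mdeg X)%N](munshiftK n0) mdeg_mshift.
(* Each use of [hecke_jucys] moves the spectral factor one column to the right, strips [T_k] from
   one side and [T_k^-1] from the other, and costs [t]. *)
have ind k : (k <= i)%N -> forall nu : 'X_{1..n.+1}, mdeg nu = ladeg la 0 ->
    tilde nu (inord k) * ((tt ^+ k * ce) *: Ti k).@[pt 1 nu] = (Vi k).@[pt 1 nu].
  elim: k => [|k IH] ki.
    have -> : inord 0 = ord0 :> 'I_n.+1 by apply: ord_inj; rewrite inordK.
    by rewrite expr0 mul1r.
  have Hk := inordK' ki; have {}IH := IH (ltnW ki); rewrite (iota_cons ki) /= in IH.
  have nk : nxt (inord k) = inord k.+1 :> 'I_n.+1.
    have kn : (k.+1 < n.+1)%N by have := ltn_ord i; lia.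
    by apply: ord_inj; rewrite val_nxt // !inordK // ltnW.
  move=> nu dnu; have := hecke_jucys Hk (oner_neq0 _) IH dnu.
  rewrite nk heckeVZ // heckeKV // => <-.
  by rewrite !mevalZ exprS; ring.
(* At [k = i] both products of operators are empty, so [Fl] itself stands on both sides and
   cancels. *)
move=> dmu Fmu; have := ind i (leqnn i) mu dmu; rewrite subnn /= inord_val mevalZ mulrA.
rewrite -[X in _ = X -> _]mul1r => /(mulIf Fmu).
rewrite /gtilde /ce => H.
have {}H : qq ^+ mu i * tt ^+ (i + e) = qq ^+ la i * tt ^+ (kk mu i + e').
  have := congr1 (fun x => x * (qq ^+ la i * (tt ^+ kk mu i * tt ^+ e'))) H.
  rewrite /= mul1r !exprD => <-.
  have n1 := expqq_neq0 K (la i); have n2 := exptt_neq0 K (kk mu i).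
  have n3 := exptt_neq0 K e'.
  move: n1 n2 n3; move: (qq ^+ la i) (tt ^+ kk mu i) (tt ^+ e') => x y z n1 n2 n3.
  by field; rewrite n3 n1 !exptt_neq0.
by have [] := g_inj H.
Qed.

End Column.
Lemma Fl_van (mu : 'X_{1..n.+1}) : (mdeg mu <= mdeg la)%N -> mu <> la ->
  Fl.@[pt 1 mu] = 0.
Proof.
rewrite -ladeg0 leq_eqVlt => /orP[/eqP dmu|lt] ne; last first.
  by have := good_van good_F (orb_lrow laL 1) lt; rewrite expr0.
apply/eqP; rewrite -[_ == _]negbK; apply/negP => Fmu; case: ne.
by apply/mnmP => i; apply: column_eigen.
Qed.

Lemma Fl_size : (msize Fl <= (mdeg la).+1)%N.
Proof. by rewrite -ladeg0; apply: (good_size good_F (orb_lrow laL 1)). Qed.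

Lemma Fl_lead : Fl@_la = 1.
Proof. by have := good_lead good_F (orb_lrow laL 1); rewrite lasub0 eqxx. Qed.

End Final.

(** * Reduced words *)

Section Inversions.
Variables (n L : nat).
Local Notation Row := {ffun 'I_n -> 'I_L.+1}.
Implicit Types (v : Row).

(** The number of inversions relative to the sorted row, that is, the length of the shortest
    permutation producing [v]. *)
Definition asc v : nat :=
  #|[set p : 'I_n * 'I_n | (p.1 < p.2)%N && (v p.1 < v p.2)%N]|.

Lemma asc_swap (i : 'I_n) v : (i.+1 < n)%N ->
  (asc (rswap i v) + (v i < v (nxt i)) = asc v + (v (nxt i) < v i))%N.
Proof.
move=> Hi; pose s2 (p : 'I_n * 'I_n) := (sgen i p.1, sgen i p.2).
have s2K : involutive s2 by move=> [a b]; rewrite /s2 /= !sgenK.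
pose P (p : 'I_n * 'I_n) : nat := (p.1 < p.2)%N && (v p.1 < v p.2)%N.
pose P' (p : 'I_n * 'I_n) : nat := (sgen i p.1 < sgen i p.2)%N && (v p.1 < v p.2)%N.
have EP : asc v = (\sum_p P p)%N.
  rewrite /asc -sum1_card big_mkcond; apply: eq_bigr => p _.
  by rewrite inE /P; case: (_ && _).
have EP' : asc (rswap i v) = (\sum_p P' p)%N.
  rewrite /asc -sum1_card big_mkcond (reindex_inj (can_inj s2K)) /=.
  apply: eq_bigr => p _; rewrite inE /= !ffunE !sgenK /P'.
  by case: (_ && _).
have ne := nxt_neq Hi; have ltn := val_nxt Hi.
pose p1 := (i, nxt i); pose p2 := (nxt i, i).
have ne12 : p2 != p1 by rewrite /p1 /p2 xpair_eqE eq_sym (negPf ne).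
rewrite EP EP' (bigD1 p1) // [in RHS](bigD1 p1) //= (bigD1 p2) // [in RHS](bigD1 p2) //=.
have -> : (\sum_(p | (p != p1) && (p != p2)) P' p = \sum_(p | (p != p1) && (p != p2)) P p)%N.
  apply: eq_bigr => -[a b]; rewrite /p1 /p2 !xpair_eqE /P /P' /= => /andP[h1 h2].
  congr (nat_of_bool (_ && _)); rewrite !val_sgen //.
  move: h1 h2; rewrite -!val_eqE /= ltn.
  by case: (eqVneq (a : nat) i); case: (eqVneq (b : nat) i);
    case: (eqVneq (a : nat) i.+1); case: (eqVneq (b : nat) i.+1) => //=; lia.
rewrite /P /P' /= !sgenL !sgenR ltn ltnSn (ltnNge i.+1) leqnSn /=.
by lia.
Qed.

End Inversions.

Section Words.
Variables (n L : nat) (la : 'X_{1..n}).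
Hypothesis laL : forall j, (la j <= L)%N.
Hypothesis part : forall i j : 'I_n, (i <= j)%N -> (la j <= la i)%N.
Local Notation Row := {ffun 'I_n -> 'I_L.+1}.
Local Notation orb m := (@orb n L la m).
Local Notation l0 := (@lrow n L la 1).
Implicit Types (v : Row) (w : seq 'I_n).

Definition wrow w : Row := foldr (@rswap n L) l0 w.

Lemma val_l0 j : l0 j = la j :> nat.
Proof. by rewrite val_lrow //; case: ifP => //; lia. Qed.

Lemma wrowE w j : wrow w j = pact (word_perm w) la j :> nat.
Proof.
elim: w j => [|i w IH] j; first by rewrite /= mnmE invg1 perm1 val_l0.
by rewrite /= ffunE IH !mnmE invMg permM /sgen tpermV.
Qed.

Lemma wrow_eq w v (mu : 'X_{1..n}) : (forall j, v j = mu j :> nat) ->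
  pact (word_perm w) la = mu <-> wrow w = v.
Proof.
move=> vmu; split=> [E|E].
  by apply/ffunP => j; apply: ord_inj; rewrite wrowE E vmu.
by apply/mnmP => j; rewrite -wrowE E.
Qed.

Lemma orb_wrow w : orb 1 (wrow w).
Proof. by elim: w => [|i w IH] /=; [apply: orb_lrow|rewrite orb_swap]. Qed.

Lemma asc_l0 : asc l0 = 0%N.
Proof.
apply/eqP; rewrite cards_eq0; apply/eqP/setP => -[a b]; rewrite !inE /=.
by apply/negP => /andP[/ltnW ab]; rewrite ltnNge (lrow_sorted laL part _ ab).
Qed.

Lemma asc_wrow_le w : valid_word w -> (asc (wrow w) <= size w)%N.
Proof.
elim: w => [|i w IH] /=; first by rewrite asc_l0.
by case/andP=> Hi /IH {}IH; have := asc_swap (wrow w) Hi; lia.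
Qed.

Lemma word_exists v : orb 1 v -> exists w, [/\ valid_word w, wrow w = v & size w = asc v].
Proof.
move=> Ov; pose P v' := exists w, [/\ valid_word w, wrow w = v' & size w = asc v'].
apply: (orb_ind laL part (P := P) _ _ Ov); first by exists [::]; rewrite asc_l0.
move=> i v' Hi Ov' lt [w [vw Ew sw]]; exists (i :: w); split.
- by rewrite /= Hi.
- by rewrite /= Ew.
- by have := asc_swap v' Hi; rewrite /= sw lt (ltnNge (v' i)) (ltnW lt); lia.
Qed.

(** Both the permutation and its word are arbitrary choices. Minimality at both levels pins the
    length of the word to [asc v], which is what [foldr_hecke] asks for. *)
Lemma reduced_sigma v (mu : 'X_{1..n}) : orb 1 v -> (forall j, v j = mu j :> nat) ->
  let w := epsilon (inhabits [::]) (reduced_word (sigma_mu la mu)) in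
  [/\ valid_word w, wrow w = v & size w = asc v].
Proof.
move=> Ov vmu /=; have [w0 [vw0 Ew0 sw0]] := word_exists Ov.
have min w : valid_word w -> pact (word_perm w) la = mu -> (size w0 <= size w)%N.
  by move=> vw /(wrow_eq w vmu) E; rewrite sw0 -E asc_wrow_le.
have mu0 : pact (word_perm w0) la = mu by apply/(wrow_eq w0 vmu).
have sp : shortest_perm la mu (sigma_mu la mu).
  apply: epsilon_spec; exists (word_perm w0); split=> //; exists w0; split.
    by split=> // w' vw' E; apply: min => //; rewrite E.
  by move=> s' w' Es' vw' E; apply: min => //; rewrite E.
case: sp => Es [w1 [rw1 min1]].
have := epsilon_spec (inhabits [::]) (reduced_word (sigma_mu la mu)) (ex_intro _ w1 rw1).
set w := epsilon _ _ => -[vw Ew minw].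
have Emu : pact (word_perm w) la = mu by rewrite Ew.
split=> //; first exact/(wrow_eq w vmu).
case: rw1 => vw1 Ew1 _.
apply/eqP; rewrite eqn_leq -{1}sw0 (leq_trans (minw _ vw1 Ew1)) ?(min1 _ w0 mu0) //=.
by rewrite -sw0; apply: min.
Qed.

Section Hecke.
Variables (K : generic_pair) (F : Row -> {mpoly K[n]}).
Hypothesis Frel : natrel (orb 1) F.

(** In a word of length [asc] each letter creates one more ascending pair, so it swaps a strict
    descent and [natrel] applies without a factor. *)
Lemma foldr_hecke w : valid_word w -> size w = asc (wrow w) ->
  foldr (@ghecke K n) (F l0) w = F (wrow w).
Proof.
elim: w => //= i w IH /andP[Hi vw] sw; have := asc_swap (wrow w) Hi.
have le := asc_wrow_le vw; rewrite -sw => E.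
have sz : size w = asc (wrow w) by move: E; case: ltngtP => /=; lia.
rewrite IH //; have [R _] := Frel Hi (orb_wrow w); apply: R.
by move: E; rewrite -sz; case: ltngtP => //=; lia.
Qed.

End Hecke.
End Words.

(** * The symmetric sum *)

Section InterpolationUniqueness.
Variables (K : generic_pair) (n : nat).
Implicit Types (f g : {mpoly K[n]}) (la mu nu : 'X_{1..n}).

(** The combination of [f] and [g] that vanishes at [la] too must be zero. In this way uniqueness
    does not presuppose that a monic solution is nonzero at its own point. *)
Lemma monic_interp_uniq la f g (Van : {mpoly K[n]} -> Prop) :
  (forall h, (msize h <= (mdeg la).+1)%N -> Van h -> h.@[pt 1 la] = 0 -> h = 0) ->
  (forall a b, Van (a *: f - b *: g)) ->
  Van g -> (msize f <= (mdeg la).+1)%N -> (msize g <= (mdeg la).+1)%N ->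
  f@_la = 1 -> g@_la = 1 -> f = g.
Proof.
move=> U Vab Vg sf sg fl gl; set a := g.@[pt 1 la]; set b := f.@[pt 1 la].
have E : a *: f - b *: g = 0.
  apply: U => //; last by rewrite mevalB !mevalZ mulrC subrr.
  apply: leq_trans (msizeD_le _ _) _.
  by rewrite geq_max msizeN !(leq_trans (msizeZ_le _ _)).
have ab : a = b.
  have := congr1 (mcoeff la) E; rewrite mcoeffB !mcoeffZ fl gl mcoeff0 !mulr1.
  by move/eqP; rewrite subr_eq0 => /eqP.
have a0 : a != 0.
  apply/eqP => a0; have := U g sg Vg a0 => g0.
  by move/eqP: gl; rewrite g0 mcoeff0 eq_sym oner_eq0.
move/eqP: E; rewrite -ab -scalerBr scaler_eq0 (negPf a0) subr_eq0.
by move/eqP.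
Qed.

Lemma mnm_sort_ind (P : 'X_{1..n} -> Prop) : (forall mu, is_partition mu -> P mu) ->
  (forall (i : 'I_n) mu, (i.+1 < n)%N -> (mu i < mu (nxt i))%N -> P (mswap i mu) -> P mu) ->
  forall mu, P mu.
Proof.
move=> P0 PS mu; have [N] := ubnP (\sum_(j < n) j * mu j)%N.
elim: N mu => // N IH mu HN.
case: (boolP [exists i : 'I_n, (i.+1 < n)%N && (mu i < mu (nxt i))%N]).
  case/existsP => i /andP[Hi lt]; apply: (PS i) => //; apply: IH.
  under eq_bigr do rewrite mnmE.
  exact: leq_trans (sum_swap_lt Hi lt) HN.
rewrite negb_exists => /forallP H; apply: P0 => i j ij.
have [k Ek] : exists k, (j : nat) = (i + k)%N by exists (j - i)%N; rewrite subnKC.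
elim: k j ij Ek => [|k IHk] j ij Ek.
  by rewrite (_ : j = i) //; apply: ord_inj; rewrite Ek addn0.
have jn := ltn_ord j; have kn : (i + k < n)%N by lia.
have Hk : ((Ordinal kn).+1 < n)%N by rewrite /= -addnS -Ek.
have Ej : j = nxt (Ordinal kn) by apply: ord_inj; rewrite (val_nxt Hk) Ek addnS.
have := H (Ordinal kn); rewrite Hk /= -leqNgt -Ej => h.
by apply: leq_trans h _; apply: IHk => /=; lia.
Qed.

(** Swapping distinct adjacent parts swaps coordinates of the spectral point, so a symmetric
    polynomial has the same value at all rearrangements. *)
Lemma symmetric_interp_uniq d f : f \is mpoly.symmetric -> (msize f <= d.+1)%N ->
  (forall nu, is_partition nu -> (mdeg nu <= d)%N -> f.@[pt 1 nu] = 0) -> f = 0.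
Proof.
move=> sf szf fv; apply: (interp_uniq (oner_neq0 K) szf) => mu.
move: mu; apply: mnm_sort_ind => [mu pmu dmu|i mu Hi lt IH dmu]; first exact: fv.
have ne : mswap i mu i != mswap i mu (nxt i) by rewrite !mnmE sgenL sgenR gtn_eqF.
have Es : msym (sgen i) f = f by apply/issymP.
have := meval_mswap Hi 1 f ne; rewrite mswapK // => <-.
by rewrite -meval_msym Es IH // mdeg_mswap.
Qed.

Definition interp_van la f := forall nu,
  (mdeg nu <= mdeg la)%N -> nu <> la -> f.@[pt 1 nu] = 0.

Lemma interp_van_uniq la f g : (msize f <= (mdeg la).+1)%N -> (msize g <= (mdeg la).+1)%N ->
  f@_la = 1 -> g@_la = 1 -> interp_van la f -> interp_van la g -> f = g.
Proof.
move=> sf sg fl gl Vf Vg; apply: (@monic_interp_uniq la f g (interp_van la)) => //.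
  move=> h sh Vh h0; apply: (interp_uniq (oner_neq0 K) sh) => nu dn.
  by case: (eqVneq nu la) => [->//|/eqP ne]; apply: Vh.
by move=> a b nu dn ne; rewrite mevalB !mevalZ Vf // Vg // !mulr0 subrr.
Qed.

Definition sym_interp_van la f := f \is mpoly.symmetric /\
  forall nu, is_partition nu -> nu <> la -> (mdeg nu <= mdeg la)%N -> f.@[pt 1 nu] = 0.

Lemma sym_interp_van_uniq la f g : (msize f <= (mdeg la).+1)%N ->
  (msize g <= (mdeg la).+1)%N -> f@_la = 1 -> g@_la = 1 ->
  sym_interp_van la f -> sym_interp_van la g -> f = g.
Proof.
move=> sf sg fl gl [yf Vf] [yg Vg].
apply: (@monic_interp_uniq la f g (sym_interp_van la)) => //.
  move=> h sh [yh Vh] h0; apply: (symmetric_interp_uniq yh sh) => nu pn dn.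
  by case: (eqVneq nu la) => [->//|/eqP ne]; apply: Vh.
move=> a b; split; last by move=> nu pn ne dn; rewrite mevalB !mevalZ Vf // Vg // !mulr0 subrr.
apply/issymP => s; rewrite raddfB /= !linearZ /=.
by rewrite (issymP _ yf) (issymP _ yg).
Qed.

End InterpolationUniqueness.

Section SymmetricSum.
Variables (K : generic_pair) (n L : nat) (la : 'X_{1..n.+1}).
Hypothesis laL : forall j, (la j <= L)%N.
Hypothesis part : forall i j : 'I_n.+1, (i <= j)%N -> (la j <= la i)%N.
Local Notation tt := (gt K).
Local Notation Row := {ffun 'I_n.+1 -> 'I_L.+1}.
Local Notation MP := {mpoly K[n.+1]}.
Local Notation T := (@ghecke K n.+1).
Local Notation orb m := (@orb n.+1 L la m).
Local Notation l0 := (@lrow n.+1 L la 1).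
Local Notation F := (@Fdown K n L la L).
Implicit Types (v : Row).

Definition Zsum : MP := \sum_(v | orb 1 v) F v.

Lemma hecke_Zsum (i : 'I_n.+1) : (i.+1 < n.+1)%N -> T i Zsum = tt *: Zsum.
Proof.
move=> Hi; have Frel := good_rel (good_F K laL part); have HO := orb_swap la 1 (L := L).
pose al v : K := if (v (nxt i) < v i)%N then 0 else
  if (v i < v (nxt i))%N then tt - 1 else tt.
pose be v : K := if (v (nxt i) < v i)%N then 1 else
  if (v i < v (nxt i))%N then tt else 0.
rewrite /Zsum hecke_sum // (eq_bigr (fun v => al v *: F v
    + be (rswap i (rswap i v)) *: F (rswap i v))); last first.
  move=> v Ov; rewrite rswapK /al /be; case: ltngtP => H.
  - by rewrite scale0r add0r scale1r (proj1 (Frel _ Hi _ Ov) H).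
  - by rewrite (natrel_lt HO Frel Hi Ov H).
  - by rewrite (proj2 (Frel _ Hi _ Ov) (esym H)) scale0r addr0.
rewrite big_split /= (reindex_swap HO i (fun v => be (rswap i v) *: F v)) -big_split /=.
rewrite scaler_sumr; apply: eq_bigr => v Ov; rewrite -scalerDl; congr (_ *: _).
rewrite /al /be rswapL rswapR; case: (ltngtP (v i) (v (nxt i))) => H.
- by rewrite subrK.
- by rewrite add0r.
- by rewrite addr0.
Qed.

(** The relation [T_i Z = t Z] says [(t x_i - x_(i+1)) (Z - s_i Z) = 0]. *)
Lemma Zsum_sgen (i : 'I_n.+1) : (i.+1 < n.+1)%N -> msym (sgen i) Zsum = Zsum.
Proof.
move=> Hi; have := heckeP i Zsum; rewrite hecke_Zsum // /is_ghecke -scalerAr => /eqP.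
rewrite eq_sym -subr_eq0 addrAC subrr add0r oppr_eq0 mulf_eq0 => /orP[|].
  have ne := nxt_neq Hi; rewrite -mul_mpolyC => /eqP/(congr1 (fun f => f@_U_(nxt i))).
  rewrite mcoeffB mcoeffCM !mcoeffXU eqxx (negPf ne) mulr0 mcoeff0 sub0r => /eqP.
  by rewrite oppr_eq0 oner_eq0.
by rewrite subr_eq0 => /eqP.
Qed.

(** Rearrangements of [la] are closed under swaps, so each [T_i] keeps the vanishing off this set,
    starting from [Fl_van]. *)
Lemma Zsum_van (mu : 'X_{1..n.+1}) : (mdeg mu <= mdeg la)%N ->
  (forall v, orb 1 v -> exists j, v j != mu j :> nat) -> Zsum.@[pt 1 mu] = 0.
Proof.
move=> dmu off; rewrite raddf_sum big1 // => v Ov.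
pose P v := forall nu : 'X_{1..n.+1}, (mdeg nu <= mdeg la)%N ->
  (forall w, orb 1 w -> exists j, w j != nu j :> nat) -> (F v).@[pt 1 nu] = 0.
suff : P v by apply.
apply: (orb_ind laL part (P := P) _ _ Ov) => [nu dnu offn|i w Hi Ow lt IH nu dnu offn].
  apply: Fl_van => // E; have [j] := offn _ (orb_lrow laL 1).
  by rewrite E val_lrow1 ?eqxx.
have [R _] := good_rel (good_F K laL part) Hi Ow; rewrite -(R lt).
case: (eqVneq (nu i) (nu (nxt i))) => En.
  by rewrite hecke_pt_eq ?oner_neq0 // IH // mulr0.
apply: (mulfI (tilde_sub_neq0 K Hi nu)).
rewrite hecke_pt_neq ?oner_neq0 // !IH ?mdeg_mswap ?mulr0 ?addr0 // => w' Ow'.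
have [|j Hj] := offn (rswap i w'); first by rewrite orb_swap.
by exists (sgen i j); move: Hj; rewrite ffunE mnmE sgenK.
Qed.

Lemma Zsum_size : (msize Zsum <= (mdeg la).+1)%N.
Proof.
apply: msize_sum_le => v Ov.
by have := good_size (good_F K laL part) Ov; rewrite ladeg0.
Qed.

Lemma Zsum_lead : Zsum@_la = 1.
Proof.
rewrite /Zsum raddf_sum (bigD1 l0) ?orb_lrow //= big1 => [|v /andP[Ov /negPf ne]].
  by have := good_lead (good_F K laL part) (orb_lrow laL 1); rewrite lasub0 eqxx addr0.
by have := good_lead (good_F K laL part) Ov; rewrite lasub0 ne.
Qed.

End SymmetricSum.

Section AdjacentGeneration.
Variables (K : generic_pair) (n : nat).

(** The staircase has distinct parts, so a permutation is determined by its effect on it;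
    [word_exists] supplies a word with that effect. *)
Lemma perm_word (s : 'S_n) : exists w, valid_word w /\ word_perm w = s.
Proof.
pose la : 'X_{1..n} := [multinom (n - j)%N | j < n].
have laL j : (la j <= n)%N by rewrite mnmE leq_subr.
have part (i j : 'I_n) : (i <= j)%N -> (la j <= la i)%N.
  by rewrite !mnmE => ij; apply: leq_sub2l.
pose v : {ffun 'I_n -> 'I_n.+1} := [ffun j => lrow n la 1 ((s^-1)%g j)].
have Ov : orb la 1 v.
  rewrite (@orb_perm _ _ la 1 (lrow n la 1) v (fun j => (s^-1)%g j)) ?orb_lrow //.
    exact: perm_inj.
  by move=> j; rewrite ffunE.
have [w [vw Ew _]] := word_exists laL part Ov; exists w; split=> //.
apply/invg_inj/permP => j; have := congr1 (fun v : {ffun 'I_n -> 'I_n.+1} => v j : nat) Ew.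
rewrite wrowE // mnmE ffunE val_l0 // !mnmE => E.
apply: ord_inj; rewrite -[LHS](@subKn _ n); last exact/ltnW/ltn_ord.
by rewrite E subKn //; apply/ltnW/ltn_ord.
Qed.

Lemma symmetric_sgen (f : {mpoly K[n]}) :
  (forall i : 'I_n, (i.+1 < n)%N -> msym (sgen i) f = f) -> f \is mpoly.symmetric.
Proof.
move=> H; apply/issymP => s; have [w [vw <-]] := perm_word s.
elim: w vw => [|i w IH] /=; first by rewrite msym1m.
by case/andP=> Hi vw; rewrite msymMm IH // H.
Qed.

End AdjacentGeneration.

(** * Signed multiline queues row by row *)

Section Chains.
Variables (R : comNzRingType) (Y : finType) (U : nat -> Y -> Y -> R).

(** Transfer form of a sum over stacks of levels; [p] stands in for the level below the lowest
    one. *)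
Fixpoint chain (d s : nat) (p : Y) : R :=
  if d is d'.+1 then \sum_y U s p y * chain d' s.+1 y else 1.

Lemma val_opred (k : nat) (r : 'I_k) : (opred r = r.-1 :> nat).
Proof. by rewrite val_insubd (leq_ltn_trans (leq_pred _)). Qed.

Lemma chainE d s p :
  \sum_(y : {ffun 'I_d -> Y})
    \prod_(r < d) U (s + r) (if r == 0%N :> nat then p else y (opred r)) (y r)
  = chain d s p.
Proof.
elim: d s p => [|d IH] s p.
  rewrite (eq_bigr (fun=> 1)) => [|y _]; last by rewrite big_ord0.
  by rewrite sumr_const card_ffun card_ord expn0.
pose J (k : Y * {ffun 'I_d -> Y}) : {ffun 'I_d.+1 -> Y} :=
  [ffun r => if unlift ord0 r is Some j then k.2 j else k.1].
have J0 k : J k ord0 = k.1 by rewrite ffunE unlift_none.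
have JS k j : J k (lift ord0 j) = k.2 j by rewrite ffunE liftK.
rewrite (reindex J) /=; last first.
  exists (fun y => (y ord0, [ffun j => y (lift ord0 j)])) => [[y0 y']|y] _ /=.
    by rewrite J0; congr (_, _); apply/ffunP => j; rewrite ffunE JS.
  apply/ffunP => r; case: (unliftP ord0 r) => [j ->|->]; first by rewrite JS ffunE.
  by rewrite J0.
rewrite -(pair_bigA _ (fun y0 y' => \prod_(r < d.+1) U (s + r)
  (if r == 0%N :> nat then p else J (y0, y') (opred r)) (J (y0, y') r))) /=.
apply: eq_bigr => y0 _; rewrite -IH mulr_sumr; apply: eq_bigr => y' _.
rewrite big_ord_recl /= addn0 J0; congr (_ * _); apply: eq_bigr => j _.
rewrite JS /bump /= addnA addn1; congr (U _ _ _).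
case: (posnP j) => j0.
  by rewrite ?j0 ?eqxx (_ : opred _ = ord0) ?J0 //; apply: ord_inj; rewrite val_opred /= j0.
rewrite ?gtn_eqF // (_ : opred (lift ord0 j) = lift ord0 (opred j)) ?JS //.
by apply: ord_inj; rewrite /= !val_opred /bump /= !add1n prednK.
Qed.

End Chains.

Lemma prod_forall (R : comNzRingType) (I : finType) (P : pred I) (w : I -> R) :
  (if [forall r, P r] then \prod_r w r else 0) = \prod_r (if P r then w r else 0).
Proof.
case: ifP => [/forallP H|/negbT]; first by apply: eq_bigr => r _; rewrite H.
by rewrite negb_forall => /existsP[r /negPf Pr]; rewrite (bigD1 r) //= Pr mul0r.
Qed.

Section Levels.
Variables (K : generic_pair) (n L : nat) (la : 'X_{1..n}).
Local Notation qq := (gq K).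
Local Notation tt := (gt K).
Local Notation Row := {ffun 'I_n -> 'I_L.+1}.
Local Notation SRow := {ffun 'I_n -> 'I_L.+1 * bool}.
Local Notation PP := {ffun 'I_n -> 'I_n}.
Local Notation MP := {mpoly K[n]}.
Local Notation orb m := (@orb n L la m).
Implicit Types (v k : Row) (S : SRow) (p : PP).

Definition srv S : 'I_n -> nat := fun j => (S j).1.
Definition srg S : {ffun 'I_n -> bool} := [ffun j => (S j).2].
Definition absrow S : Row := [ffun j => (S j).1].

Definition swt (s : nat) v S p : MP :=
  if [&& orb s.+1 v, orb s.+1 (absrow S), [forall j, (srv S j == 0%N) ==> srg S j]
       & srow_ok (rv v) (srv S) (srg S) p]
  then (\prod_(j | srv S j != 0%N)
          (if srg S j then 'X_j else (- (qq ^+ s / tt ^+ n.-1))%:MP))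
    * \prod_(j | (srv S j != 0%N) && (p j != j)) (srow K (rv v) (srv S) (srg S j) p j)%:MP
  else 0.

(** No classic layer lies below row 1. Its slot carries the boundary condition that row 1 is [mu]
    and that the dummy pairing is the identity. *)
Definition cwt (mu : 'X_{1..n}) (s : nat) S v p : MP :=
  if s == 0%N then ([forall j, p j == j] && [forall j, v j == mu j :> nat])%:R
  else if crow_ok (srv S) (rv v) p then
    (\prod_(j | (rv v j != 0%N) && (p j != j)) crow K (srv S) (rv v) s p j)%:MP
  else 0.

Definition level mu s (a b : Row * SRow * PP * PP) : MP :=
  swt s b.1.1.1 b.1.1.2 b.1.2 * cwt mu s a.1.1.2 b.1.1.1 b.2.

Lemma absrowE S : rv (absrow S) = srv S.
Proof. by apply: functional_extensionality => j; rewrite /rv ffunE. Qed.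

Lemma sum_SRow (G : SRow -> MP) : \sum_S G S
  = \sum_(k : Row) \sum_(e : {ffun 'I_n -> bool}) G [ffun j => (k j, e j)].
Proof.
rewrite pair_bigA /= (reindex (fun x : Row * {ffun 'I_n -> bool} =>
  [ffun j => (x.1 j, x.2 j)] : SRow)) //.
exists (fun S => (absrow S, srg S)) => [[k e]|S] _.
  by congr (_, _); apply/ffunP => j; rewrite !ffunE.
by apply/ffunP => j; rewrite !ffunE /=; case: (S j).
Qed.

Hypothesis laL : forall j, (la j <= L)%N.

Lemma orb_cardrv (r : nat) v k a : orb r v -> orb r k ->
  #|[set j | rv v j == a]| = #|[set j | rv k j == a]|.
Proof.
move=> Ov Ok; rewrite /rv (orb_card laL Ov (fun x => x == a)).
by rewrite (orb_card laL Ok (fun x => x == a)).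
Qed.

Lemma sum_swt s v (h : Row -> MP) : orb s.+1 v ->
  \sum_S \sum_p swt s v S p * h (absrow S)
  = \sum_(k | orb s.+1 k) Smat (qq ^+ s / tt ^+ n.-1) L.+1 (rv v) (rv k) * h k.
Proof.
move=> Ov; rewrite sum_SRow [RHS]big_mkcond; apply: eq_bigr => k _.
pose J (e : {ffun 'I_n -> bool}) : SRow := [ffun j => (k j, e j)].
have aJ e : absrow (J e) = k by apply/ffunP => j; rewrite !ffunE.
have vJ e : srv (J e) = rv k by rewrite -absrowE aJ.
have gJ e : srg (J e) = e by apply/ffunP => j; rewrite !ffunE.
under eq_bigr => e _ do rewrite -/(J e) aJ -mulr_suml.
rewrite -mulr_suml; case: ifP => Ok; last first.
  rewrite big1 ?mul0r // => e _; rewrite big1 // => p _.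
  by rewrite /swt aJ Ok andbF.
congr (_ * h k); rewrite /Smat -ssumE => [|a _|j]; last exact: ltn_ord; last first.
  exact: (orb_cardrv a Ov Ok).
rewrite /ssum [RHS]big_mkcond; apply: eq_bigr => e _; rewrite /swt aJ vJ gJ Ov Ok /=.
case: ifP => He; last by rewrite big1.
by rewrite [RHS]big_mkcond.
Qed.

Lemma sum_cwt mu s S v : orb s.+1 (absrow S) -> orb s.+2 v ->
  \sum_p cwt mu s.+1 S v p = (Cmat K s.+1 s.+2 L.+1 (srv S) (rv v))%:MP.
Proof.
move=> OS Ov; rewrite /cwt /= -big_mkcond -rmorph_sum /=; congr (_%:MP).
rewrite -[LHS]/(csum K (srv S) (rv v) s.+1) (@csumE _ _ _ _ _ s.+2 L.+1) // => [j|a ha].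
  by case: (orb_range laL Ov j) => [E|//]; rewrite /rv E.
rewrite -absrowE /rv (orb_card laL OS (fun x => x == a)).
rewrite (orb_card laL Ov (fun x => x == a)); apply: eq_card => j; rewrite !inE.
by rewrite !val_lrow //; case: ifP; case: ifP; lia.
Qed.

(** The levels above see only the absolute labels of the signed row, so signs and pairings of one
    level can be summed out, leaving layer matrices. *)
Lemma sum_level mu s a (h : Row -> MP) (H : Row * SRow * PP * PP -> MP) :
  (forall b, orb s.+1 (absrow b.1.1.2) -> H b = h (absrow b.1.1.2)) ->
  \sum_b level mu s a b * H b
  = \sum_(v | orb s.+1 v) (\sum_p cwt mu s a.1.1.2 v p)
     * \sum_(k | orb s.+1 k) Smat (qq ^+ s / tt ^+ n.-1) L.+1 (rv v) (rv k) * h k.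
Proof.
move=> Hh.
have E b : level mu s a b * H b
    = swt s b.1.1.1 b.1.1.2 b.1.2 * h (absrow b.1.1.2) * cwt mu s a.1.1.2 b.1.1.1 b.2.
  rewrite /level mulrAC; congr (_ * _); case: (boolP (orb s.+1 (absrow b.1.1.2))) => Ob.
    by rewrite Hh.
  by rewrite /swt (negPf Ob) andbF !mul0r.
rewrite (eq_bigr _ (fun b _ => E b)).
rewrite -(pair_bigA _ (fun x p => swt s x.1.1 x.1.2 x.2 * h (absrow x.1.2)
  * cwt mu s a.1.1.2 x.1.1 p)) /=.
under eq_bigr => x _ do rewrite -mulr_sumr.
rewrite -(pair_bigA _ (fun x q => swt s x.1 x.2 q * h (absrow x.2)
  * \sum_p cwt mu s a.1.1.2 x.1 p)) /=.
rewrite -(pair_bigA _ (fun v S => \sum_q swt s v S q * h (absrow S)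
  * \sum_p cwt mu s a.1.1.2 v p)) /=.
rewrite [RHS]big_mkcond; apply: eq_bigr => v _; case: ifP => Ov; last first.
  rewrite big1 // => S _; rewrite big1 // => q _.
  by rewrite /swt Ov !mul0r.
rewrite -(sum_swt h Ov) mulr_sumr; apply: eq_bigr => S _.
by rewrite mulr_sumr; apply: eq_bigr => q _; rewrite mulrC.
Qed.

End Levels.

Section ChainSum.
Variables (K : generic_pair) (n L : nat) (la mu : 'X_{1..n.+1}).
Hypothesis laL : forall j, (la j <= L)%N.
Local Notation Row := {ffun 'I_n.+1 -> 'I_L.+1}.
Local Notation orb m := (@orb n.+1 L la m).
Local Notation lrow m := (@lrow n.+1 L la m).
Local Notation Fd := (@Fdown K n L la).
Local Notation ch := (chain (@level K n.+1 L la mu)).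

Lemma orb_top v : orb L.+1 v -> v = lrow L.+1.
Proof.
have z w : orb L.+1 w -> forall j, w j = 0%N :> nat.
  by move=> Ow j; case: (orb_range laL Ow j) => // H; move: (ltn_ord (w j)); lia.
by move=> Ov; apply/ffunP => j; apply: ord_inj; rewrite !z // orb_lrow.
Qed.

Lemma chain_hrow d m a : (d + m.+1 = L)%N -> orb m.+1 (absrow a.1.1.2) ->
  ch d m.+1 a = hrow la m (Fd d) (absrow a.1.1.2).
Proof.
elim: d m a => [|d IH] m a dm Oa; rewrite /hrow /hfam.
  rewrite add0n in dm; have Om : m.+2 = L.+1 by rewrite dm.
  rewrite (big_pred1 (lrow L.+1)) => [|v]; last first.
    rewrite Om; apply/idP/eqP => [|->]; [exact: orb_top|exact: orb_lrow].
  by rewrite /Cmat Om big_geq // scale1r.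
have dm' : (d + m.+2 = L)%N by rewrite -dm addSnnS.
rewrite [LHS]/= (@sum_level K n.+1 L la laL mu m.+1 a (hrow la m.+1 (Fd d))) => [|b Ob]; last exact: IH.
apply: eq_bigr => v Ov; rewrite (sum_cwt K laL mu Oa Ov) absrowE mul_mpolyC.
congr (_ *: _); rewrite (_ : Fd d.+1 = step la m.+1 (Fd d)) //=.
by congr (step _ _ _); rewrite -dm addSn; clear; lia.
Qed.

Lemma chain_Fdown d a (v : Row) : d = L -> orb 1 v -> (forall j, v j = mu j :> nat) ->
  ch d 0 a = Fd d v.
Proof.
case: d => [|d] dL Ov vmu //.
rewrite [LHS]/= (@sum_level K n.+1 L la laL mu 0 a (hrow la 0 (Fd d))) => [|b Ob];
  last by apply: chain_hrow; rewrite // addn1.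
have Ev w : (w == v) = [forall j, w j == mu j :> nat].
  apply/eqP/forallP => [-> j|H]; first by rewrite vmu.
  by apply/ffunP => j; apply: ord_inj; rewrite vmu; apply/eqP.
rewrite (bigD1 v) //= [X in _ + X]big1 ?addr0 => [|w /andP[_ ne]]; last first.
  by rewrite big1 ?mul0r // => p _; rewrite /cwt /= -Ev (negPf ne) andbF.
rewrite (bigD1 [ffun j => j]) //= [X in (_ + X) * _]big1 ?addr0 => [|p ne]; last first.
  rewrite /cwt /=; case: forallP => //= H; case/eqP: ne.
  by apply/ffunP => j; rewrite ffunE; apply/eqP.
rewrite /cwt /= -Ev eqxx andbT (_ : [forall j, _]) ?mul1r; last first.
  by apply/forallP => j; rewrite ffunE.
have -> : (L - d.+1 = 0)%N by move: dL; clear; lia.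
by rewrite /step /Ffam expr0 mul1r.
Qed.

End ChainSum.

(** * Return to rational functions in [q] and [t] and to whole queues *)

Section RationalFunctions.

Lemma qt_inj (a b c d : nat) : qq ^+ a * tt ^+ b = qq ^+ c * tt ^+ d -> a = c /\ b = d.
Proof.
rewrite /qq /tt -!tofracXn -!tofracM => /eqP; rewrite tofrac_eq => /eqP E.
have C (x y k : nat) : ('X%:P ^+ x * 'X ^+ y : {poly {poly rat}})`_k
    = if k == y then 'X^x else 0.
  by rewrite -rmorphXn /= coefCM coefXn; case: eqP; rewrite ?mulr1 ?mulr0.
have X0 (x : nat) : 'X^x != 0 :> {poly rat} by rewrite -size_poly_eq0 size_polyXn.
have := congr1 (fun p : {poly {poly rat}} => p`_b) E; rewrite !C eqxx.
case: eqP => [-> Ex|_ Ex]; last by have := X0 a; rewrite Ex eqxx.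
by have := congr1 (fun p : {poly rat} => size p) Ex; rewrite !size_polyXn => -[->].
Qed.

Definition KQ : generic_pair := GenericPair qt_inj.

Variables (n : nat) (la mu : 'X_{1..n}).
Local Notation L := (maxpart la).
Local Notation Row := {ffun 'I_n -> 'I_L.+1}.
Local Notation SRow := {ffun 'I_n -> 'I_L.+1 * bool}.
Local Notation PP := {ffun 'I_n -> 'I_n}.
Local Notation lev := (@level KQ n L la mu).

Definition qlevel (Q : qdata n L) (r : 'I_L) : Row * SRow * PP * PP :=
  (Q.1.1.1 r, Q.1.1.2 r, Q.1.2 r, Q.2 r).

Lemma forall_and4 (I : finType) (P1 P2 P3 P4 : pred I) :
  [&& [forall r, P1 r], [forall r, P2 r], [forall r, P3 r] & [forall r, P4 r]]
  = [forall r, [&& P1 r, P2 r, P3 r & P4 r]].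
Proof.
apply/and4P/forallP => [[/forallP h1 /forallP h2 /forallP h3 /forallP h4] r|H].
  by rewrite h1 h2 h3 h4.
by split; apply/forallP => r; have /and4P[] := H r.
Qed.

Lemma level_bool0 (R : comNzRingType) (b1 b2 b3 b4 b5 b6 : bool) (x : R) :
  (if [&& [&& b1, b2 & b3], b4, b5 & b6] then x else 0)
  = (if [&& b1, b2, b3 & b5] then x else 0) * (b6 && b4)%:R.
Proof.
by case: b1; case: b2; case: b3; case: b4; case: b5; case: b6;
  rewrite /= ?mulr1 ?mulr0.
Qed.

Lemma level_bool1 (R : comNzRingType) (b1 b2 b3 b4 b5 : bool) (x y : R) :
  (if [&& [&& b1, b2 & b3], b4 & b5] then x * y else 0)
  = (if [&& b1, b2, b3 & b4] then x else 0) * (if b5 then y else 0).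
Proof.
by case: b1; case: b2; case: b3; case: b4; case: b5; rewrite /= ?mul0r ?mulr0.
Qed.

(** All conditions and weights concern one row, its signed row and the signed labels just below, so
    validity and weight factor together over the levels. *)
Lemma smlq_weight (Q : qdata n L) :
  (if is_smlq la mu Q then wt Q else 0) = \prod_(r < L) lev r (qlevel Q (opred r)) (qlevel Q r).
Proof.
rewrite /is_smlq /ball_ok /row1_ok /signed_ok /classic_ok forall_and4.
rewrite /wt /ballwt [X in _ * X]big_mkcond -!big_split /= prod_forall.
apply: eq_bigr => r _; rewrite /level /swt /cwt /=.
set v := Q.1.1.1 r; set S := Q.1.1.2 r.
have e1 : orb la r.+1 (absrow S) = perm_eq [seq sab Q r j | j <- enum 'I_n] (lamr la r.+1).
  by rewrite /orb; congr perm_eq; apply: eq_map => j; rewrite ffunE.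
have e2 : [forall j, (srv S j == 0%N) ==> srg S j]
    = [forall j, (sab Q r j == 0%N) ==> spos Q r j].
  by apply: eq_forallb => j; rewrite ffunE.
have e3 : srow_ok (rv v) (srv S) (srg S) (Q.1.2 r) = 
   [forall j : 'I_n,
      if sab Q r j == 0%N then ps Q r j == j else
      [&& reg Q r (ps Q r j) == sab Q r j,
          (j <= ps Q r j)%N &
          if spos Q r j then
            (sab Q r j <= reg Q r j)%N
            && ((reg Q r j == sab Q r j) ==> (ps Q r j == j))
          else (reg Q r j <= sab Q r j)%N]]
    && [forall j1 : 'I_n, forall j2 : 'I_n,
          [&& sab Q r j1 != 0%N, sab Q r j2 != 0%N & ps Q r j1 == ps Q r j2]
          ==> (j1 == j2)].
  by rewrite /srow_ok; congr (_ && _); apply: eq_forallb => j; rewrite ffunE.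
rewrite e1 e2 e3 {e1 e2 e3}.
set A1 := perm_eq _ _; have -> : orb la r.+1 v = A1 by [].
set A2 := perm_eq _ _; set A3 := [forall j, _ ==> spos Q r j].
set B1 := \prod_(j | sab Q r j != 0%N) _; set B2 := \prod_(j | _ && (ps Q r j != j)) _.
set C1 := \prod_(j | srv S j != 0%N) _; set C2 := \prod_(j | _ && (Q.1.2 r j != j)) _.
have -> : C1 = B1 by apply: eq_bigr => j _; rewrite ffunE.
have -> : C2 = B2 by apply: eq_bigr => j _; rewrite ffunE.
case: (eqVneq (r : nat) 0%N) => [r0|r0] /=.
  rewrite mulr1.
  exact: level_bool0.
rewrite rmorph_prod /=.
exact: level_bool1.
Qed.

Lemma FstarE a : Fstar la mu = chain lev L 0 a.
Proof.
rewrite -chainE /Fstar big_mkcond (eq_bigr _ (fun Q _ => smlq_weight Q)).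
pose D (y : {ffun 'I_L -> Row * SRow * PP * PP}) : qdata n L :=
  ([ffun r => (y r).1.1.1], [ffun r => (y r).1.1.2], [ffun r => (y r).1.2], [ffun r => (y r).2]).
have qD y r : qlevel (D y) r = y r.
  by rewrite /qlevel /D !ffunE /=; case: (y r) => -[[? ?] ?] ?.
rewrite (reindex D) /=; last first.
  exists (fun Q => [ffun r => qlevel Q r]) => [y|Q] _.
    by apply/ffunP => r; rewrite ffunE qD.
  case: Q => -[[q1 q2] q3] q4; rewrite /D; congr (_, _, _, _); apply/ffunP => r;
    by rewrite !ffunE.
apply: eq_bigr => y _; apply: eq_bigr => r _; rewrite !qD.
(* At the lowest level [cwt] does not look at its predecessor, so the level itself, which [opred]
   returns there, may be replaced by [a]. *)
by case: (eqVneq (r : nat) 0%N) => // r0; rewrite /level /cwt r0.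
Qed.

End RationalFunctions.

(** * Identification with the interpolation polynomials *)

Section PositiveRank.
Variables (n : nat) (la : 'X_{1..n.+1}).
Hypothesis part : is_partition la.
Local Notation L := (maxpart la).
Local Notation Row := {ffun 'I_n.+1 -> 'I_L.+1}.
Local Notation F := (@Fdown KQ n L la L).
Local Notation l0 := (@lrow n.+1 L la 1).
Implicit Types (v : Row) (mu nu : 'X_{1..n.+1}) (h : {mpoly KQ[n.+1]}).

Lemma maxpart_ge j : (la j <= L)%N.
Proof. exact: leq_bigmax. Qed.
Local Notation laL := maxpart_ge.

Lemma meval_tilde nu h : h.@[tilde nu] = h.@[pt 1 nu].
Proof. by apply: meval_eq => i; rewrite pt1. Qed.

Lemma Estar_lrow : Estar la = F l0.
Proof.
have Fl : is_Estar la (F l0).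
  split; [exact: (Fl_size KQ laL part)|exact: (Fl_lead KQ laL part)|move=> nu dn ne].
  by rewrite (meval_tilde nu (F l0)); exact (@Fl_van KQ n L la laL part nu dn ne).
have [sE lE vE] : is_Estar la (Estar la) by apply: epsilon_spec; exists (F l0).
have [sF lF vF] := Fl.
apply: (@interp_van_uniq KQ n.+1 la (Estar la) (F l0) sE sF lE lF) => nu dn ne.
  by rewrite -meval_tilde; apply: vE.
by rewrite -meval_tilde; apply: vF.
Qed.

Lemma pact_row s mu : pact s la = mu -> exists v, orb la 1 v /\ forall j, v j = mu j :> nat.
Proof.
move=> <-; pose v : Row := [ffun j => l0 ((s^-1)%g j)].
exists v; split=> [|j]; last by rewrite ffunE val_l0 ?mnmE //; apply: laL.
rewrite (@orb_perm _ _ la 1 l0 v (fun j => (s^-1)%g j)) ?orb_lrow //.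
- exact: laL.
- exact: perm_inj.
- by move=> j; rewrite ffunE.
Qed.

Lemma Fstar_row v mu : orb la 1 v -> (forall j, v j = mu j :> nat) -> Fstar la mu = F v.
Proof.
move=> Ov vmu; pose a : Row * {ffun 'I_n.+1 -> 'I_L.+1 * bool}
  * {ffun 'I_n.+1 -> 'I_n.+1} * {ffun 'I_n.+1 -> 'I_n.+1} :=
  (v, [ffun j => (v j, true)], [ffun j => j], [ffun j => j]).
by rewrite (FstarE mu a) (@chain_Fdown KQ n L la mu laL L a v).
Qed.

Lemma fstar_row v mu : orb la 1 v -> (forall j, v j = mu j :> nat) -> fstar la mu = F v.
Proof.
move=> Ov vmu; have /= [vw Ew sw] := reduced_sigma laL part Ov vmu.
rewrite /fstar /heckeT Estar_lrow -[RHS](congr1 F Ew).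
have E := @foldr_hecke n.+1 L la laL part KQ F (good_rel (good_F KQ laL part)) _ vw.
by apply: E; rewrite Ew.
Qed.

Lemma Zstar_sum : Zstar la = Zsum KQ L la.
Proof.
pose toM v : 'X_{1..n.+1} := [multinom (v j : nat) | j < n.+1].
rewrite /Zstar (perm_big [seq toM v | v <- enum (orb la 1 : pred Row)]) /=.
  rewrite big_map big_enum; apply: eq_bigr => v Ov.
  by apply: Fstar_row => // j; rewrite mnmE.
apply: uniq_perm => [||mu]; first exact: undup_uniq.
  rewrite map_inj_uniq ?enum_uniq // => v v' E; apply/ffunP => j; apply: ord_inj.
  by have := congr1 (fun m : 'X_{1..n.+1} => m j) E; rewrite !mnmE.
rewrite mem_undup; apply/mapP/mapP => [[s _ ->]|[v Ov ->]].
  have [v [Ov vE]] := pact_row (erefl (pact s la)).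
  by exists v; [rewrite mem_enum|apply/mnmP => j; rewrite [RHS]mnmE vE].
rewrite mem_enum in Ov; have [w [vw Ew _]] := word_exists laL part Ov.
exists (word_perm w); first by rewrite mem_enum.
by apply/mnmP => j; rewrite [LHS]mnmE -Ew (wrowE laL).
Qed.

Lemma Pstar_sum : Pstar la = Zsum KQ L la.
Proof.
have vZ nu : is_partition nu -> nu <> la -> (mdeg nu <= mdeg la)%N ->
    (Zsum KQ L la).@[pt 1 nu] = 0.
  move=> pn ne dn; apply: (@Zsum_van KQ n L la laL part nu dn) => v Ov.
  case: (pickP (fun j => v j != nu j :> nat)) => [j Hj|H]; first by exists j.
  have E j : v j = nu j :> nat by apply/eqP/negbFE/H.
  case: ne; apply/mnmP => j; rewrite -E (sorted_orbE laL part Ov) ?val_lrow1 //.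
    exact: laL.
  by move=> i Hi; rewrite !E; apply: pn; rewrite val_nxt.
have sZ : Zsum KQ L la \is mpoly.symmetric.
  by apply: symmetric_sgen => i Hi; apply: (Zsum_sgen KQ laL part).
have PZ : is_Pstar la (Zsum KQ L la).
  split=> //; [exact: (Zsum_size KQ laL part)|exact: (Zsum_lead KQ laL part)|].
  by move=> nu pn ne dn; rewrite (meval_tilde nu (Zsum KQ L la)); apply: vZ.
have [yP sP lP vP] : is_Pstar la (Pstar la) by apply: epsilon_spec; exists (Zsum KQ L la).
have [_ zZ lZ _] := PZ.
apply: (@sym_interp_van_uniq KQ n.+1 la (Pstar la) (Zsum KQ L la) sP zZ lP lZ); split=> //.
by move=> nu pn ne dn; rewrite -meval_tilde; apply: vP.
Qed.

End PositiveRank.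

(** * Rank zero, where there is no column to rotate and everything is 1 *)

Section RankZero.
Implicit Types (la mu : 'X_{1..0}).

Lemma mnm0_eq la mu : la = mu.
Proof. by apply/mnmP => -[]. Qed.

Lemma mpoly0_eq mu (f g : {mpoly QT[0]}) : f@_mu = g@_mu -> f = g.
Proof. by move=> E; apply/mpolyP => nu; rewrite (mnm0_eq nu mu). Qed.

Lemma mcoeff1_0 mu : (1 : {mpoly QT[0]})@_mu = 1.
Proof. by rewrite mcoeff1 (mnm0_eq mu 0%MM) eqxx. Qed.

Lemma Estar0 la : Estar la = 1.
Proof.
have [] : is_Estar la (Estar la).
  apply: epsilon_spec; exists 1; split; rewrite ?msize1 ?mcoeff1_0 // => nu _ [].
  exact: mnm0_eq.
by move=> _ E _; apply: (@mpoly0_eq la); rewrite E mcoeff1_0.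
Qed.

Lemma Pstar0 la : Pstar la = 1.
Proof.
have [] : is_Pstar la (Pstar la).
  apply: epsilon_spec; exists 1; split; rewrite ?msize1 ?mcoeff1_0 //.
    by apply/issymP => s; rewrite rmorph1.
  by move=> nu _ []; apply: mnm0_eq.
by move=> _ _ E _; apply: (@mpoly0_eq la); rewrite E mcoeff1_0.
Qed.

Lemma fstar0 la mu : fstar la mu = 1.
Proof. by rewrite /fstar /heckeT Estar0; case: (epsilon _ _) => [|[]]. Qed.

Lemma Fstar0 la mu : Fstar la mu = 1.
Proof.
rewrite (FstarE mu ([ffun=> ord0], [ffun=> (ord0, true)], [ffun j => j], [ffun j => j])).
have chain0 (R : comNzRingType) (Y : finType) (U : nat -> Y -> Y -> R) d p :
  d = 0%N -> chain U d 0 p = 1 by move->.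
by apply: chain0; rewrite /maxpart big_ord0.
Qed.

Lemma Zstar0 la : Zstar la = 1.
Proof.
rewrite /Zstar (perm_big [:: la]) /= ?big_seq1 ?Fstar0 //.
apply: uniq_perm => [||mu]; rewrite ?undup_uniq // mem_undup inE (mnm0_eq mu la) eqxx.
apply/mapP; exists 1%g; first by rewrite mem_enum.
exact: mnm0_eq.
Qed.

End RankZero.

Theorem theorem1p15 (n : nat) (la : 'X_{1..n}) :
  is_partition la ->
  (forall mu : 'X_{1..n}, (exists s : 'S_n, pact s la = mu) ->
     fstar la mu = Fstar la mu)
  /\ Pstar la = Zstar la.
Proof.
case: n la => [|n] la part.
  by split=> [mu _|]; rewrite ?fstar0 ?Fstar0 // Pstar0 Zstar0.
split=> [mu [s /pact_row[v [Ov vmu]]]|].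
  by rewrite (fstar_row part Ov vmu) (Fstar_row Ov vmu).
by rewrite (Pstar_sum part) (Zstar_sum part).
Qed.
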